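(* Let $\pi_{\mathbb U}:\mathrm{Cpt}(\mathbb U)\to\mathcal{GH}$ be the Urysohn chart and let $\mathcal R:=\mathrm{Cpt}(\mathbb U)\times_{\pi_{\mathbb U},\mathcal{GH},\pi_{\mathbb U}}\mathrm{Cpt}(\mathbb U)$, a sheaf on $\mathrm{tbMet}_{\mathrm{lsm}}$. Then the natural morphism $[\mathrm{Cpt}(\mathbb U)/\mathcal R]\to\mathcal{GH}$ is an equivalence of stacks in groupoids over $\mathrm{tbMet}_{\mathrm{lsm}}$. In particular, $\mathcal{GH}$ is a naive metric stack of quotient type.
   Context: Metric spaces. $\mathrm{Met}$ is the category of metric spaces (finite distances) and 1-Lipschitz maps; $\mathrm{tbMet}$ is its full subcategory of totally bounded metric spaces. Products and fiber products in $\mathrm{Met}$ carry the maximum of the two distances. $B_X(x,r)$ is the open ball. $d^H_X$ is the Hausdorff distance on subsets of $X$. A 1-Lipschitz map $f:X\to B$ of metric spaces is a submetry if it is surjective and $d^H_X(f^{-1}(b_0),f^{-1}(b_1))\le d_B(b_0,b_1)$ for all $b_0,b_1\in B$. It is proper if it is a closed map with compact fibers. The lsm site. A 1-Lipschitz map $f:X\to Y$ of metric spaces is a local submetry if for every $x\in X$ there is $r>0$ such that for every $x'\in B_X(x,r)$ and $0<s<r-d_X(x,x')$ one has $f(B_X(x',s))=B_Y(f(x'),s)$. A family $\{f_i:U_i\to X\}_{i\in I}$ in $\mathrm{tbMet}$ is an lsm covering if each $f_i$ is a local submetry and for all $x_1,x_2,x_3\in X$ and $\varepsilon>0$ there are $i\in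 I$ and $u_k\in f_i^{-1}(x_k)$ ($k=1,2,3$) with $d_{U_i}(u_1,u_2)<d_X(x_1,x_2)+\varepsilon$ and $d_{U_i}(u_2,u_3)<d_X(x_2,x_3)+\varepsilon$. These coverings form a Grothendieck pretopology; $\mathrm{tbMet}_{\mathrm{lsm}}$ is the resulting site. Stacks. Fiber products of stacks in groupoids over $\mathrm{tbMet}_{\mathrm{lsm}}$ are 2-fiber products. A metric space $X$ is identified with the sheaf $\mathrm{Hom}_{\mathrm{Met}}(-,X)|_{\mathrm{tbMet}}$ and hence with a stack. $\mathcal X(T)$ denotes the groupoid $\mathrm{Hom}(T,\mathcal X)$. Let $*=\{0\}$, and for $r>0$ let $2_r=\{0,r\}\subset\mathbb R$; $\iota_{0r}:*\to 2_r$ is the map $0\mapsto 0$, and for $r>s>0$, $\iota_{rs}:2_r\to2_s$ is the bijection with $0\mapsto0$. A morphism $f:\mathcal X\to\mathcal Y$ of stacks is a formal submetry if (1) $\mathcal X( * )\to\mathcal Y( * )$ is essentially surjective; and (2) for all real $r>s>0$, morphisms $x:*\to\mathcal X$, $g:2_s\to\mathcal Y$ and every 2-isomorphism $\alpha:f\circ x\Rightarrow g\circ\iota_{0s}$, there are a morphism $h:2_r\to\mathcal X$ and 2-isomorphisms $\beta:h\circ\iota_{0r}\Rightarrow x$, $\gamma:f\circ h\Rightarrow g\circ\iota_{rs}$ with $\alpha\circ(f\star\beta)=\gamma\star\iota_{0r}$ ($\star$ is whiskering). A naive metric stack is a stack $\mathcal X$ admitting a formal submetry $U\to\mathcal X$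 from a metric space $U$. It is of quotient type if there is a formal submetry $U\to\mathcal X$ from a metric space $U$ such that for every $T\in\mathrm{tbMet}$ and $t\in\mathcal X(T)$ there is an lsm covering $\{q_i:U_i\to T\}$ with each $q_i^*t$ in the essential image of $U(U_i)\to\mathcal X(U_i)$. For a groupoid object $\mathcal R\rightrightarrows\mathcal U$ in sheaves on $\mathrm{tbMet}_{\mathrm{lsm}}$, the quotient stack $[\mathcal U/\mathcal R]$ is the stackification of the fibered category associated with the presheaf of groupoids $T\mapsto(\mathcal R(T)\rightrightarrows\mathcal U(T))$. For a morphism $\mathcal U\to\mathcal X$ from a sheaf to a stack and $\mathcal R=\mathcal U\times_{\mathcal X}\mathcal U$, the natural morphism $[\mathcal U/\mathcal R]\to\mathcal X$ is the one induced by the two projections and the canonical 2-isomorphism. $\mathcal{GH}$ is the stack in groupoids over $\mathrm{tbMet}_{\mathrm{lsm}}$ whose objects over $T\in\mathrm{tbMet}$ are the proper submetries $P\to T$ with $P\in\mathrm{Met}$; morphisms are commutative squares in $\mathrm{Met}$ inducing an isomorphism $P_1\cong P_2\times_{T_2}T_1$. The Urysohn chart. $\mathbb U$ is the Urysohn universal space: the complete separable metric space, unique up to isometry, such that for every isometric embedding $i:A\to X$ of finite metric spaces and every isometric embedding $f:A\to\mathbb U$ there is an isometric embedding $\tilde f:X\to\mathbb U$ with $\tilde f\circ i=f$. $\mathrm{Cpt}(\mathbb U)$ is the set of non-empty compact subsets of $\mathbb U$ with the Hausdorff distance. It represents the functor $T\mapsto\{A\subset\mathbb U\times T\mid A\to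 T\text{ is a proper submetry}\}$ on $\mathrm{tbMet}$ (a 1-Lipschitz map $f:T\to\mathrm{Cpt}(\mathbb U)$ corresponds to $A=\{(x,t)\mid x\in f(t)\}$). The Urysohn chart $\pi_{\mathbb U}:\mathrm{Cpt}(\mathbb U)\to\mathcal{GH}$ is the morphism sending $A\subset\mathbb U\times T$ to the object $A\to T$ of $\mathcal{GH}(T)$. *)

(* Defs.v *)
From HB Require Import structures.
From mathcomp Require Import all_boot all_order all_algebra.
From mathcomp Require Import boolp classical_sets functions cardinality reals.
From mathcomp Require Import constructive_ereal ereal topology.

Set Implicit Arguments.
Unset Strict Implicit.
Unset Printing Implicit Defensive.

Import Order.TTheory GRing.Theory Num.Theory.
Import numFieldTopology.Exports.

Local Open Scope classical_set_scope.

Lemma sig_eq (T : Type) (P : T -> Prop) (u v : {x : T | P x}) :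
  sval u = sval v -> u = v.
Proof. by case: u v => [u pu] [v pv] /= uv; exact: eq_exist. Qed.

Record category := Category {
  cobj :> Type;
  chom : cobj -> cobj -> Type;
  idc : forall X, chom X X;
  ccomp : forall X Y Z, chom Y Z -> chom X Y -> chom X Z;
  ccomp1m : forall X Y (f : chom X Y), ccomp (idc Y) f = f;
  ccompm1 : forall X Y (f : chom X Y), ccomp f (idc X) = f;
  ccompA : forall X Y Z W (h : chom Z W) (g : chom Y Z) (f : chom X Y),
    ccomp h (ccomp g f) = ccomp (ccomp h g) f }.
Arguments chom {c} X Y.
Arguments idc {c} X.
Arguments ccomp {c X Y Z} g f.

Declare Scope cat_scope.
Delimit Scope cat_scope with cat.
Local Open Scope cat_scope.
Notation "g ∘ f" := (ccomp g f) (at level 40, left associativity) : cat_scope.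

Record site := Site {
  scat :> category;
  covering : forall (T : scat) (I : Type) (U : I -> scat),
    (forall i, chom (U i) T) -> Prop }.
Arguments covering {s T I U} f.

Record presheaf (C : category) := Presheaf {
  sec :> C -> Type;
  res : forall (S T : C), chom S T -> sec T -> sec S;
  res1 : forall T (x : sec T), res (idc T) x = x;
  resM : forall S T W (g : chom T W) (f : chom S T) (x : sec W),
    res (g ∘ f) x = res f (res g x) }.
Arguments res {C} P {S T} f x : rename.

Record presheaf_map (C : category) (P Q : presheaf C) := PresheafMap {
  pmap :> forall T, P T -> Q T;
  pmap_res : forall S T (f : chom S T) (x : P T),
    pmap (res P f x) = res Q f (pmap x) }.

Definition is_sheaf (C : site) (P : presheaf C) : Prop :=
  forall (T : C) (I : Type) (U : I -> C) (f : forall i, chom (U i) T),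
    covering f ->
  forall s : forall i, P (U i),
    (forall (i j : I) (V : C) (a : chom V (U i)) (b : chom V (U j)),
       f i ∘ a = f j ∘ b -> res P a (s i) = res P b (s j)) ->
  exists! t : P T, forall i, res P (f i) t = s i.

Section Sieve.
Variables (C : category) (T : C) (I : Type) (U : I -> C).
Variable (f : forall i, chom (U i) T).

Definition hom_presheaf : presheaf C :=
  @Presheaf C (fun V => chom V T) (fun V W h g => g ∘ h)
    (fun V g => ccompm1 g) (fun V W X h k g => ccompA g h k).

Definition in_sieve V (g : chom V T) : Prop :=
  exists i, exists a : chom V (U i), g = f i ∘ a.

Lemma in_sieve_comp V W (h : chom V W) (g : chom W T) :
  in_sieve g -> in_sieve (g ∘ h).
Proof. by move=> [i [a ->]]; exists i, (a ∘ h); rewrite ccompA. Qed.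

Definition sieve_presheaf : presheaf C.
Proof.
refine (@Presheaf C (fun V => {g : chom V T | in_sieve g})
  (fun V W h g => exist _ (sval g ∘ h) (in_sieve_comp h (svalP g))) _ _).
- by move=> V g; apply: sig_eq; exact: ccompm1.
- by move=> V W X h k g; apply: sig_eq; exact: ccompA.
Defined.

Definition sieve_incl : presheaf_map sieve_presheaf hom_presheaf :=
  @PresheafMap C sieve_presheaf hom_presheaf
    (fun V (g : sieve_presheaf V) => sval g) (fun _ _ _ _ => erefl).

End Sieve.

(* A category with a functor to [C]: [fob T] is the class of objects over [T],
   [fhom x y] consists of all morphisms from [x] to [y], and [fbase] is the
   action of the functor on morphisms. *)
Record catover (C : category) := Catover {
  fob :> C -> Type;
  fhom : forall S T : C, fob S -> fob T -> Type;
  fbase : forall (S T : C) (x : fob S) (y : fob T), fhom x y -> chom S T;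
  fid : forall (T : C) (x : fob T), fhom x x;
  fcomp : forall (S T W : C) (x : fob S) (y : fob T) (z : fob W),
    fhom y z -> fhom x y -> fhom x z;
  fbase1 : forall T (x : fob T), fbase (fid x) = idc T;
  fbaseM : forall S T W (x : fob S) (y : fob T) (z : fob W)
    (g : fhom y z) (f : fhom x y), fbase (fcomp g f) = fbase g ∘ fbase f;
  fcomp1m : forall S T (x : fob S) (y : fob T) (f : fhom x y),
    fcomp (fid y) f = f;
  fcompm1 : forall S T (x : fob S) (y : fob T) (f : fhom x y),
    fcomp f (fid x) = f;
  fcompA : forall S T W V (x : fob S) (y : fob T) (z : fob W) (w : fob V)
    (h : fhom z w) (g : fhom y z) (f : fhom x y),
    fcomp h (fcomp g f) = fcomp (fcomp h g) f }.
Arguments fhom {C} X {S T} x y : rename.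
Arguments fbase {C X S T x y} f : rename.
Arguments fid {C} X {T} x : rename.
Arguments fcomp {C X S T W x y z} g f : rename.

Notation "g ⊚ f" := (fcomp g f) (at level 40, left associativity) : cat_scope.

Definition all_cartesian (C : category) (X : catover C) : Prop :=
  forall (S T W : C) (x : X S) (y : X T) (z : X W)
    (phi : fhom X y z) (psi : fhom X x z) (h : chom S T),
    fbase phi ∘ h = fbase psi ->
    exists! chi : fhom X x y, fbase chi = h /\ phi ⊚ chi = psi.

Definition fibered_in_groupoids (C : category) (X : catover C) : Prop :=
  (forall (S T : C) (f : chom S T) (y : X T),
     exists (x : X S) (phi : fhom X x y), fbase phi = f)
  /\ all_cartesian X.

Definition fibered_in_sets (C : category) (X : catover C) : Prop :=
  forall (S T : C) (f : chom S T) (y : X T),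
    exists! p : {x : X S & fhom X x y}, fbase (projT2 p) = f.

Record fmor (C : category) (X Y : catover C) := Fmor {
  mob :> forall T, X T -> Y T;
  mhom : forall S T (x : X S) (y : X T), fhom X x y -> fhom Y (mob x) (mob y);
  mhom_base : forall S T (x : X S) (y : X T) (f : fhom X x y),
    fbase (mhom f) = fbase f;
  mhom1 : forall T (x : X T), mhom (fid X x) = fid Y (mob x);
  mhomM : forall S T W (x : X S) (y : X T) (z : X W)
    (g : fhom X y z) (f : fhom X x y), mhom (g ⊚ f) = mhom g ⊚ mhom f }.
Arguments mhom {C X Y} F {S T x y} f : rename.

Definition fmor_id (C : category) (X : catover C) : fmor X X :=
  @Fmor C X X (fun T x => x) (fun S T x y f => f)
    (fun _ _ _ _ _ => erefl) (fun _ _ => erefl) (fun _ _ _ _ _ _ _ _ => erefl).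

Definition fmor_comp (C : category) (X Y Z : catover C)
  (G : fmor Y Z) (F : fmor X Y) : fmor X Z.
Proof.
refine (@Fmor C X Z (fun T x => G T (F T x))
  (fun S T x y f => mhom G (mhom F f)) _ _ _).
- by move=> S T x y f; rewrite !mhom_base.
- by move=> T x; rewrite !mhom1.
- by move=> *; rewrite !mhomM.
Defined.
Notation "G ⊙ F" := (fmor_comp G F) (at level 40, left associativity) : cat_scope.

(* Between morphisms into a category fibered in groupoids every 2-morphism is
   a 2-isomorphism, since morphisms over an identity are then invertible. *)
Record fmor2 (C : category) (X Y : catover C) (F G : fmor X Y) := Fmor2 {
  comp2 :> forall T (x : X T), fhom Y (F T x) (G T x);
  comp2_base : forall T (x : X T), fbase (comp2 x) = idc T;
  comp2_nat : forall S T (x : X S) (y : X T) (f : fhom X x y),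
    comp2 y ⊚ mhom F f = mhom G f ⊚ comp2 x }.

Definition iso2 (C : category) (X Y : catover C) (F G : fmor X Y) : Prop :=
  inhabited (fmor2 F G).

Definition is_equivalence (C : category) (X Y : catover C) (F : fmor X Y) :=
  exists G : fmor Y X, iso2 (G ⊙ F) (fmor_id X) /\ iso2 (F ⊙ G) (fmor_id Y).

(* Precomposition with [J] is an equivalence from the category of morphisms
   [B -> Z] to the category of morphisms [A -> Z]. *)
Definition precomp_equivalence (C : category) (A B : catover C)
    (J : fmor A B) (Z : catover C) : Prop :=
  (forall F : fmor A Z, exists G : fmor B Z, iso2 (G ⊙ J) F) /\
  (forall (G H : fmor B Z) (alpha : fmor2 (G ⊙ J) (H ⊙ J)),
     exists! beta : fmor2 G H,
       forall T (x : A T), beta T (J T x) = alpha T x).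

Section Elements.
Variable C : category.

Definition el_hom (P : presheaf C) S T (f : chom S T) (x : P S) (y : P T)
  (e : x = res P f y) : {f : chom S T | x = res P f y} := exist _ f e.

Lemma el_homM_subproof (P : presheaf C) S T W (g : chom T W) (f : chom S T)
  (x : P S) (y : P T) (z : P W) :
  y = res P g z -> x = res P f y -> x = res P (g ∘ f) z.
Proof. by move=> -> ->; rewrite resM. Qed.

Definition el (P : presheaf C) : catover C.
Proof.
refine (@Catover C P (fun S T x y => {f : chom S T | x = res P f y})
  (fun S T x y f => sval f)
  (fun T x => el_hom (esym (res1 x)))
  (fun S T W x y z g f => el_hom (el_homM_subproof (svalP g) (svalP f)))
  _ _ _ _ _) => /=.
- by [].
- by [].
- by move=> S T x y f; apply: sig_eq; rewrite /= ccomp1m.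
- by move=> S T x y f; apply: sig_eq; rewrite /= ccompm1.
- by move=> *; apply: sig_eq; rewrite /= ccompA.
Defined.

Definition el_cast (P : presheaf C) T (x y : P T) (e : x = y) :
  fhom (el P) x y := el_hom (etrans e (esym (res1 y))).

Lemma el_hom_eq (P : presheaf C) S T (x : el P S) (y : el P T)
  (f g : fhom (el P) x y) : fbase f = fbase g -> f = g.
Proof. exact: sig_eq. Qed.

Definition el_mor (P Q : presheaf C) (u : presheaf_map P Q) :
  fmor (el P) (el Q).
Proof.
refine (@Fmor C (el P) (el Q) u
  (fun S T x y f =>
     @el_hom Q S T (sval f) (u S x) (u T y)
       (etrans (congr1 (u S) (svalP f)) (pmap_res u (sval f) y))) _ _ _).
- by [].
- by move=> T x; exact: el_hom_eq.
- by move=> *; exact: el_hom_eq.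
Defined.

End Elements.
Arguments el_cast {C P T x y} e.

(* Giraud's definition: restriction from the represented category [C / T] to
   the sieve generated by a covering of [T] is an equivalence, i.e. descent
   data for the covering (and their morphisms) are effective. *)
Definition is_stack (C : site) (X : catover C) : Prop :=
  fibered_in_groupoids X /\
  forall (T : C) (I : Type) (U : I -> C) (f : forall i, chom (U i) T),
    covering f -> precomp_equivalence (el_mor (sieve_incl f)) X.

(* Stackification, by its universal property; this determines [Q] and [eta] up
   to an equivalence that is unique up to a unique 2-isomorphism. *)
Definition is_stackification (C : site) (X Q : catover C) (eta : fmor X Q) :
    Prop :=
  is_stack Q /\ forall Z : catover C, is_stack Z -> precomp_equivalence eta Z.

Section FiberProduct.
Variables (C : category) (X Y Z : catover C) (F : fmor X Z) (G : fmor Y Z).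

(* [fpiso] lies over an identity, so it is invertible as soon as [Z] is fibered
   in groupoids. *)
Record fprod_ob (T : C) := FprodOb {
  fp1 : X T;
  fp2 : Y T;
  fpiso : fhom Z (F T fp1) (G T fp2);
  fpiso_base : fbase fpiso = idc T }.

Record fprod_hom S T (p : fprod_ob S) (q : fprod_ob T) := FprodHom {
  fph1 : fhom X (fp1 p) (fp1 q);
  fph2 : fhom Y (fp2 p) (fp2 q);
  fph_base : fbase fph1 = fbase fph2;
  fph_comm : fpiso q ⊚ mhom F fph1 = mhom G fph2 ⊚ fpiso p }.

Lemma fprod_hom_eq S T (p : fprod_ob S) (q : fprod_ob T)
  (a b : fprod_hom p q) : fph1 a = fph1 b -> fph2 a = fph2 b -> a = b.
Proof.
case: a b => [a1 a2 ea ca] [b1 b2 eb cb] /= e1 e2; subst b1 b2.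
by congr FprodHom; exact: Prop_irrelevance.
Qed.

Definition fprod_hom1 T (p : fprod_ob T) : fprod_hom p p.
Proof.
apply: (@FprodHom T T p p (fid X _) (fid Y _)); first by rewrite !fbase1.
by rewrite !mhom1 fcompm1 fcomp1m.
Defined.

Definition fprod_homM S T W (p : fprod_ob S) (q : fprod_ob T)
  (r : fprod_ob W) (g : fprod_hom q r) (f : fprod_hom p q) : fprod_hom p r.
Proof.
apply: (@FprodHom S W p r (fph1 g ⊚ fph1 f) (fph2 g ⊚ fph2 f)).
  by rewrite !fbaseM !fph_base.
by rewrite !mhomM fcompA fph_comm -!fcompA fph_comm.
Defined.

Definition fprod : catover C.
Proof.
refine (@Catover C fprod_ob fprod_hom (fun S T p q f => fbase (fph1 f))
  fprod_hom1 fprod_homM _ _ _ _ _).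
- by move=> *; exact: fbase1.
- by move=> *; exact: fbaseM.
- by move=> *; apply: fprod_hom_eq; exact: fcomp1m.
- by move=> *; apply: fprod_hom_eq; exact: fcompm1.
- by move=> *; apply: fprod_hom_eq; exact: fcompA.
Defined.

End FiberProduct.
Arguments fprod_ob {C X Y Z} F G T.
Arguments fprod_hom {C X Y Z F G S T} p q.
Arguments fprod {C X Y Z} F G.

Section PresheafOfSets.
Variables (C : category) (X : catover C) (HX : fibered_in_sets X).

Definition set_lift S T (f : chom S T) (y : X T) :
  {p : {x : X S & fhom X x y} |
    unique (fun p : {x : X S & fhom X x y} => fbase (projT2 p) = f) p} :=
  cid (HX f y).

Definition set_res S T (f : chom S T) (y : X T) : X S :=
  projT1 (sval (set_lift f y)).

Definition set_res_hom S T (f : chom S T) (y : X T) :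
  fhom X (set_res f y) y := projT2 (sval (set_lift f y)).

Lemma set_res_base S T (f : chom S T) (y : X T) :
  fbase (set_res_hom f y) = f.
Proof. by case: (svalP (set_lift f y)). Qed.

Lemma set_res_unique S T (f : chom S T) (x : X S) (y : X T)
  (phi : fhom X x y) : fbase phi = f -> set_res f y = x.
Proof.
case: (svalP (set_lift f y)) => _ pu e.
exact: (congr1 (@projT1 _ _) (pu (existT _ x phi) e)).
Qed.

Definition psh_of_sets : presheaf C.
Proof.
refine (@Presheaf C X set_res _ _).
- by move=> T x; apply: (set_res_unique (phi := fid X x)); exact: fbase1.
- move=> S T W g f x.
  apply: (set_res_unique (phi := set_res_hom g x ⊚ set_res_hom f _)).
  by rewrite fbaseM !set_res_base.
Defined.

End PresheafOfSets.

(* [gmul r r'] is the composite of the arrow [r] followed by [r']. *)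
Record gpd_object (C : category) := GpdObject {
  gob : presheaf C;
  garr : presheaf C;
  gsrc : presheaf_map garr gob;
  gtgt : presheaf_map garr gob;
  gunit : presheaf_map gob garr;
  ginv : presheaf_map garr garr;
  gmul : forall T (r r' : garr T), gtgt T r = gsrc T r' -> garr T;
  gsrc1 : forall T (u : gob T), gsrc T (gunit T u) = u;
  gtgt1 : forall T (u : gob T), gtgt T (gunit T u) = u;
  gsrcV : forall T (r : garr T), gsrc T (ginv T r) = gtgt T r;
  gtgtV : forall T (r : garr T), gtgt T (ginv T r) = gsrc T r;
  gsrcM : forall T (r r' : garr T) e, gsrc T (@gmul T r r' e) = gsrc T r;
  gtgtM : forall T (r r' : garr T) e, gtgt T (@gmul T r r' e) = gtgt T r';
  gmul_res : forall S T (f : chom S T) (r r' : garr T) e e',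
    res garr f (@gmul T r r' e) = @gmul S (res garr f r) (res garr f r') e';
  gmul1r : forall T (r : garr T) e, @gmul T (gunit T (gsrc T r)) r e = r;
  gmulr1 : forall T (r : garr T) e, @gmul T r (gunit T (gtgt T r)) e = r;
  gmulA : forall T (r s t : garr T) e1 e2 e3 e4,
    @gmul T r (@gmul T s t e1) e2 = @gmul T (@gmul T r s e3) t e4;
  gmulrV : forall T (r : garr T) e,
    @gmul T r (ginv T r) e = gunit T (gsrc T r);
  gmulVr : forall T (r : garr T) e,
    @gmul T (ginv T r) r e = gunit T (gtgt T r) }.
Arguments gmul {C} g {T} r r' e : rename.

Section GpdCatover.
Variables (C : category) (G : gpd_object C).

Record gpd_hom S T (u : gob G S) (v : gob G T) := GpdHom {
  ghom_base : chom S T;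
  ghom_arr : garr G S;
  ghom_src : gsrc G S ghom_arr = u;
  ghom_tgt : gtgt G S ghom_arr = res (gob G) ghom_base v }.

Lemma gpd_hom_eq S T (u : gob G S) (v : gob G T) (f g : gpd_hom u v) :
  ghom_base f = ghom_base g -> ghom_arr f = ghom_arr g -> f = g.
Proof.
case: f g => [f1 f2 ef cf] [g1 g2 eg cg] /= e1 e2; subst g1 g2.
by congr GpdHom; exact: Prop_irrelevance.
Qed.

Lemma gmul_eq T (r1 r1' r2 r2' : garr G T) e1 e2 :
  r1 = r2 -> r1' = r2' -> gmul G r1 r1' e1 = gmul G r2 r2' e2.
Proof.
by move=> E E'; subst r2 r2'; congr gmul; exact: Prop_irrelevance.
Qed.

Definition gpd_hom1 T (u : gob G T) : gpd_hom u u.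
Proof.
apply: (@GpdHom T T u u (idc T) (gunit G T u)); first exact: gsrc1.
by rewrite res1 gtgt1.
Defined.

Lemma gpd_homM_subproof S T W (u : gob G S) (v : gob G T) (w : gob G W)
  (g : gpd_hom v w) (f : gpd_hom u v) :
  gtgt G S (ghom_arr f) = gsrc G S (res (garr G) (ghom_base f) (ghom_arr g)).
Proof. by rewrite ghom_tgt pmap_res ghom_src. Qed.

Definition gpd_homM S T W (u : gob G S) (v : gob G T) (w : gob G W)
  (g : gpd_hom v w) (f : gpd_hom u v) : gpd_hom u w.
Proof.
apply: (@GpdHom S W u w (ghom_base g ∘ ghom_base f)
  (gmul G (ghom_arr f) (res (garr G) (ghom_base f) (ghom_arr g))
     (gpd_homM_subproof g f))); first by rewrite gsrcM ghom_src.
by rewrite gtgtM pmap_res ghom_tgt resM.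
Defined.

Definition gpd_catover : catover C.
Proof.
refine (@Catover C (gob G) gpd_hom (fun S T u v f => ghom_base f)
  gpd_hom1 gpd_homM _ _ _ _ _).
- by [].
- by [].
- move=> S T x y f; apply: gpd_hom_eq => /=; first exact: ccomp1m.
  have e : gtgt G S (ghom_arr f) = gsrc G S (gunit G S (gtgt G S (ghom_arr f))).
    by rewrite gsrc1.
  rewrite -[RHS](gmulr1 e); apply: gmul_eq => //.
  by rewrite -pmap_res ghom_tgt.
- move=> S T x y f; apply: gpd_hom_eq => /=; first exact: ccompm1.
  have e : gtgt G S (gunit G S (gsrc G S (ghom_arr f))) = gsrc G S (ghom_arr f).
    by rewrite gtgt1.
  rewrite -[RHS](gmul1r e); apply: gmul_eq; first by rewrite ghom_src.
  exact: res1.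
- move=> S T W V x y z w h g f; apply: gpd_hom_eq => /=; first exact: ccompA.
  have e : gtgt G S (res (garr G) (ghom_base f) (ghom_arr g)) =
      gsrc G S (res (garr G) (ghom_base f)
        (res (garr G) (ghom_base g) (ghom_arr h))).
    by rewrite !pmap_res ghom_tgt ghom_src.
  have e' : gtgt G S (ghom_arr f) = gsrc G S
      (gmul G (res (garr G) (ghom_base f) (ghom_arr g))
        (res (garr G) (ghom_base f) (res (garr G) (ghom_base g) (ghom_arr h))) e).
    by rewrite gsrcM (gpd_homM_subproof g f).
  have e4 : gtgt G S (gmul G _ _ (gpd_homM_subproof g f)) =
      gsrc G S (res (garr G) (ghom_base f) (res (garr G) (ghom_base g) (ghom_arr h))).
    by rewrite gtgtM e.
  transitivity (gmul G (ghom_arr f) (gmul G _ _ e) e').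
    rewrite (gmulA e' e4).
    by apply: gmul_eq => //; rewrite resM.
  by apply: gmul_eq => //; rewrite gmul_res.
Defined.

End GpdCatover.

(* [Q] together with [eta] is a quotient stack [gob G / garr G]. *)
Definition is_quotient_stack (C : site) (G : gpd_object C) (Q : catover C)
    (eta : fmor (gpd_catover G) Q) : Prop :=
  is_stackification (C := C) eta.

(* The groupoid object [fprod pi pi] over [P], with structure maps given by the
   two projections, the identity, and composition of 2-isomorphisms; and the
   morphism to [X] it induces before stackification. *)
Section Cech.
Variables (C : category) (P : presheaf C) (X : catover C).
Variables (pi : fmor (el P) X) (cX : all_cartesian X).

Lemma el_castid T (u : P T) (e : u = u) : el_cast e = fid (el P) u.
Proof. exact: el_hom_eq. Qed.

Lemma fprod_ob_eq T (p q : fprod_ob pi pi T)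
  (e1 : fp1 p = fp1 q) (e2 : fp2 p = fp2 q) :
  fpiso q ⊚ mhom pi (el_cast e1) = mhom pi (el_cast e2) ⊚ fpiso p -> p = q.
Proof.
case: p q e1 e2 => [x y a ea] [x' y' b eb] /= e1 e2; subst x' y'.
rewrite !el_castid !mhom1 fcompm1 fcomp1m => e; subst b.
by congr FprodOb; exact: Prop_irrelevance.
Qed.

Lemma chart_fiber_product_sets : fibered_in_sets (fprod pi pi).
Proof.
move=> S T f p; pose x := res P f (fp1 p); pose y := res P f (fp2 p).
pose a : fhom (el P) x (fp1 p) := el_hom erefl.
pose b : fhom (el P) y (fp2 p) := el_hom erefl.
have e : fbase (mhom pi b) ∘ idc S = fbase (fpiso p ⊚ mhom pi a).
  by rewrite fbaseM fpiso_base !mhom_base ccompm1 ccomp1m.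
have [chi [[chi1 chiE] chiu]] := cX e.
pose q : fprod pi pi S := FprodOb chi1.
pose h : fhom (fprod pi pi) q p :=
  @FprodHom _ _ _ _ pi pi S T q p a b erefl (esym chiE).
exists (existT _ q h); split=> // -[q' [a' b' e' c']].
rewrite /= /fbase /=.
case: q' a' b' e' c' => [x' y' chi' ec] /= [fa ea] [fb eb] /= e' c' fE.
have e2 : fa = fb by [].
have e3 : fa = f by [].
subst fb fa x' y'.
have ? : chi = chi' by apply: chiu; split => //; rewrite -[RHS]c'.
subst chi'; rewrite /h /q /x /y.
have -> : chi1 = ec by exact: Prop_irrelevance.
congr existT; apply: fprod_hom_eq => /=; exact: el_hom_eq.
Qed.

Definition cech_arr : presheaf C := psh_of_sets chart_fiber_product_sets.

Lemma cech_res_unique S T (f : chom S T) (q : cech_arr S) (p : cech_arr T)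
  (a : fhom (el P) (fp1 q) (fp1 p)) (b : fhom (el P) (fp2 q) (fp2 p)) :
  fbase a = f -> fbase b = f ->
  fpiso p ⊚ mhom pi a = mhom pi b ⊚ fpiso q -> res cech_arr f p = q.
Proof.
move=> ea eb c; have eab : fbase a = fbase b by rewrite ea eb.
exact: (set_res_unique _ (phi := FprodHom eab c : fhom (fprod pi pi) q p) ea).
Qed.

Lemma cech_res_lift S T (f : chom S T) (p : cech_arr T) :
  exists (a : fhom (el P) (fp1 (res cech_arr f p)) (fp1 p))
         (b : fhom (el P) (fp2 (res cech_arr f p)) (fp2 p)),
  [/\ fbase a = f, fbase b = f &
      fpiso p ⊚ mhom pi a = mhom pi b ⊚ fpiso (res cech_arr f p)].
Proof.
have := set_res_base chart_fiber_product_sets f p.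
case: (set_res_hom chart_fiber_product_sets f p) => a b e c fE.
by exists a, b; split => //; rewrite -e.
Qed.

Lemma cech_src_res S T (f : chom S T) (p : cech_arr T) :
  fp1 (res cech_arr f p) = res P f (fp1 p).
Proof.
have [a [_ [e _ _]]] := cech_res_lift f p.
exact: etrans (svalP a) (congr1 (fun h => res P h (fp1 p)) e).
Qed.

Lemma cech_tgt_res S T (f : chom S T) (p : cech_arr T) :
  fp2 (res cech_arr f p) = res P f (fp2 p).
Proof.
have [_ [b [_ e _]]] := cech_res_lift f p.
exact: etrans (svalP b) (congr1 (fun h => res P h (fp2 p)) e).
Qed.

Definition cech_src : presheaf_map cech_arr P :=
  @PresheafMap _ cech_arr P (fun T p => fp1 p) cech_src_res.

Definition cech_tgt : presheaf_map cech_arr P :=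
  @PresheafMap _ cech_arr P (fun T p => fp2 p) cech_tgt_res.

Definition cech_unit_fun T (u : P T) : cech_arr T :=
  @FprodOb _ _ _ _ pi pi T u u (fid X (pi T u)) (fbase1 _).

Lemma cech_unit_res S T (f : chom S T) (u : P T) :
  cech_unit_fun (res P f u) = res cech_arr f (cech_unit_fun u).
Proof.
pose a : fhom (el P) (res P f u) u := el_hom erefl.
apply/esym; apply: (@cech_res_unique S T f (cech_unit_fun (res P f u))
  (cech_unit_fun u) a a) => //=.
by rewrite fcomp1m fcompm1.
Qed.

Definition cech_unit : presheaf_map P cech_arr :=
  @PresheafMap _ P cech_arr cech_unit_fun cech_unit_res.

Lemma cech_mul_subproof T (r r' : cech_arr T) (e : fp2 r = fp1 r') :
  fbase (fpiso r' ⊚ mhom pi (el_cast e) ⊚ fpiso r) = idc T.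
Proof. by rewrite !fbaseM !fpiso_base mhom_base !ccomp1m. Qed.

Definition cech_mul T (r r' : cech_arr T) (e : cech_tgt T r = cech_src T r') :
  cech_arr T := FprodOb (cech_mul_subproof e).

Lemma vert_inv_subproof T (x y : X T) (a : fhom X x y) :
  fbase a = idc T -> fbase a ∘ idc T = fbase (fid X y).
Proof. by move=> ->; rewrite ccompm1 fbase1. Qed.

Definition vert_inv T (x y : X T) (a : fhom X x y) (e : fbase a = idc T) :
  fhom X y x := sval (cid (cX (vert_inv_subproof e))).

Lemma vert_invP T (x y : X T) (a : fhom X x y) (e : fbase a = idc T) :
  [/\ fbase (vert_inv e) = idc T, a ⊚ vert_inv e = fid X y &
      vert_inv e ⊚ a = fid X x].
Proof.
have [[bi abi] _] := svalP (cid (cX (vert_inv_subproof e))).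
split => //; have e' : fbase a ∘ idc T = fbase a by rewrite ccompm1.
have [chi [_ u]] := cX e'; rewrite -(u (fid X x)).
  apply/esym/u; rewrite fbaseM e; split; first by rewrite ccompm1.
  by rewrite fcompA abi fcomp1m.
by rewrite fbase1 fcompm1.
Qed.

Definition cech_inv_fun T (r : cech_arr T) : cech_arr T :=
  FprodOb (let: And3 e _ _ := vert_invP (fpiso_base r) in e).

Lemma cech_inv_res S T (f : chom S T) (r : cech_arr T) :
  cech_inv_fun (res cech_arr f r) = res cech_arr f (cech_inv_fun r).
Proof.
have [a [b [ea eb c]]] := cech_res_lift f r.
apply/esym; apply: (@cech_res_unique _ _ f (cech_inv_fun (res cech_arr f r))
  (cech_inv_fun r) b a) => //=.
have [_ _ v] := vert_invP (fpiso_base r).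
have [_ v' _] := vert_invP (fpiso_base (res cech_arr f r)).
rewrite -[mhom pi b]fcompm1 -v' (fcompA _ (fpiso _)) -c !fcompA v.
by rewrite fcomp1m.
Qed.

Definition cech_inv : presheaf_map cech_arr cech_arr :=
  @PresheafMap _ cech_arr cech_arr cech_inv_fun cech_inv_res.

Lemma pi_eq S T (x : P S) (y : P T) (f g : fhom (el P) x y) :
  fbase f = fbase g -> mhom pi f = mhom pi g.
Proof. by move=> /el_hom_eq ->. Qed.

Lemma pi_vert T (x : P T) (f : fhom (el P) x x) :
  fbase f = idc T -> mhom pi f = fid X (pi T x).
Proof.
by move=> e; rewrite (@pi_eq _ _ _ _ f (fid (el P) x)) ?mhom1 // e fbase1.
Qed.

Lemma cech_mul_res S T (f : chom S T) (r r' : cech_arr T) e e' :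
  res cech_arr f (@cech_mul T r r' e) =
  @cech_mul S (res cech_arr f r) (res cech_arr f r') e'.
Proof.
have [a [b [ea eb c]]] := cech_res_lift f r.
have [a' [b' [ea' eb' c']]] := cech_res_lift f r'.
apply: (@cech_res_unique S T f (cech_mul e') (cech_mul e) a b') => //=.
have k : mhom pi (el_cast e) ⊚ mhom pi b = mhom pi a' ⊚ mhom pi (el_cast e').
  by rewrite -!mhomM; apply: pi_eq; rewrite !fbaseM eb ea' ccomp1m ccompm1.
rewrite -!fcompA c (fcompA _ (mhom pi b)) k -(fcompA (mhom pi a')).
by rewrite (fcompA (fpiso r')) c' -fcompA.
Qed.

Definition cech_groupoid : gpd_object C.
Proof.
refine (@GpdObject C P cech_arr cech_src cech_tgt cech_unit cech_inv cech_mul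
  _ _ _ _ _ _ _ _ _ _ _ _) => //.
- exact: cech_mul_res.
- move=> T r e; have k := @pi_vert T (fp1 r) (el_cast e) erefl.
  apply: (@fprod_ob_eq T (cech_mul e) r erefl erefl).
  rewrite !el_castid !mhom1 fcompm1 fcomp1m [fpiso (cech_mul _)]/=.
  by rewrite fcompm1 [mhom pi _]k fcompm1.
- move=> T r e; have k := @pi_vert T (fp2 r) (el_cast e) erefl.
  apply: (@fprod_ob_eq T (cech_mul e) r erefl erefl).
  rewrite !el_castid !mhom1 fcompm1 fcomp1m [fpiso (cech_mul _)]/=.
  by rewrite fcomp1m [mhom pi _]k fcomp1m.
- move=> T r s t e1 e2 e3 e4.
  apply: (@fprod_ob_eq T (cech_mul e2) (cech_mul e4) erefl erefl) => /=.
  rewrite !el_castid !mhom1 fcompm1 fcomp1m !fcompA.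
  by rewrite (@pi_eq _ _ _ _ (el_cast e4) (el_cast e1)) //
    (@pi_eq _ _ _ _ (el_cast e2) (el_cast e3)).
- move=> T r e; have k := @pi_vert T (fp2 r) (el_cast e) erefl.
  apply: (@fprod_ob_eq T (cech_mul e) (cech_unit_fun (fp1 r)) erefl erefl).
  rewrite !el_castid !mhom1 fcompm1 fcomp1m [fpiso (cech_mul _)]/=.
  by rewrite [mhom pi _]k fcompm1; have [_ _ ->] := vert_invP (fpiso_base r).
- move=> T r e; have k := @pi_vert T (fp1 r) (el_cast e) erefl.
  apply: (@fprod_ob_eq T (cech_mul e) (cech_unit_fun (fp2 r)) erefl erefl).
  rewrite !el_castid !mhom1 fcompm1 fcomp1m [fpiso (cech_mul _)]/=.
  by rewrite [mhom pi _]k fcompm1; have [_ -> _] := vert_invP (fpiso_base r).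
Defined.

(* An arrow of the fibered category from [u] over [S] to [v] over [T] is a base
   map [f] with an arrow [r] from [u] to the restriction of [v] along [f]; it is
   sent to the composite of the 2-isomorphism carried by [r] and of the
   cartesian morphism over [f] with target [pi v]. *)
Definition cech_mor_hom S T (u : gpd_catover cech_groupoid S)
    (v : gpd_catover cech_groupoid T) (h : fhom _ u v) :
    fhom X (pi S u) (pi T v) :=
  mhom pi (el_hom (ghom_tgt h)) ⊚ fpiso (ghom_arr h) ⊚
    mhom pi (el_cast (esym (ghom_src h))).

Definition cech_mor : fmor (gpd_catover cech_groupoid) X.
Proof.
refine (@Fmor C (gpd_catover cech_groupoid) X (fun T u => pi T u)
  cech_mor_hom _ _ _).
- move=> S T x y f; rewrite /cech_mor_hom !fbaseM fpiso_base !mhom_base.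
  by rewrite ccompm1 [RHS]/= -[RHS]ccompm1.
- move=> T x; rewrite /cech_mor_hom /= fcompm1.
  by rewrite !pi_vert // fcomp1m.
- move=> S T W x y z g f; rewrite /cech_mor_hom /=.
  have [a [b [ea eb c]]] := cech_res_lift (ghom_base f) (ghom_arr g).
  rewrite (_ : mhom pi (el_hom _) =
    mhom pi (el_hom (ghom_tgt g)) ⊚ mhom pi b); last first.
    by rewrite -mhomM; apply: pi_eq; rewrite fbaseM eb.
  rewrite -!(fcompA (mhom pi (el_hom (ghom_tgt g)))); congr (_ ⊚ _).
  rewrite !fcompA -c -!(fcompA (fpiso (ghom_arr g))); congr (_ ⊚ _).
  rewrite -!mhomM; congr (_ ⊚ _ ⊚ _); last exact: pi_eq.
  by apply: pi_eq; rewrite !fbaseM ea ccompm1 [RHS]ccomp1m.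
Defined.

(* By the universal property of [eta], such a [Phi] is unique up to a unique
   2-isomorphism compatible with the given one. *)
Definition is_natural_morphism (Q : catover C)
    (eta : fmor (gpd_catover cech_groupoid) Q) (Phi : fmor Q X) : Prop :=
  iso2 (Phi ⊙ eta) cech_mor.

End Cech.
Local Open Scope ring_scope.

Section Metric.
Variable R : realType.
Implicit Types X Y Z : metricType R.

Record lip1 X Y := Lip1 {
  lip_fun :> X -> Y;
  lip_le : forall x y, mdist (lip_fun x) (lip_fun y) <= mdist x y }.

Lemma lip1_eq X Y (f g : lip1 X Y) : (forall x, f x = g x) -> f = g.
Proof.
case: f g => [f fl] [g gl] /= /funext fg; subst g.
by congr Lip1; exact: Prop_irrelevance.
Qed.

Definition lip_id X : lip1 X X := @Lip1 X X id (fun _ _ => lexx _).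

Definition lip_comp X Y Z (g : lip1 Y Z) (f : lip1 X Y) : lip1 X Z :=
  @Lip1 X Z (g \o f) (fun x y => le_trans (lip_le g _ _) (lip_le f x y)).

Definition is_isometry X Y (f : X -> Y) : Prop :=
  forall x y, mdist (f x) (f y) = mdist x y.

Definition lip_iso X Y (f : lip1 X Y) : Prop :=
  exists g : lip1 Y X, cancel f g /\ cancel g f.

Lemma lip_isoP X Y (f : lip1 X Y) :
  lip_iso f <-> is_isometry f /\ forall y, exists x, f x = y.
Proof.
split=> [[g [fg gf]]|[fi fs]].
  split=> [x y|y]; last by exists (g y); rewrite gf.
  by apply/le_anti; rewrite lip_le -{1}(fg x) -{1}(fg y) lip_le.
pose g y := sval (cid (fs y)).
have gE y : f (g y) = y by rewrite /g; case: cid.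
have gl x y : mdist (g x) (g y) <= mdist x y by rewrite -fi !gE.
exists (Lip1 gl); split=> //= x; apply: mdist_positivity.
by rewrite -fi gE mdistxx.
Qed.

End Metric.

Definition subsp (R : realType) (X : metricType R) (A : set X) : Type :=
  {x : X | A x}.

Section Subspace.
Variables (R : realType) (X : metricType R) (A : set X).
Let d (x y : subsp A) : R := mdist (sval x) (sval y).

Let dxx x : d x x = 0. Proof. exact: mdistxx. Qed.
Let dpos x y : d x y = 0 -> x = y.
Proof. by move=> /mdist_positivity; exact: sig_eq. Qed.
Let dsym x y : d x y = d y x. Proof. exact: metric_sym. Qed.
Let dtri y x z : d x z <= d x y + d y z. Proof. exact: metric_triangle. Qed.

HB.instance Definition _ := gen_eqMixin (subsp A).
HB.instance Definition _ := gen_choiceMixin (subsp A).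
HB.instance Definition _ :=
  isMetric.Build R (subsp A) dxx dpos dsym dtri.

End Subspace.

Definition maxprod (R : realType) (X Y : metricType R) : Type := (X * Y)%type.

Section MaxProduct.
Variables (R : realType) (X Y : metricType R).
Let d (p q : maxprod X Y) : R := Num.max (mdist p.1 q.1) (mdist p.2 q.2).

Let dxx p : d p p = 0. Proof. by rewrite /d !mdistxx maxxx. Qed.
Let dpos p q : d p q = 0 -> p = q.
Proof.
case: p q => [x y] [x' y']; rewrite /d /= => e.
have e1 : mdist x x' = 0.
  by apply/le_anti; rewrite mdist_ge0 andbT -e le_max lexx.
have e2 : mdist y y' = 0.
  by apply/le_anti; rewrite mdist_ge0 andbT -e le_max lexx orbT.
by rewrite (mdist_positivity _ _ e1) (mdist_positivity _ _ e2).
Qed.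
Let dsym p q : d p q = d q p.
Proof. by rewrite /d metric_sym [mdist p.2 _]metric_sym. Qed.
Let dtri q p r : d p r <= d p q + d q r.
Proof.
rewrite {1}/d ge_max; apply/andP; split.
  by rewrite (le_trans (metric_triangle _ q.1 _))// lerD// le_max lexx.
by rewrite (le_trans (metric_triangle _ q.2 _))// lerD// le_max lexx orbT.
Qed.

HB.instance Definition _ := gen_eqMixin (maxprod X Y).
HB.instance Definition _ := gen_choiceMixin (maxprod X Y).
HB.instance Definition _ :=
  isMetric.Build R (maxprod X Y) dxx dpos dsym dtri.

End MaxProduct.

Section Hausdorff.
Variable R : realType.
Implicit Types X Y Z : metricType R.

Definition fiber_product X Y Z (f : lip1 X Z) (g : lip1 Y Z) : metricType R :=
  subsp [set p : maxprod X Y | f p.1 = g p.2].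

Lemma fiber_pair_le X Y Z (W : metricType R) (f : lip1 X Z) (g : lip1 Y Z)
  (a : lip1 W X) (b : lip1 W Y) (e : forall w, f (a w) = g (b w)) v w :
  mdist (exist _ (a v, b v) (e v) : fiber_product f g)
        (exist _ (a w, b w) (e w) : fiber_product f g) <= mdist v w.
Proof. by rewrite /mdist /= ge_max !lip_le. Qed.

Definition fiber_pair X Y Z (W : metricType R) (f : lip1 X Z) (g : lip1 Y Z)
  (a : lip1 W X) (b : lip1 W Y) (e : forall w, f (a w) = g (b w)) :
  lip1 W (fiber_product f g) := Lip1 (fiber_pair_le e).

Local Open Scope ereal_scope.

Definition set_dist X (x : X) (B : set X) : \bar R :=
  ereal_inf [set (mdist x b)%:E | b in B].

Definition hausdorff_dist X (A B : set X) : \bar R :=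
  maxe (ereal_sup [set set_dist a B | a in A])
       (ereal_sup [set set_dist b A | b in B]).

Lemma set_dist_le X (x : X) (B : set X) (r : R) :
  set_dist x B <= r%:E <->
  forall e : R, (0 < e)%R -> exists2 b, B b & (mdist x b < r + e)%R.
Proof.
split=> [h e e0|h].
  have /ereal_inf_lt[_ [b Bb <-]] : set_dist x B < (r + e)%:E.
    by rewrite (le_lt_trans h)// lte_fin ltrDl.
  by rewrite lte_fin; exists b.
apply/lee_addgt0Pr => e e0; have [b Bb xb] := h e e0.
by apply: ge_ereal_inf; exists (mdist x b)%:E; [exists b|rewrite -EFinD lee_fin ltW].
Qed.

Lemma hausdorff_dist_le X (A B : set X) (r : R) :
  hausdorff_dist A B <= r%:E <->
  (forall a, A a -> forall e : R, (0 < e)%R ->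
     exists2 b, B b & (mdist a b < r + e)%R) /\
  (forall b, B b -> forall e : R, (0 < e)%R ->
     exists2 a, A a & (mdist b a < r + e)%R).
Proof.
rewrite /hausdorff_dist ge_max; split=> [/andP[/ereal_supP h1 /ereal_supP h2]|].
  split=> x Ax; apply/set_dist_le.
    by apply: h1; exists x.
  by apply: h2; exists x.
move=> [h1 h2]; apply/andP; split; apply: ge_ereal_sup => _ [x Ax <-].
  by apply/set_dist_le => e; apply: h1.
by apply/set_dist_le => e; apply: h2.
Qed.

Lemma hausdorff_distC X (A B : set X) : hausdorff_dist A B = hausdorff_dist B A.
Proof. exact: maxC. Qed.

Lemma hausdorff_dist_ge0 X (A B : set X) : A !=set0 -> 0 <= hausdorff_dist A B.
Proof.
move=> [a Aa]; rewrite /hausdorff_dist le_max; apply/orP; left.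
apply: (le_trans _ (ereal_sup_ubound _)); last by exists a.
by apply: le_ereal_inf_tmp => _ [b Bb <-]; rewrite lee_fin mdist_ge0.
Qed.

End Hausdorff.

Section Submetry.
Variable R : realType.
Implicit Types X Y Z B : metricType R.

Definition submetry X B (f : lip1 X B) : Prop :=
  (forall b, exists x, f x = b) /\
  forall b0 b1,
    (hausdorff_dist (f @^-1` [set b0]) (f @^-1` [set b1])
       <= (mdist b0 b1)%:E)%E.

Definition proper X B (f : lip1 X B) : Prop :=
  (forall A : set X, closed A -> closed (f @` A)) /\
  forall b, compact (f @^-1` [set b]).

Lemma submetry_proper X B (f : lip1 X B) :
  submetry f -> (forall b, compact (f @^-1` [set b])) -> proper f.
Proof.
move=> [_ fH] fK; split=> // A cA b clb; apply: contrapT => nAb.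
have : near_covering (f @^-1` [set b]) by apply/compact_near_coveringP/fK.
move=> /(_ R (0%R^'+) (fun e x => forall y, mdist x y < e -> ~ A y)
    (at_right_proper_filter 0))[].
  move=> x fx; have nAx : ~ A x by move=> Ax; apply: nAb; exists x.
  have : nbhs x (~` A) by apply: open_nbhs_nbhs; split=> //; exact: closed_openC.
  rewrite -nbhs_ballE => -[d /= d0 dA].
  exists (ball x (d / 2), [set e | e < d / 2]); first split.
  - by apply: nbhsx_ballx; rewrite divr_gt0.
  - by apply: nbhs_right_lt; rewrite divr_gt0.
  move=> [x' e] /= [xx' ed] y x'y; apply: dA.
  rewrite [d]splitr; apply: ball_triangle xx' _.
  by rewrite ballEmdist /=; exact: lt_trans ed.
move=> e0 /= e00 he; pose e := e0 / 2; have e_gt0 : 0 < e by rewrite divr_gt0.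
have hE x y : f x = b -> mdist x y < e -> ~ A y.
  move=> fx; apply: (he e) => //=.
  by rewrite sub0r normrN gtr0_norm// /e ltr_pdivrMr// ltr_pMr// ltr1n.
have [_ [[y Ay <-] yb]] : f @` A `&` ball b (e / 2) !=set0.
  by apply: clb; apply: nbhsx_ballx; rewrite divr_gt0.
have /hausdorff_dist_le[h _] := fH (f y) b.
have e2 : 0 < e / 2 by rewrite divr_gt0.
have [x fx yx] := h y erefl _ e2.
apply: (hE x y fx _ Ay); rewrite metric_sym (lt_trans yx)// [ltRHS]splitr.
by rewrite ltrD2r metric_sym; move: yb; rewrite ballEmdist.
Unshelve. all: by end_near. Qed.

Lemma compact_isometry X Y (phi : X -> Y) (K : set X) :
  (forall x y, K x -> K y -> mdist (phi x) (phi y) = mdist x y) ->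
  compact (phi @` K) -> compact K.
Proof.
move=> phiE cK F PF FK.
have GK : (phi @ F) (phi @` K).
  by rewrite /fmap /=; apply: filterS FK => x Kx; exists x.
have [_ [[p Kp <-] cp]] := cK (phi @ F) _ GK.
exists p; split=> // A V FA; rewrite -nbhs_ballE => -[e /= e0 eV].
have GA : (phi @ F) (phi @` (A `&` K)).
  by rewrite /fmap /=; apply: filterS (filterI FA FK) => x AKx; exists x.
have [_ [[q [Aq Kq] <-] pq]] := cp _ _ GA (nbhsx_ballx (phi p) e e0).
exists q; split=> //; apply: eV; move: pq; rewrite !ballEmdist /=.
by rewrite phiE.
Qed.

Lemma compact_bounded X (K : set X) (x : X) :
  compact K -> exists r : R, forall y, K y -> mdist x y < r.
Proof.
move=> /compact_near_coveringP.
move=> /(_ R (0%R^'+) (fun e y => 0 < e -> mdist x y < e^-1)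
    (at_right_proper_filter 0))[].
  move=> y _; have y0 : 0 < mdist x y + 1 by rewrite ltr_wpDl// mdist_ge0.
  exists (ball y 1, [set e | e < (mdist x y + 1)^-1]); first split.
  - exact: nbhsx_ballx.
  - by apply: nbhs_right_lt; rewrite invr_gt0.
  move=> [z e] /= [yz ey] e0; rewrite (@lt_trans _ _ (mdist x y + 1))//.
    rewrite (le_lt_trans (metric_triangle _ y _))// ltrD2l.
    by move: yz; rewrite ballEmdist.
  by rewrite -[ltLHS]invrK ltf_pV2// posrE invr_gt0.
move=> e0 /= e00 he; have e_gt0 : 0 < e0 / 2 by rewrite divr_gt0.
exists (e0 / 2)^-1 => y Ky; apply: he => //=.
by rewrite sub0r normrN gtr0_norm// ltr_pdivrMr// ltr_pMr// ltr1n.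
Qed.

End Submetry.

Definition Cpt (R : realType) (X : metricType R) : Type :=
  {K : set X | compact K /\ K !=set0}.

Section CptMetric.
Variables (R : realType) (X : metricType R).
Let d (K L : Cpt X) : R := fine (hausdorff_dist (sval K) (sval L)).

Lemma cpt_dist_fin (K L : Cpt X) :
  (fine (hausdorff_dist (sval K) (sval L)))%:E
  = hausdorff_dist (sval K) (sval L).
Proof.
rewrite fineK// ge0_fin_numE; last exact: hausdorff_dist_ge0 (proj2 (svalP K)).
have [cK [k Kk]] := svalP K; have [cL [l Ll]] := svalP L.
have [r hr] := compact_bounded l cK; have [s hs] := compact_bounded k cL.
apply: (@le_lt_trans _ _ (Num.max r s)%:E); last exact: ltry.
apply/hausdorff_dist_le; split=> [x Kx|x Lx] e e0.
  exists l => //; rewrite metric_sym (lt_le_trans (hr x Kx))//.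
  by rewrite (@le_trans _ _ (Num.max r s))// ?le_max ?lexx// lerDl ltW.
exists k => //; rewrite metric_sym (lt_le_trans (hs x Lx))//.
by rewrite (@le_trans _ _ (Num.max r s))// ?le_max ?lexx ?orbT// lerDl ltW.
Qed.

Lemma cpt_dist_le (K L : Cpt X) (r : R) :
  fine (hausdorff_dist (sval K) (sval L)) <= r <->
  (forall a, sval K a -> forall e : R, (0 < e)%R ->
     exists2 b, sval L b & (mdist a b < r + e)%R) /\
  (forall b, sval L b -> forall e : R, (0 < e)%R ->
     exists2 a, sval K a & (mdist b a < r + e)%R).
Proof. by rewrite -hausdorff_dist_le -cpt_dist_fin lee_fin. Qed.

Let dge0 K L : 0 <= d K L.
Proof. by rewrite fine_ge0// hausdorff_dist_ge0//; exact: (proj2 (svalP K)). Qed.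

Let dxx K : d K K = 0.
Proof.
apply/le_anti; rewrite dge0 andbT; apply/cpt_dist_le.
by split=> a Ka e e0; exists a; rewrite // mdistxx add0r.
Qed.

Let dsym K L : d K L = d L K.
Proof. by rewrite /d hausdorff_distC. Qed.

Let dsub K L : d K L = 0 -> sval K `<=` sval L.
Proof.
move=> e; have /cpt_dist_le[h _] : d K L <= 0 by rewrite e.
move=> x /h {}h.
have /closure_id -> : closed (sval L).
  by apply: compact_closed; [exact: metric_hausdorff|exact: (proj1 (svalP L))].
move=> V; rewrite -nbhs_ballE => -[r /= r0 rV].
have [b Lb xb] := h r r0; exists b; split=> //; apply: rV.
by rewrite ballEmdist /= -[r]add0r.
Qed.

Let dpos K L : d K L = 0 -> K = L.
Proof.
move=> e; apply: sig_eq; apply/seteqP.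
by split; apply: dsub => //; rewrite dsym.
Qed.

Let dtri L K M : d K M <= d K L + d L M.
Proof.
have /cpt_dist_le[h1 h2] := lexx (d K L).
have /cpt_dist_le[h3 h4] := lexx (d L M).
have H (a b e : R) : a + b + e = (a + e / 2) + (b + e / 2).
  by rewrite addrACA -splitr.
apply/cpt_dist_le; split=> x Kx e e0; have e2 : 0 < e / 2 by rewrite divr_gt0.
- have [y Ly xy] := h1 x Kx _ e2; have [z Mz yz] := h3 y Ly _ e2.
  exists z => //; rewrite H.
  by rewrite (le_lt_trans (metric_triangle _ y _))// ltrD.
- have [y Ly xy] := h4 x Kx _ e2; have [z Mz yz] := h2 y Ly _ e2.
  exists z => //; rewrite H.
  by rewrite (le_lt_trans (metric_triangle _ y _))// addrC ltrD.
Qed.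

HB.instance Definition _ := gen_eqMixin (Cpt X).
HB.instance Definition _ := gen_choiceMixin (Cpt X).
HB.instance Definition _ := isMetric.Build R (Cpt X) dxx dpos dsym dtri.

End CptMetric.

Section TbMet.
Variable R : realType.
Implicit Types X Y Z B : metricType R.

Definition urysohn_universal (U : metricType R) : Prop :=
  [/\ forall F : set_system U, ProperFilter F -> cauchy F ->
        exists x : U, F --> x,
      exists2 D : set U, countable D & dense D
    & forall (A X : metricType R) (i : A -> X) (f : A -> U),
        finite_set [set: A] -> finite_set [set: X] ->
        is_isometry i -> is_isometry f ->
        exists2 g : X -> U, is_isometry g & forall a, g (i a) = f a].

Definition totally_bounded X : Prop :=
  forall e : R, 0 < e ->
  exists2 F : set X, finite_set F & [set: X] `<=` \bigcup_(x in F) ball x e.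

Record tbMet_obj := TbMet {
  tb_space :> metricType R;
  tb_bounded : totally_bounded tb_space }.

Definition tbMet : category.
Proof.
refine (@Category tbMet_obj (fun S T => lip1 S T) (fun T => lip_id T)
  (fun S T W g f => lip_comp g f) _ _ _).
- by move=> *; exact: lip1_eq.
- by move=> *; exact: lip1_eq.
- by move=> *; exact: lip1_eq.
Defined.

Definition local_submetry X Y (f : lip1 X Y) : Prop :=
  forall x : X, exists2 r : R, 0 < r &
  forall (x' : X) (s : R), ball x r x' -> 0 < s < r - mdist x x' ->
    f @` ball x' s = ball (f x') s.

Definition lsm_covering (X : tbMet) (I : Type) (U : I -> tbMet)
    (f : forall i, chom (U i) X) : Prop :=
  (forall i, local_submetry (f i)) /\
  forall (x1 x2 x3 : tb_space X) (e : R), 0 < e ->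
  exists (i : I) (u1 u2 u3 : tb_space (U i)),
    [/\ f i u1 = x1, f i u2 = x2, f i u3 = x3,
        mdist u1 u2 < mdist x1 x2 + e & mdist u2 u3 < mdist x2 x3 + e].

Definition tbMet_lsm : site := @Site tbMet lsm_covering.

Definition met_presheaf X : presheaf tbMet.
Proof.
refine (@Presheaf tbMet (fun T : tbMet_obj => lip1 T X)
  (fun S T f x => lip_comp x f) _ _).
- by move=> *; exact: lip1_eq.
- by move=> *; exact: lip1_eq.
Defined.

Definition met X : catover tbMet := el (met_presheaf X).

Definition met_presheaf_map X Y (f : lip1 X Y) :
  presheaf_map (met_presheaf X) (met_presheaf Y).
Proof.
refine (@PresheafMap tbMet (met_presheaf X) (met_presheaf Y)
  (fun T x => lip_comp f x) _).
by move=> *; exact: lip1_eq.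
Defined.

Definition met_map X Y (f : lip1 X Y) : fmor (met X) (met Y) :=
  el_mor (met_presheaf_map f).

Definition pt : metricType R := subsp [set x : R^o | x = 0].

Definition two (r : R) : metricType R := subsp [set x : R^o | x = 0 \/ x = r].

Definition two0 (r : R) : two r := exist _ 0 (or_introl erefl).

Definition two1 (r : R) : two r := exist _ r (or_intror erefl).

Lemma iota0_le (r : R) (x y : pt) : mdist (two0 r) (two0 r) <= mdist x y.
Proof. by rewrite mdistxx mdist_ge0. Qed.

Definition iota0 (r : R) : lip1 pt (two r) := Lip1 (@iota0_le r).

Definition iota_fun (r s : R) (x : two r) : two s :=
  if sval x == 0 then two0 s else two1 s.

Lemma iota_le (r s : R) : 0 < s < r -> forall x y : two r,
  mdist (iota_fun s x) (iota_fun s y) <= mdist x y.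
Proof.
move=> /andP[s0 sr] [x hx] [y hy]; rewrite /iota_fun /mdist /= /mdist /=.
have r0 := lt_trans s0 sr.
by case: hx => ->; case: hy => ->; rewrite ?eqxx ?(gt_eqF r0) /=
  ?subrr ?normr0// ?sub0r ?subr0 ?normrN !gtr0_norm// ltW.
Qed.

Definition iota (r s : R) (h : 0 < s < r) : lip1 (two r) (two s) :=
  Lip1 (iota_le h).

Lemma iota_iota0 (r s : R) (h : 0 < s < r) (T : tbMet) (t : met pt T) :
  met_map (iota h) T (met_map (iota0 r) T t) = met_map (iota0 s) T t
  :> met_presheaf (two s) T.
Proof. by apply: lip1_eq => x; rewrite /= /iota_fun /= eqxx. Qed.

(* The last equation is the equality of 2-morphisms between
   [f ⊙ h ⊙ met_map (iota0 r)] and [g ⊙ met_map (iota0 s)], evaluated at an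
   arbitrary object [t] of [met pt]; [el_cast] is the identity 2-isomorphism
   [met_map (iota h) ⊙ met_map (iota0 r) = met_map (iota0 s)]. *)
Definition formal_submetry (X Y : catover tbMet) (f : fmor X Y) : Prop :=
  (forall y : fmor (met pt) Y, exists x : fmor (met pt) X, iso2 (f ⊙ x) y) /\
  forall (r s : R) (rs : 0 < s < r) (x : fmor (met pt) X)
    (g : fmor (met (two s)) Y)
    (alpha : fmor2 (f ⊙ x) (g ⊙ met_map (iota0 s))),
  exists (h : fmor (met (two r)) X)
    (beta : fmor2 (h ⊙ met_map (iota0 r)) x)
    (gamma : fmor2 (f ⊙ h) (g ⊙ met_map (iota rs))),
  forall (T : tbMet) (t : met pt T),
    alpha T t ⊚ mhom f (beta T t) =
    mhom g (el_cast (iota_iota0 rs t)) ⊚ gamma T (met_map (iota0 r) T t).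

Definition naive_metric_stack (X : catover tbMet) : Prop :=
  is_stack (C := tbMet_lsm) X /\
  exists (U : metricType R) (f : fmor (met U) X), formal_submetry f.

Definition quotient_type (X : catover tbMet) : Prop :=
  exists (U : metricType R) (p : fmor (met U) X),
  formal_submetry p /\
  forall (T : tbMet) (t : fmor (met T) X),
  exists (I : Type) (V : I -> tbMet) (q : forall i, chom (V i) T),
    lsm_covering q /\
    forall i, exists u : fmor (met (V i)) (met U),
      iso2 (p ⊙ u) (t ⊙ met_map (q i)).

Record proper_submetry (T : metricType R) := ProperSubmetry {
  ps_total : metricType R;
  ps_map :> lip1 ps_total T;
  ps_submetry : submetry ps_map;
  ps_proper : proper ps_map }.

Record cart_square (S T : metricType R)
    (P : proper_submetry S) (Q : proper_submetry T) := CartSquare {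
  sq_top : lip1 (ps_total P) (ps_total Q);
  sq_base : lip1 S T;
  sq_comm : forall p, Q (sq_top p) = sq_base (P p);
  sq_cart : lip_iso (fiber_pair sq_comm) }.

Lemma fiber_pair_iso X Y Z (W : metricType R) (f : lip1 X Z) (g : lip1 Y Z)
    (a : lip1 W X) (b : lip1 W Y) (e : forall w, f (a w) = g (b w)) :
  lip_iso (fiber_pair e) <->
  (forall v w, Num.max (mdist (a v) (a w)) (mdist (b v) (b w)) = mdist v w) /\
  (forall x y, f x = g y -> exists w, a w = x /\ b w = y).
Proof.
rewrite lip_isoP; split=> -[hi hs]; split=> //.
- move=> x y exy; have [w] := hs (exist _ (x, y) exy).
  by move=> /(congr1 sval)[<- <-]; exists w.
- move=> [[x y] exy]; have [w [ax bw]] := hs x y exy.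
  by exists w; apply: sig_eq; rewrite /= ax bw.
Qed.

Section Squares.
Variables (S T W : metricType R).
Variables (P : proper_submetry S) (Q : proper_submetry T).
Variable (M : proper_submetry W).

Lemma cart_square_eq (f g : cart_square P Q) :
  (forall x, sq_top f x = sq_top g x) ->
  (forall x, sq_base f x = sq_base g x) -> f = g.
Proof.
case: f g => [a b c d] [a' b' c' d'] /= /lip1_eq ea /lip1_eq eb; subst a' b'.
have ec : c = c' by exact: Prop_irrelevance.
by subst c'; congr CartSquare; exact: Prop_irrelevance.
Qed.

Definition cart_square_id : cart_square P P.
Proof.
apply: (@CartSquare _ _ P P (lip_id _) (lip_id S) (fun=> erefl)).
apply/fiber_pair_iso; split=> [v w|x y e]; last by exists x.
by apply: max_l; exact: lip_le.
Defined.

Definition cart_square_comp (g : cart_square Q M) (f : cart_square P Q) :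
  cart_square P M.
Proof.
apply: (@CartSquare _ _ P M (lip_comp (sq_top g) (sq_top f))
  (lip_comp (sq_base g) (sq_base f))
  (fun p => etrans (sq_comm g _) (congr1 _ (sq_comm f p)))).
have /fiber_pair_iso[gd gs] := sq_cart g.
have /fiber_pair_iso[fd fs] := sq_cart f.
apply/fiber_pair_iso; split=> [v w /=|x y /= e].
  rewrite -[RHS]fd -[in RHS]gd -maxA; congr Num.max.
  rewrite !sq_comm [in RHS]max_r//; exact: lip_le.
have [q [qx qy]] := gs x (sq_base f y) e.
by have [p [pq py]] := fs q y qy; exists p; rewrite pq qx.
Defined.

End Squares.

Definition GH : catover tbMet.
Proof.
refine (@Catover tbMet (fun T : tbMet_obj => proper_submetry T)
  (fun S T P Q => cart_square P Q) (fun S T P Q f => sq_base f)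
  (fun T P => cart_square_id P)
  (fun S T W P Q M g f => cart_square_comp g f) _ _ _ _ _).
- by [].
- by [].
- by move=> *; exact: cart_square_eq.
- by move=> *; exact: cart_square_eq.
- by move=> *; exact: cart_square_eq.
Defined.

Lemma GH_cartesian : all_cartesian GH.
Proof.
move=> S T W P Q M phi psi h.
rewrite /= => /(congr1 (fun f : lip1 S W => f : S -> W)) e.
have /fiber_pair_iso[fd fs] := sq_cart phi.
have /fiber_pair_iso[pd ps] := sq_cart psi.
have k p : exists q, sq_top phi q = sq_top psi p /\ Q q = h (P p).
  apply: fs; rewrite sq_comm -e //.
pose c p := sval (cid (k p)).
have c1 p : sq_top phi (c p) = sq_top psi p by case: (svalP (cid (k p))).
have c2 p : Q (c p) = h (P p) by case: (svalP (cid (k p))).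
have cl p p' : mdist (c p) (c p') <= mdist p p'.
  by rewrite -fd !c1 !c2 ge_max lip_le (le_trans (lip_le h _ _))// lip_le.
have cc : lip_iso (fiber_pair (c2 : forall p, Q (Lip1 cl p) = h (P p))).
  apply/fiber_pair_iso; split=> [v w|x y exy] /=.
    rewrite -fd !c1 !c2 -[RHS]pd -maxA; congr Num.max.
    by rewrite max_r// lip_le.
  have [p [px py]] : exists p, sq_top psi p = sq_top phi x /\ P p = y.
    by apply: ps; rewrite sq_comm exy -e.
  exists p; split=> //; apply: mdist_positivity; rewrite -fd c1 c2 px py exy.
  by rewrite !mdistxx maxxx.
exists (CartSquare cc : fhom GH P Q); split.
  by split=> //; apply: cart_square_eq => // x /=; rewrite -e.
move=> chi [chib chic]; apply: cart_square_eq => /= p; last by rewrite -chib.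
apply: mdist_positivity; rewrite -fd c1 -chic /= c2 sq_comm -chib.
by rewrite !mdistxx maxxx.
Qed.

Section UrysohnChart.
Variable U : metricType R.

Definition cpt_total (T : metricType R) (f : lip1 T (Cpt U)) : metricType R :=
  subsp [set p : maxprod U T | sval (f p.2) p.1].

Definition cpt_proj (T : metricType R) (f : lip1 T (Cpt U)) :
  lip1 (cpt_total f) T.
Proof.
apply: (@Lip1 _ _ _ (fun p : cpt_total f => (sval p).2)).
by move=> x y; rewrite {2}/mdist /= {2}/mdist /= le_max lexx orbT.
Defined.

Lemma cpt_submetry (T : metricType R) (f : lip1 T (Cpt U)) :
  submetry (cpt_proj f).
Proof.
split=> [t|t t'].
  have [_ [x fx]] := svalP (f t).
  by exists (exist _ (x, t) fx : cpt_total f).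
have /cpt_dist_le[h1 h2] := lip_le f t t'.
apply/hausdorff_dist_le; split=> -[[x u] fx] /= uE e e0; subst u.
  have [y fy xy] := h1 x fx e e0.
  exists (exist _ (y, t') fy : cpt_total f) => //.
  by rewrite /mdist /= /mdist /= gt_max xy ltrDl.
have [y fy xy] := h2 x fx e e0.
exists (exist _ (y, t) fy : cpt_total f) => //.
by rewrite /mdist /= /mdist /= gt_max xy metric_sym ltrDl.
Qed.

Lemma cpt_proper (T : metricType R) (f : lip1 T (Cpt U)) :
  proper (cpt_proj f).
Proof.
apply: submetry_proper; first exact: cpt_submetry.
move=> t; apply: (@compact_isometry _ _ _ (fun p : cpt_total f => (sval p).1)).
  move=> p q /= pt qt; rewrite {2}/mdist /= {2}/mdist /= pt qt mdistxx.
  by rewrite max_l// mdist_ge0.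
rewrite (_ : _ @` _ = sval (f t)); first by case: (svalP (f t)).
apply/seteqP; split=> [_ [[[x u] /= fx] <- <-]//|x fx].
by exists (exist _ (x, t) fx : cpt_total f).
Qed.

Definition cpt_family (T : metricType R) (f : lip1 T (Cpt U)) :
  proper_submetry T := ProperSubmetry (cpt_submetry f) (cpt_proper f).

Section ChartSquare.
Variables (S T : metricType R) (h : lip1 S T).
Variables (f : lip1 S (Cpt U)) (g : lip1 T (Cpt U)).
Hypothesis e : f = lip_comp g h.

Lemma chart_top_subproof (p : cpt_total f) :
  sval (g (h (sval p).2)) (sval p).1.
Proof. by have := svalP p; rewrite /= {1}e. Qed.

Definition chart_top_fun (p : cpt_total f) : cpt_total g :=
  exist _ ((sval p).1, h (sval p).2) (chart_top_subproof p).

Lemma chart_top_le p q :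
  mdist (chart_top_fun p) (chart_top_fun q) <= mdist p q.
Proof.
rewrite /mdist /= /mdist /= ge_max !le_max lexx /=.
by rewrite lip_le orbT.
Qed.

Lemma chart_cart :
  lip_iso (@fiber_pair _ _ _ _ _ (cpt_proj g) h (Lip1 chart_top_le)
    (cpt_proj f) (fun=> erefl)).
Proof.
apply/fiber_pair_iso; split=> [v w|[[x u] gx] y /= uE].
  rewrite /mdist /= /mdist /= -maxA; congr Num.max.
  by rewrite max_r// lip_le.
subst u; have fx : sval (f y) x by rewrite e.
by exists (exist _ (x, y) fx : cpt_total f); split=> //; exact: sig_eq.
Qed.

Definition chart_square : cart_square (cpt_family f) (cpt_family g) :=
  @CartSquare _ _ (cpt_family f) (cpt_family g) (Lip1 chart_top_le) h
    (fun=> erefl) chart_cart.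

End ChartSquare.

Definition urysohn_chart : fmor (met (Cpt U)) GH.
Proof.
refine (@Fmor tbMet (met (Cpt U)) GH (fun T f => cpt_family f)
  (fun S T f g h => chart_square (svalP h)) _ _ _).
- by [].
- move=> T f; apply: cart_square_eq => // -[[x t] fx].
  exact: sig_eq.
- by move=> S T W f g k h h'; apply: cart_square_eq => // x; exact: sig_eq.
Defined.

End UrysohnChart.

End TbMet.
Arguments GH_cartesian : clear implicits.

(* Main.v *)
(** The fibered category [gpd_catover G] is a full subcategory of
    [GH], through [cech_mor], and every object of [GH] is in its essential image
    locally for the topology.  A comparison lemma then shows that [cech_mor]
    itself is a stackification as soon as [GH] is a stack, so no
    stackification has to be constructed, and uniqueness of stackifications
    gives the equivalence.

    [GH] is a stack because a proper submetry [P -> T] is known from its fibers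
    and its restrictions to maps from two-point spaces [two r] to [T]: for
    points [p], [q] of [P] over [t], [t'] and [r > d(t, t')], the distance of the
    corresponding points of the restriction is [max (d(p, q)) r].  The
    three-point condition in the definition of lsm coverings is what makes the
    distance glued from these data satisfy the triangle inequality.

    The total space of a proper submetry over a totally bounded space is totally
    bounded, and an isometry from a compact subset of a separable space to the
    Urysohn space extends to the whole space.  An isometric embedding
    [psi : P -> U] exhibits [P -> T] as the family of compacta [psi (P_t)], so
    that every object lies in the image of the chart, over [T] itself.  Extending
    a prescribed embedding of one fiber in the same way gives the lifting
    property of formal submetries. *)

From HB Require Import structures.
Require Import Defs.
From mathcomp Require Import all_boot all_order all_algebra lra.
From mathcomp Require Import boolp classical_sets cardinality reals topology.

Set Implicit Arguments.
Unset Strict Implicit.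
Unset Printing Implicit Defensive.

Import Order.TTheory GRing.Theory Num.Theory.

Local Open Scope classical_set_scope.
Local Open Scope cat_scope.

(** * Stacks and stackification *)

Section Cartesian.
Variables (C : category) (Z : catover C).
Hypothesis cZ : all_cartesian Z.

Lemma cart_lift S T W (x : Z S) (y : Z T) (z : Z W) (phi : fhom Z y z)
    (psi : fhom Z x z) (h : chom S T) : fbase phi ∘ h = fbase psi ->
  exists2 chi : fhom Z x y, fbase chi = h & phi ⊚ chi = psi.
Proof. by move=> /cZ [chi [[? ?] _]]; exists chi. Qed.

(** All arrows being cartesian, any [phi] can be cancelled between arrows with the same base. Most
    equalities of arrows below are proved by cancelling a suitable [phi]. *)
Lemma cart_inj S T W (x : Z S) (y : Z T) (z : Z W) (phi : fhom Z y z)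
    (a b : fhom Z x y) : fbase a = fbase b -> phi ⊚ a = phi ⊚ b -> a = b.
Proof.
move=> ab e; have E : fbase phi ∘ fbase b = fbase (phi ⊚ b) by rewrite fbaseM.
by have [chi [_ u]] := cZ E; rewrite -(u a) ?(u b).
Qed.

Lemma cart_inv T (x y : Z T) (a : fhom Z x y) : fbase a = idc T ->
  exists2 b : fhom Z y x, fbase b = idc T & a ⊚ b = fid Z y.
Proof.
by move=> e; apply: cart_lift; rewrite e ccompm1 fbase1.
Qed.

End Cartesian.

Definition fmor2_comp (C : category) (X Y : catover C) (F G H : fmor X Y)
  (b : fmor2 G H) (a : fmor2 F G) : fmor2 F H.
Proof.
apply: (@Fmor2 _ _ _ F H (fun T x => b T x ⊚ a T x)) => [T x|S T x y f].
  by rewrite fbaseM !comp2_base ccompm1.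
by rewrite -fcompA comp2_nat !fcompA comp2_nat.
Defined.

Definition whiskerr (C : category) (W X Y : catover C) (F G : fmor X Y)
  (a : fmor2 F G) (J : fmor W X) : fmor2 (F ⊙ J) (G ⊙ J).
Proof.
apply: (@Fmor2 _ _ _ (F ⊙ J) (G ⊙ J) (fun T x => a T (J T x))) => [T x|*] /=.
  exact: comp2_base.
exact: comp2_nat.
Defined.

Definition whiskerl (C : category) (X Y W : catover C) (H : fmor Y W)
  (F G : fmor X Y) (a : fmor2 F G) : fmor2 (H ⊙ F) (H ⊙ G).
Proof.
apply: (@Fmor2 _ _ _ (H ⊙ F) (H ⊙ G) (fun T x => mhom H (a T x))) => /=.
  by move=> T x; rewrite mhom_base comp2_base.
by move=> *; rewrite -!mhomM comp2_nat.
Defined.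

(** * The 2-Yoneda lemma *)

Section Yoneda.
Variables (C : category) (P : presheaf C) (T : C) (e : P T).
Hypothesis eU : forall S (x : P S), exists! g : chom S T, x = res P g e.

(** Representability is expressed by a universal element [e], so that the section covers both
    [hom_presheaf T] and [met_presheaf T]. *)
Definition class_map S (x : P S) : chom S T := sval (cid (eU x)).

Lemma class_mapE S (x : P S) : x = res P (class_map x) e.
Proof. by rewrite /class_map; case: cid => g []. Qed.

Lemma class_map_unique S (x : P S) g : x = res P g e -> class_map x = g.
Proof. by rewrite /class_map; case: cid => ? [? u] /= /u. Qed.

Definition class_hom S (x : P S) : fhom (el P) x e := el_hom (class_mapE x).

Lemma class_hom_comp S W (x : el P S) (y : el P W) (f : fhom (el P) x y) :
  class_hom y ⊚ f = class_hom x.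
Proof.
apply: el_hom_eq; rewrite fbaseM /=; apply/esym/class_map_unique.
by rewrite resM -class_mapE; exact: (svalP f).
Qed.

Variable X : catover C.

(** The component at [x] is the restriction of [theta] along [class_hom x]. Naturality follows by
    cancelling cartesian arrows, because [class_hom] is compatible with every arrow. *)
Lemma yoneda_hom (G H : fmor (el P) X) (theta : fhom X (G T e) (H T e)) :
  all_cartesian X -> fbase theta = idc T ->
  exists a : fmor2 G H, a T e = theta.
Proof.
move=> cX theta1.
have k S (x : P S) : exists2 chi : fhom X (G S x) (H S x), fbase chi = idc S &
    mhom H (class_hom x) ⊚ chi = theta ⊚ mhom G (class_hom x).
  by apply: cart_lift; rewrite // fbaseM !mhom_base theta1 ccompm1 ccomp1m.
pose a S (x : P S) := s2val (cid2 (k S x)).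
have a1 S x : fbase (@a S x) = idc S by rewrite /a; case: cid2.
have aE S x : mhom H (class_hom x) ⊚ @a S x = theta ⊚ mhom G (class_hom x).
  by rewrite /a; case: cid2.
unshelve eexists (@Fmor2 _ _ _ G H a a1 _).
  move=> S W x y f; apply: (cart_inj cX (phi := mhom H (class_hom y))).
    by rewrite !fbaseM !mhom_base !a1 ccomp1m ccompm1.
  by rewrite !fcompA -mhomM class_hom_comp !aE -fcompA -mhomM class_hom_comp.
have h1 : class_hom e = fid (el P) e.
  by apply: el_hom_eq; apply: class_map_unique; rewrite res1.
by have := aE _ e; rewrite h1 !mhom1 fcomp1m fcompm1.
Qed.

(** The value at [y] is the source of a chosen lift of [class_map y] ending at [x]; cartesianness
    then forces the action on arrows, and uniqueness makes it functorial. *)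
Lemma yoneda_ob (x : X T) : fibered_in_groupoids X ->
  exists (G : fmor (el P) X) (phi : fhom X (G T e) x), fbase phi = idc T.
Proof.
move=> [lX cX].
pose ob S (y : P S) := sval (cid (lX _ _ (class_map y) x)).
have k S (y : P S) : exists lam : fhom X (ob S y) x, fbase lam = class_map y.
  by rewrite /ob; case: cid.
pose lam S (y : P S) := sval (cid (k S y)).
have lamE S y : fbase (@lam S y) = class_map y by rewrite /lam; case: cid.
have k2 S W (y : el P S) (z : el P W) (f : fhom (el P) y z) :
    exists2 chi : fhom X (ob S y) (ob W z), fbase chi = fbase f &
    lam W z ⊚ chi = lam S y.
  apply: cart_lift => //; rewrite !lamE.
  exact: (congr1 fbase (class_hom_comp f)).
pose m S W (y : el P S) (z : el P W) (f : fhom (el P) y z) :=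
  s2val (cid2 (k2 _ _ _ _ f)).
have m1 S W y z f : fbase (@m S W y z f) = fbase f by rewrite /m; case: cid2.
have mE S W y z f : lam W z ⊚ (@m S W y z f) = lam S y.
  by rewrite /m; case: cid2.
unshelve eexists (@Fmor _ (el P) X ob m m1 _ _).
- move=> S y; apply: (cart_inj cX (phi := lam S y)); rewrite ?m1 ?fbase1 //.
  by rewrite mE fcompm1.
- move=> S W V y z w g f; apply: (cart_inj cX (phi := lam V w)).
    by rewrite m1 !fbaseM !m1.
  by rewrite fcompA !mE.
exists (lam T e); rewrite lamE; apply: class_map_unique.
by rewrite res1.
Qed.

End Yoneda.

Lemma hom_presheaf_universal (C : category) (T : C) S
  (x : hom_presheaf T S) : exists! g, x = res (hom_presheaf T) g (idc T).
Proof.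
exists x; split; first by rewrite /= ccomp1m.
by move=> g; rewrite /= ccomp1m.
Qed.

(** Base change of coverings, phrased with sieves rather than with fiber products in [C]. *)
Definition stable (C : site) : Prop :=
  forall (T : C) (I : Type) (U : I -> C) (f : forall i, chom (U i) T),
    covering f -> forall (W : C) (h : chom W T),
  exists (J : Type) (V : J -> C) (q : forall j, chom (V j) W),
    covering q /\ forall j, in_sieve f (h ∘ q j).

(** * Descent of morphisms in a stack *)

Section DescentHom.
Variables (C : site) (Z : catover C).
Hypothesis sZ : is_stack (C := C) Z.
Let fZ : fibered_in_groupoids Z := proj1 sZ.
Let cZ : all_cartesian Z := proj2 fZ.

(** Factoring through a cartesian lift [chi] of the common base makes [M] and [N] vertical. The
    Yoneda lemma turns them into 2-morphisms between functors on [C / T], which agree on the sieve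
    of the covering, hence everywhere. *)
Lemma separated_hom (T : C) (I : Type) (U : I -> C)
    (f : forall i, chom (U i) T) : covering f ->
  forall (T' : C) (z : Z T) (w : Z T') (M N : fhom Z z w),
  fbase M = fbase N ->
  (forall i, exists (v : Z (U i)) (lam : fhom Z v z),
     fbase lam = f i /\ M ⊚ lam = N ⊚ lam) -> M = N.
Proof.
move=> cf T' z w M N MN h.
have [w' [chi chiE]] := proj1 fZ _ _ (fbase M) w.
have [M' M'1 M'E] : exists2 M' : fhom Z z w', fbase M' = idc T & chi ⊚ M' = M.
  by apply: cart_lift => //; rewrite chiE ccompm1.
have [N' N'1 N'E] : exists2 N' : fhom Z z w', fbase N' = idc T & chi ⊚ N' = N.
  by apply: cart_lift => //; rewrite chiE ccompm1.
suff -> : M = N :> fhom Z z w by [].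
rewrite -M'E -N'E; congr (_ ⊚ _).
have eU := @hom_presheaf_universal C T.
have [F [p p1]] := yoneda_ob eU z fZ.
have [G [q q1]] := yoneda_ob eU w' fZ.
have lift (K : fhom Z z w') : fbase K = idc T ->
    exists2 t : fhom Z (F T (idc T)) (G T (idc T)), fbase t = idc T &
      q ⊚ t = K ⊚ p.
  by move=> K1; apply: cart_lift; rewrite // fbaseM K1 p1 q1.
have [tM tM1 tME] := lift _ M'1; have [tN tN1 tNE] := lift _ N'1.
have [bM bME] := yoneda_hom eU cZ tM1; have [bN bNE] := yoneda_hom eU cZ tN1.
(* [bM] and [bN] both extend the restriction of [bM] to the sieve, and such an extension is
   unique. *)
have [b [_ bu]] := (proj2 sZ _ _ _ _ cf).2 _ _ (whiskerr bM _).
have bMN : bM = bN.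
  rewrite -(bu bM) // -(bu bN) //= => V [g0 [i [a gE]]] /=; rewrite {g0}gE.
  pose g : fhom (el (hom_presheaf T)) (f i ∘ a : hom_presheaf T V) (idc T) :=
    @el_hom C (hom_presheaf T) V T _ _ (idc T) (esym (ccomp1m (f i ∘ a))).
  apply: (cart_inj cZ (phi := mhom G g)); first by rewrite !comp2_base.
  rewrite -!comp2_nat bME bNE.
  apply: (cart_inj cZ (phi := q)); first by rewrite !fbaseM tM1 tN1.
  rewrite !fcompA tME tNE -!fcompA.
  apply: (cart_inj cZ (phi := chi)); first by rewrite !fbaseM M'1 N'1.
  rewrite !fcompA M'E N'E.
  have [v [lam [lamE e]]] := h i.
  have [k _ kE] : exists2 k : fhom Z _ v, fbase k = a & lam ⊚ k = p ⊚ mhom F g.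
    by apply: cart_lift => //; rewrite fbaseM mhom_base lamE p1 /= ccomp1m.
  by rewrite -!(fcompA _ p) -kE !fcompA e.
have [p' _ pp'] := cart_inv cZ p1.
rewrite -[M']fcompm1 -[N']fcompm1 -pp' !fcompA -tME -tNE.
by rewrite -bME -bNE bMN.
Qed.

Variables (T T' : C) (z : Z T) (w : Z T') (k : chom T T').
Variable Rel : forall V (v : Z V), fhom Z v z -> fhom Z v w -> Prop.
Hypothesis Rel_base : forall V (v : Z V) (lam : fhom Z v z) (mu : fhom Z v w),
  Rel lam mu -> fbase mu = k ∘ fbase lam.
Hypothesis Rel_fun : forall V (v : Z V) (lam : fhom Z v z)
  (mu mu' : fhom Z v w), Rel lam mu -> Rel lam mu' -> mu = mu'.
Hypothesis Rel_comp : forall V V' (v : Z V) (v' : Z V') (lam : fhom Z v z)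
  (mu : fhom Z v w) (g : fhom Z v' v), Rel lam mu -> Rel (lam ⊚ g) (mu ⊚ g).

(** [Rel] is the graph of a partially defined transformation and replaces a descent datum with
    chosen restrictions. Over the sieve it yields vertical arrows from the Yoneda functor of [z] to
    that of a lift [w'] of [w]; the stack condition extends them to all of [C / T]. *)
Lemma descent_hom_sieve (I : Type) (U : I -> C) (f : forall i, chom (U i) T) :
  covering f ->
  (forall i, exists (v : Z (U i)) (lam : fhom Z v z) (mu : fhom Z v w),
     fbase lam = f i /\ Rel lam mu) ->
  exists2 M : fhom Z z w, fbase M = k &
    forall V (v : Z V) (lam : fhom Z v z) (mu : fhom Z v w),
      in_sieve f (fbase lam) -> Rel lam mu -> M ⊚ lam = mu.
Proof.
move=> cf h.
have [w' [chi chiE]] := proj1 fZ _ _ k w.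
have eU := @hom_presheaf_universal C T.
have [F [p p1]] := yoneda_ob eU z fZ.
have [G [q q1]] := yoneda_ob eU w' fZ.
pose toid V (g : hom_presheaf T V) : fhom (el (hom_presheaf T)) g (idc T) :=
  @el_hom C (hom_presheaf T) V T g g (idc T) (esym (ccomp1m g)).
have toidM V W (g : el (hom_presheaf T) V) (g' : el (hom_presheaf T) W)
    (a : fhom (el (hom_presheaf T)) g' g) : toid _ g ⊚ a = toid _ g'.
  by apply: el_hom_eq; rewrite fbaseM /=; exact: esym (svalP a).
pose lam V (g : hom_presheaf T V) := p ⊚ mhom F (toid V g).
pose rho V (g : hom_presheaf T V) := chi ⊚ q ⊚ mhom G (toid V g).
have lamb V (g : hom_presheaf T V) : fbase (lam V g) = g.
  by rewrite /lam fbaseM mhom_base p1 /= ccomp1m.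
have rhob V (g : hom_presheaf T V) : fbase (rho V g) = k ∘ g.
  by rewrite /rho !fbaseM mhom_base q1 chiE /= ccompm1.
have lamM V W (g : el (hom_presheaf T) V) (g' : el (hom_presheaf T) W)
    (a : fhom (el (hom_presheaf T)) g' g) : lam _ g ⊚ mhom F a = lam _ g'.
  by rewrite /lam -fcompA -mhomM toidM.
have rhoM V W (g : el (hom_presheaf T) V) (g' : el (hom_presheaf T) W)
    (a : fhom (el (hom_presheaf T)) g' g) : rho _ g ⊚ mhom G a = rho _ g'.
  by rewrite /rho -fcompA -mhomM toidM.
clearbody rho.
have muP V (g : sieve_presheaf f V) :
    exists mu, Rel (lam V (sval g)) mu.
  case: g => [g0 [i [a gE]]] /=; rewrite {g0}gE; have [v [l [mu [lE lmu]]]] := h i.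
  have [c _ cE] : exists2 c : fhom Z _ v, fbase c = a & l ⊚ c = lam V (f i ∘ a).
    by apply: cart_lift => //; rewrite lamb lE.
  by exists (mu ⊚ c); rewrite -cE; exact: Rel_comp.
pose mu V g := sval (cid (muP V g)).
have muE V g : Rel (lam V (sval g)) (mu V g) by rewrite /mu; case: cid.
have aP V (g : sieve_presheaf f V) :
    exists2 al : fhom Z (F V (sval g)) (G V (sval g)), fbase al = idc V &
      rho V (sval g) ⊚ al = mu V g.
  apply: cart_lift => //.
  by rewrite (Rel_base (muE V g)) rhob lamb ccompm1.
pose al V g := s2val (cid2 (aP V g)).
have al1 V g : fbase (al V g) = idc V by rewrite /al; case: cid2.
have alE V g : rho V (sval g) ⊚ al V g = mu V g by rewrite /al; case: cid2.
have alN (S W : C) (x : el (sieve_presheaf f) S) (y : el (sieve_presheaf f) W)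
    (a : fhom (el (sieve_presheaf f)) x y) :
    al _ y ⊚ mhom (F ⊙ el_mor (sieve_incl f)) a =
    mhom (G ⊙ el_mor (sieve_incl f)) a ⊚ al _ x.
  apply: (cart_inj cZ (phi := rho _ (sval y))).
    by rewrite !fbaseM !mhom_base !al1 ccomp1m ccompm1.
  (* Naturality of [al] is functionality of [Rel]: after composition with [rho], both sides are
     related to the same arrow into [z]. *)
  rewrite !fcompA alE /= rhoM alE; apply: (Rel_fun _ (muE _ x)).
  have e := lamM _ _ _ _ (mhom (el_mor (sieve_incl f)) a).
  by have := Rel_comp (mhom F (mhom (el_mor (sieve_incl f)) a)) (muE _ y); rewrite e.
pose alpha : fmor2 (F ⊙ el_mor (sieve_incl f)) (G ⊙ el_mor (sieve_incl f)) :=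
  @Fmor2 _ _ _ (F ⊙ el_mor (sieve_incl f)) (G ⊙ el_mor (sieve_incl f))
    al al1 alN.
have [b [bE _]] := (proj2 sZ _ _ _ _ cf).2 _ _ alpha.
have [p' p'1 pp'] := cart_inv cZ p1.
have p'p : p' ⊚ p = fid Z _.
  apply: (cart_inj cZ (phi := p)); rewrite ?fcompA ?pp' ?fcomp1m ?fcompm1 //.
  by rewrite fbaseM p1 p'1 ccompm1 fbase1.
exists (rho T (idc T) ⊚ b T (idc T) ⊚ p').
  by rewrite fbaseM [fbase (_ ⊚ b _ _)]fbaseM rhob comp2_base p'1 !ccompm1.
move=> V v l m gV lm; pose g : sieve_presheaf f V := exist _ _ gV.
have [c c1 cE] : exists2 c : fhom Z v (F V (sval g)), fbase c = idc V &
    lam V (sval g) ⊚ c = l.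
  by apply: cart_lift; rewrite // lamb /= ccompm1.
rewrite -cE {1}/lam -!fcompA (fcompA p') p'p fcomp1m (fcompA (b _ _)) comp2_nat.
rewrite -fcompA (fcompA (rho _ _)) rhoM (bE V g) /= (fcompA (rho _ _)) (alE V g).
have := Rel_comp c (muE _ g); rewrite cE => r; exact: Rel_fun r lm.
Qed.

(** The base of a related arrow may lie outside the sieve of [f], but by stability it enters the
    sieve after a covering of its source; [separated_hom] brings the equation back. *)
Lemma descent_hom (I : Type) (U : I -> C) (f : forall i, chom (U i) T) :
  stable C -> covering f ->
  (forall i, exists (v : Z (U i)) (lam : fhom Z v z) (mu : fhom Z v w),
     fbase lam = f i /\ Rel lam mu) ->
  exists! M : fhom Z z w, fbase M = k /\
    forall V (v : Z V) (lam : fhom Z v z) (mu : fhom Z v w),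
      Rel lam mu -> M ⊚ lam = mu.
Proof.
move=> stC cf h; have [M M1 ME] := descent_hom_sieve cf h.
exists M; split; last first.
  move=> N [N1 NE]; apply: (separated_hom cf); first by rewrite M1.
  move=> i; have [v [lam [mu [lE lmu]]]] := h i; exists v, lam; split=> //.
  rewrite (ME _ _ _ _ _ lmu) ?(NE _ _ _ _ lmu) // lE.
  by exists i, (idc _); rewrite ccompm1.
split=> // V v lam mu lmu.
have [J [W [q [cq qs]]]] := stC _ _ _ _ cf _ (fbase lam).
apply: (separated_hom cq); first by rewrite fbaseM M1 (Rel_base lmu).
move=> j; have [v' [c cE]] := proj1 fZ _ _ (q j) v.
exists v', c; split=> //; rewrite -fcompA; apply: ME; last exact: Rel_comp.
by rewrite fbaseM cE.
Qed.

End DescentHom.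

(** * Comparison lemma for a fully faithful, locally surjective functor *)

Section Comparison.
Variables (C : site) (X Y : catover C) (J : fmor Y X).
Hypothesis stC : stable C.
Hypothesis cX : all_cartesian X.
Hypothesis liftY : forall (S T : C) (f : chom S T) (v : Y T),
  exists (u : Y S) (n : fhom Y u v), fbase n = f.
Hypothesis fullJ : forall S T (u : Y S) (v : Y T)
  (psi : fhom X (J S u) (J T v)), exists n : fhom Y u v, mhom J n = psi.
Hypothesis faithJ : forall S T (u : Y S) (v : Y T) (m n : fhom Y u v),
  mhom J m = mhom J n -> m = n.
Hypothesis surjJ : forall (T : C) (x : X T),
  exists (I : Type) (U : I -> C) (f : forall i, chom (U i) T),
    covering f /\
    forall i, exists (u : Y (U i)) (psi : fhom X (J _ u) x), fbase psi = f i.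

Lemma full_factor S S' T (u : Y S) (u' : Y S') (x : X T)
    (psi : fhom X (J S u) x) (psi' : fhom X (J S' u') x) (a : chom S' S) :
  fbase psi ∘ a = fbase psi' ->
  exists2 n : fhom Y u' u, fbase n = a & psi ⊚ mhom J n = psi'.
Proof.
move=> /(cart_lift cX)[chi chia <-]; have [n nE] := fullJ chi.
by exists n; rewrite ?nE // -(mhom_base J) nE.
Qed.

(** A substitute for a fiber product over [x]: [v] is a lift along [a'], and by fullness its arrow
    to [x] also factors through [psi]. *)
Lemma common_lift S S' V T (u : Y S) (u' : Y S') (x : X T)
    (psi : fhom X (J S u) x) (psi' : fhom X (J S' u') x)
    (a : chom V S) (a' : chom V S') : fbase psi ∘ a = fbase psi' ∘ a' ->
  exists (v : Y V) (n : fhom Y v u) (n' : fhom Y v u'),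
    [/\ fbase n = a, fbase n' = a' & psi ⊚ mhom J n = psi' ⊚ mhom J n'].
Proof.
move=> e; have [v [n' n'E]] := liftY a' u'.
have [|n nE nn'] := @full_factor _ _ _ u v x psi (psi' ⊚ mhom J n') a.
  by rewrite fbaseM mhom_base n'E.
by exists v, n, n'.
Qed.

Variable Z : catover C.
Hypothesis sZ : is_stack (C := C) Z.
Let fZ : fibered_in_groupoids Z := proj1 sZ.
Let cZ : all_cartesian Z := proj2 fZ.

(* An object of [Z] playing the role of the value at [x] of an extension of
   [F] along [J]. *)
Record cocone (F : fmor Y Z) T (x : X T) := Cocone {
  apex : Z T;
  leg : forall W (u : Y W), fhom X (J W u) x -> fhom Z (F W u) apex;
  leg_base : forall W (u : Y W) (psi : fhom X (J W u) x),
    fbase (leg psi) = fbase psi;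
  leg_nat : forall W W' (u : Y W) (u' : Y W') (n : fhom Y u' u)
    (psi : fhom X (J W u) x), leg (psi ⊚ mhom J n) = leg psi ⊚ mhom F n }.

Section CoconeMap.
Variables (F : fmor Y Z) (S T : C) (x : X S) (y : X T) (phi : fhom X x y).
Variables (c : cocone F x) (d : cocone F y).

(** By [surjJ] the legs of [c] cover its apex, so the equations determine [m]. The pairs formed by a
    leg of [c] and the corresponding leg of [d] generate a descent relation, functional by
    [common_lift]. *)
Lemma cocone_map : exists! m : fhom Z (apex c) (apex d),
  fbase m = fbase phi /\
  forall W (u : Y W) (psi : fhom X (J W u) x), m ⊚ leg c psi = leg d (phi ⊚ psi).
Proof.
pose Rel V (v : Z V) (lam : fhom Z v (apex c)) (mu : fhom Z v (apex d)) :=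
  exists W (u : Y W) (psi : fhom X (J W u) x) (k : fhom Z v (F W u)),
    lam = leg c psi ⊚ k /\ mu = leg d (phi ⊚ psi) ⊚ k.
have [I [U [f [cf fP]]]] := surjJ x.
have [||||m [[m1 mE] mu]] := descent_hom sZ (k := fbase phi) (Rel := Rel) _ _ _ stC cf.
- move=> V v _ _ [W [u [psi [k [-> ->]]]]].
  by rewrite !fbaseM !leg_base fbaseM ccompA.
- move=> V v lam _ _ [W [u [psi [k [-> ->]]]]] [W' [u' [psi' [k' [e ->]]]]].
  have [|v' [n [n' [nE n'E nn']]]] :=
      @common_lift _ _ _ _ u u' x psi psi' (fbase k) (fbase k').
    by rewrite -!(leg_base c) -!fbaseM e.
  have [l l1 lE] : exists2 l : fhom Z v (F V v'), fbase l = idc V &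
      mhom F n ⊚ l = k by apply: cart_lift; rewrite // mhom_base ccompm1.
  have [l' l'1 l'E] : exists2 l : fhom Z v (F V v'), fbase l = idc V &
      mhom F n' ⊚ l = k' by apply: cart_lift; rewrite // mhom_base ccompm1.
  have ll' : l = l'.
    apply: (cart_inj cZ (phi := leg c (psi ⊚ mhom J n))); first by rewrite l1.
    by rewrite {2}nn' !leg_nat -!fcompA lE l'E.
  rewrite -lE -l'E ll' !fcompA -!leg_nat.
  by rewrite -!(fcompA phi) nn'.
- move=> V V' v v' _ _ g [W [u [psi [k [-> ->]]]]].
  by exists W, u, psi, (k ⊚ g); rewrite !fcompA.
- move=> i; have [u [psi psiE]] := fP i.
  exists (F _ u), (leg c psi), (leg d (phi ⊚ psi)); split.
    by rewrite leg_base.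
  by exists _, u, psi, (fid Z _); rewrite !fcompm1.
exists m; split; first split=> //.
  move=> W u psi; apply: mE.
  by exists _, u, psi, (fid Z _); rewrite !fcompm1.
move=> m' [m'1 m'E]; apply: mu; split=> //.
by move=> V v _ _ [W [u [psi [k [-> ->]]]]]; rewrite fcompA m'E.
Qed.

End CoconeMap.

(** Local models of [x] chosen over the sieve assemble into a functor [A] to [Y], since [J] is fully
    faithful. The stack condition extends [F ⊙ A] to [C / T], and the value of the extension at the
    identity is the apex. *)
Lemma cocone_exists (F : fmor Y Z) T (x : X T) : inhabited (cocone F x).
Proof.
have [I [U [f [cf fP]]]] := surjJ x.
have locP V (g : sieve_presheaf f V) :
    exists p : {u : Y V & fhom X (J V u) x}, fbase (projT2 p) = sval g.
  case: g => g0 [i [a gE]] /=; rewrite {g0}gE.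
  have [u [psi psiE]] := fP i; have [u' [n nE]] := liftY a u.
  by exists (existT _ u' (psi ⊚ mhom J n)); rewrite /= fbaseM mhom_base nE psiE.
have [lu [lpsi lpsiE]] : exists lu : forall V, sieve_presheaf f V -> Y V,
    exists lpsi : forall V g, fhom X (J V (lu V g)) x,
    forall V g, fbase (lpsi V g) = sval g.
  exists (fun V g => projT1 (sval (cid (locP V g)))).
  exists (fun V g => projT2 (sval (cid (locP V g)))).
  by move=> V g; exact: svalP (cid (locP V g)).
have homP V W (g : el (sieve_presheaf f) V) (h : el (sieve_presheaf f) W)
    (a : fhom (el (sieve_presheaf f)) g h) :
    exists2 n : fhom Y (lu V g) (lu W h), fbase n = fbase a &
      lpsi W h ⊚ mhom J n = lpsi V g.
  apply: full_factor; rewrite !lpsiE.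
  exact: esym (congr1 sval (svalP a)).
pose hm V W g h a := s2val (cid2 (homP V W g h a)).
have hm1 V W g h a : fbase (hm V W g h a) = fbase a by rewrite /hm; case: cid2.
have hmE V W g h a : lpsi W h ⊚ mhom J (hm V W g h a) = lpsi V g.
  by rewrite /hm; case: cid2.
clearbody hm.
have lpsi_inj V W (u : Y W) (g : sieve_presheaf f V)
    (n n' : fhom Y u (lu V g)) : fbase n = fbase n' ->
    lpsi V g ⊚ mhom J n = lpsi V g ⊚ mhom J n' -> n = n'.
  move=> b e; apply: faithJ; apply: cart_inj e => //.
  by rewrite !mhom_base.
have hm_id V (g : el (sieve_presheaf f) V) :
    hm V V g g (fid _ g) = fid Y (lu V g).
  apply: lpsi_inj; first by rewrite hm1 !fbase1.
  by rewrite hmE mhom1 fcompm1.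
have hmM V W W' (g : el (sieve_presheaf f) V) (h : el (sieve_presheaf f) W)
    (k : el (sieve_presheaf f) W') (b : fhom _ h k) (a : fhom _ g h) :
    hm V W' g k (b ⊚ a) = hm W W' h k b ⊚ hm V W g h a.
  apply: lpsi_inj; first by rewrite hm1 !fbaseM !hm1.
  by rewrite mhomM fcompA !hmE.
pose A := @Fmor C (el (sieve_presheaf f)) Y lu hm hm1 hm_id hmM.
have [D [e]] := (proj2 sZ _ _ _ _ cf).1 (F ⊙ A).
have eVP V (g : sieve_presheaf f V) : exists2 e' : fhom Z (F V (lu V g)) (D V (sval g)),
    fbase e' = idc V & e V g ⊚ e' = fid Z _.
  exact: (cart_inv cZ (comp2_base e g)).
pose eV V g := s2val (cid2 (eVP V g)).
have eV1 V g : fbase (eV V g) = idc V by rewrite /eV; case: cid2.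
have eVE V g : e V g ⊚ eV V g = fid Z _ by rewrite /eV; case: cid2.
clearbody eV.
pose toid V (g : hom_presheaf T V) : fhom (el (hom_presheaf T)) g (idc T) :=
  @el_hom C (hom_presheaf T) V T g g (idc T) (esym (ccomp1m g)).
have toidM V W (g : el (hom_presheaf T) V) (g' : el (hom_presheaf T) W)
    (a : fhom (el (hom_presheaf T)) g' g) : toid _ g ⊚ a = toid _ g'.
  by apply: el_hom_eq; rewrite fbaseM /=; exact: esym (svalP a).
pose z := D T (idc T).
(* legs indexed by the sieve generated by [f] *)
pose c0 V (g : sieve_presheaf f V) : fhom Z (F V (lu V g)) z :=
  mhom D (toid V (sval g)) ⊚ eV V g.
have c01 V g : fbase (c0 V g) = sval g.
  by rewrite /c0 fbaseM mhom_base eV1 ccompm1.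
have c0M V W (g : el (sieve_presheaf f) V) (h : el (sieve_presheaf f) W)
    (a : fhom (el (sieve_presheaf f)) g h) :
    c0 W h ⊚ mhom F (hm V W g h a) = c0 V g.
  rewrite /c0 -(toidM _ _ _ _ (mhom (el_mor (sieve_incl f)) a)) mhomM -!fcompA.
  congr (_ ⊚ _); apply: (cart_inj cZ (phi := e W h)).
    by rewrite !fbaseM !mhom_base !eV1 hm1 ccomp1m ccompm1.
  rewrite !fcompA eVE fcomp1m.
  have := comp2_nat e a; rewrite /= => ->.
  by rewrite -fcompA eVE fcompm1.
clearbody c0.
(* The leg at an arrow [psi] over the sieve, kept as a relation: [g] can only be [fbase psi], and
   having it as a variable avoids transport along that equality. *)
pose c1R V (u : Y V) (psi : fhom X (J V u) x) (l : fhom Z (F V u) z) :=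
  exists (g : sieve_presheaf f V) (n : fhom Y u (lu V g)),
    [/\ fbase n = idc V, psi = lpsi V g ⊚ mhom J n & l = c0 V g ⊚ mhom F n].
have c1R_ex V (u : Y V) (psi : fhom X (J V u) x) : in_sieve f (fbase psi) ->
    exists l, c1R V u psi l.
  move=> s; pose g : sieve_presheaf f V := exist _ _ s.
  have [|n n1 nE] := @full_factor _ _ _ (lu V g) u x (lpsi V g) psi (idc V).
    by rewrite lpsiE ccompm1.
  by exists (c0 V g ⊚ mhom F n), g, n.
have c1R_base V u psi l : c1R V u psi l -> fbase l = fbase psi.
  by move=> [g [n [_ -> ->]]]; rewrite !fbaseM !mhom_base c01 lpsiE.
have c1R_comp V V' (u : Y V) (u' : Y V') (m : fhom Y u' u) psi l :
    c1R V u psi l -> c1R V' u' (psi ⊚ mhom J m) (l ⊚ mhom F m).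
  move=> [g [n [_ -> ->]]].
  pose g' : sieve_presheaf f V' := res (sieve_presheaf f) (fbase (n ⊚ m)) g.
  have [|n' n'1 n'E] := @full_factor _ _ _ (lu V' g') u' x (lpsi V' g')
      (lpsi V g ⊚ mhom J n ⊚ mhom J m) (idc V').
    by rewrite !fbaseM !mhom_base !lpsiE /= ccompm1 -ccompA -fbaseM.
  exists g', n'; split=> //.
  pose a : fhom (el (sieve_presheaf f)) g' g := el_hom erefl.
  rewrite -(c0M _ _ _ _ a) -!fcompA -!mhomM; congr (_ ⊚ mhom F _).
  apply: lpsi_inj; first by rewrite [RHS]fbaseM hm1 n'1 ccompm1.
  by rewrite !mhomM !fcompA hmE.
have c1R_fun V u psi l l' : c1R V u psi l -> c1R V u psi l' -> l = l'.
  move=> [g [n [n1 e1 ->]]] [g' [n' [n'1 e2 ->]]].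
  have gg' : g = g'.
    apply: sig_eq; have := congr1 fbase e1.
    by rewrite e2 !fbaseM !mhom_base n1 n'1 !lpsiE !ccompm1.
  subst g'; congr (_ ⊚ mhom F _); apply: lpsi_inj; first by rewrite n1.
  by rewrite -e1.
(* legs over arbitrary maps, by descent *)
have c2P W (u : Y W) (psi : fhom X (J W u) x) :
  exists! m : fhom Z (F W u) z, fbase m = fbase psi /\
    forall V (v : Y V) (n : fhom Y v u) l, c1R V v (psi ⊚ mhom J n) l ->
      m ⊚ mhom F n = l.
  pose Rel V (v : Z V) (lam : fhom Z v (F W u)) (mu : fhom Z v z) :=
    exists V' (u' : Y V') (n : fhom Y u' u) (k : fhom Z v (F V' u')) l,
      [/\ c1R V' u' (psi ⊚ mhom J n) l, lam = mhom F n ⊚ k & mu = l ⊚ k].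
  (* Pulling the covering back along [fbase psi] brings [psi] locally into the sieve, where [c1R]
     applies. *)
  have [K [Q [q [cq qs]]]] := stC cf (fbase psi).
  have [||||m [[m1 mE] mu]] :=
    descent_hom sZ (k := fbase psi) (Rel := Rel) _ _ _ stC cq.
  - move=> V v _ _ [V' [u' [n [k [l [nl -> ->]]]]]].
    by rewrite !fbaseM mhom_base (c1R_base _ _ _ _ nl) fbaseM mhom_base ccompA.
  - move=> V v _ _ mu [V1 [u1 [n1 [k1 [l1 [nl1 -> ->]]]]]].
    move=> [V2 [u2 [n2 [k2 [l2 [nl2 e12 ->]]]]]].
    have [|v' [n [n' [nE n'E nn']]]] := @common_lift _ _ _ _ u1 u2 x
        (psi ⊚ mhom J n1) (psi ⊚ mhom J n2) (fbase k1) (fbase k2).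
      rewrite !fbaseM !mhom_base -!ccompA; congr (_ ∘ _).
      by rewrite -!(mhom_base F) -!fbaseM e12.
    have [j j1 jE] : exists2 j : fhom Z v (F V v'), fbase j = idc V &
        mhom F n ⊚ j = k1 by apply: cart_lift; rewrite // mhom_base ccompm1.
    have [j' j'1 j'E] : exists2 j : fhom Z v (F V v'), fbase j = idc V &
        mhom F n' ⊚ j = k2 by apply: cart_lift; rewrite // mhom_base ccompm1.
    have N : n1 ⊚ n = n2 ⊚ n'.
      have B : fbase (n1 ⊚ n) = fbase (n2 ⊚ n').
        rewrite !fbaseM nE n'E.
        by rewrite -!(mhom_base F) -!fbaseM e12.
      apply: faithJ; apply: (cart_inj cX (phi := psi)).
        by rewrite !mhom_base.
      by rewrite !mhomM !fcompA.
    have jj' : j = j'.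
      apply: (cart_inj cZ (phi := mhom F (n1 ⊚ n))); first by rewrite j1.
      by rewrite {2}N !mhomM -!fcompA jE j'E.
    rewrite -jE -j'E jj' !fcompA; congr (_ ⊚ _).
    apply: (c1R_fun _ v' (psi ⊚ mhom J n1 ⊚ mhom J n)); first exact: c1R_comp.
    by rewrite nn'; exact: c1R_comp.
  - move=> V V' v v' _ _ g [V1 [u1 [n1 [k1 [l1 [nl1 -> ->]]]]]].
    by exists V1, u1, n1, (k1 ⊚ g), l1; rewrite !fcompA.
  - move=> j; have [v [n nE]] := liftY (q j) u.
    have [l lE] : exists l, c1R (Q j) v (psi ⊚ mhom J n) l.
      by apply: c1R_ex; rewrite fbaseM mhom_base nE.
    exists (F _ v), (mhom F n), l; rewrite mhom_base; split=> //.
    by exists _, v, n, (fid Z _), l; rewrite !fcompm1.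
  exists m; split; first split=> //.
    move=> V v n l nl; apply: mE.
    by exists V, v, n, (fid Z _), l; rewrite !fcompm1.
  move=> m' [m'1 m'E]; apply: mu; split=> //.
  move=> V v _ _ [V1 [u1 [n1 [k1 [l1 [nl1 -> ->]]]]]].
  by rewrite fcompA (m'E _ _ _ _ nl1).
pose c2 W u psi := sval (cid (c2P W u psi)).
have c21 W u psi : fbase (c2 W u psi) = fbase psi.
  by rewrite /c2; case: cid => ? /= [[]].
have c2E W (u : Y W) (psi : fhom X (J W u) x) V (v : Y V) (n : fhom Y v u) l :
    c1R V v (psi ⊚ mhom J n) l -> c2 W u psi ⊚ mhom F n = l.
  by rewrite /c2; case: cid => ? /= [[_ h] _]; exact: h.
have c2u W u psi m : fbase m = fbase psi ->
    (forall V (v : Y V) (n : fhom Y v u) l, c1R V v (psi ⊚ mhom J n) l ->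
      m ⊚ mhom F n = l) -> c2 W u psi = m.
  by rewrite /c2; case: cid => ? /= [_ h] *; apply: h.
constructor; apply: (@Cocone F T x z c2 c21) => W W' u u' n psi.
apply: c2u; first by rewrite !fbaseM !mhom_base c21.
move=> V v m l; rewrite -!fcompA -!mhomM; exact: c2E.
Qed.

(** The extension of [F] sends [x] to the apex of a chosen cocone and acts on arrows by
    [cocone_map]. At [J u] the leg of the identity is vertical, and its inverse compares the
    extension with [F]. *)
Lemma comparison : precomp_equivalence J Z.
Proof.
split=> [F|G H alpha].
- pose c T (x : X T) : cocone F x := inhabited_witness (cocone_exists F x).
  have mP S T (x : X S) (y : X T) (phi : fhom X x y) :=
    cocone_map phi (c S x) (c T y).
  pose m S T x y phi := sval (cid (mP S T x y phi)).
  have m1 S T x y phi : fbase (m S T x y phi) = fbase phi.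
    by rewrite /m; case: cid => ? /= [[]].
  have mE S T x y phi W (u : Y W) (psi : fhom X (J W u) x) :
      m S T x y phi ⊚ leg (c S x) psi = leg (c T y) (phi ⊚ psi).
    by rewrite /m; case: cid => ? /= [[_ h] _]; exact: h.
  have mu S T x y phi (m' : fhom Z (apex (c S x)) (apex (c T y))) :
      fbase m' = fbase phi -> (forall W (u : Y W) (psi : fhom X (J W u) x),
      m' ⊚ leg (c S x) psi = leg (c T y) (phi ⊚ psi)) -> m S T x y phi = m'.
    by rewrite /m; case: cid => ? /= [_ h] *; apply: h.
  clearbody m.
  have m_id T (x : X T) : m T T x x (fid X x) = fid Z _.
    by apply: mu => [|*]; rewrite ?fbase1 // !fcomp1m.
  have mM S T W (x : X S) (y : X T) (z : X W) (g : fhom X y z)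
      (f : fhom X x y) : m S W x z (g ⊚ f) = m T W y z g ⊚ m S T x y f.
    by apply: mu => [|*]; rewrite ?fbaseM ?m1 // -!fcompA !mE.
  pose E := @Fmor C X Z (fun T x => apex (c T x)) m m1 m_id mM.
  exists E.
  pose i T (u : Y T) := leg (c T (J T u)) (fid X _).
  have i1 T u : fbase (@i T u) = idc T by rewrite /i leg_base fbase1.
  have [iV iVP] : exists iV : (forall T (u : Y T), fhom Z (apex (c T (J T u))) (F T u)),
      forall T u, fbase (iV T u) = idc T /\ i T u ⊚ iV T u = fid Z _.
    exists (fun T u => s2val (cid2 (cart_inv cZ (i1 T u)))).
    by move=> T u; case: cid2.
  constructor; apply: (@Fmor2 C Y Z (E ⊙ J) F iV) => [T u|S T u v n].
    exact: (iVP T u).1.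
  apply: (cart_inj cZ (phi := i T v)).
    by rewrite !fbaseM !(iVP _ _).1 !mhom_base ccomp1m ccompm1.
  rewrite !fcompA (iVP _ _).2 fcomp1m /i -leg_nat fcomp1m /= -[mhom J n]fcompm1.
  by rewrite -mE -fcompA (iVP _ _).2 !fcompm1.
(* [G x] and [H x] are both apexes of cocones on [G ⊙ J], the second with legs twisted by [alpha];
   the component of the 2-morphism is the unique map between them. *)
- have @c T (x : X T) : cocone (G ⊙ J) x.
    apply: (@Cocone (G ⊙ J) T x (G T x) (fun W u psi => mhom G psi)) => /= *.
      by rewrite mhom_base.
    by rewrite mhomM.
  have @d T (x : X T) : cocone (G ⊙ J) x.
    apply: (@Cocone (G ⊙ J) T x (H T x) (fun W u psi => mhom H psi ⊚ alpha W u)).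
      by move=> /= *; rewrite fbaseM mhom_base (comp2_base alpha) ccompm1.
    by move=> /= *; rewrite mhomM -!fcompA (comp2_nat alpha).
  have bP T (x : X T) := cocone_map (fid X x) (c T x) (d T x).
  pose b T x := sval (cid (bP T x)).
  have b1 T x : fbase (b T x) = idc T.
    by rewrite /b; case: cid => ? /= [[/= -> _ _]]; rewrite fbase1.
  have bE T x W (u : Y W) (psi : fhom X (J W u) x) :
      b T x ⊚ mhom G psi = mhom H psi ⊚ alpha W u.
    by rewrite /b; case: cid => ? /= [[_ h] _]; rewrite h fcomp1m.
  have bu T x (m : fhom Z (G T x) (H T x)) : fbase m = idc T ->
      (forall W (u : Y W) (psi : fhom X (J W u) x),
        m ⊚ mhom G psi = mhom H psi ⊚ alpha W u) -> b T x = m.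
    rewrite /b; case: cid => ? /= [_ h] m1 mE; apply: h.
    by rewrite m1 fbase1; split=> // *; rewrite mE fcomp1m.
  clearbody b.
  unshelve eexists (@Fmor2 C X Z G H b b1 _).
    (* Both sides of the naturality square are the cocone map over [phi]. *)
    move=> S T x y phi; have [m [_ mu]] := cocone_map phi (c S x) (d T y).
    apply: (etrans (esym (mu (b T y ⊚ mhom G phi) _)) (mu (mhom H phi ⊚ b S x) _)).
    - split=> [|W u psi /=]; first by rewrite fbaseM mhom_base b1 ccomp1m.
      by rewrite -fcompA -mhomM bE.
    - split=> [|W u psi /=]; first by rewrite fbaseM mhom_base b1 ccompm1.
      by rewrite -fcompA bE mhomM fcompA.
  split=> [T u /=|b' b'E].
    by have := bE T _ T u (fid X _); rewrite !mhom1 fcompm1 fcomp1m.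
  case: b' b'E => b' b'1 b'N /= b'E.
  have e : b = b'.
    apply: functional_extensionality_dep => T.
    apply: functional_extensionality_dep => x.
    apply: bu => // W u psi; by rewrite b'N b'E.
  by subst b'; congr Fmor2; exact: Prop_irrelevance.
Qed.

End Comparison.

(** * Stackification of the groupoid of a chart *)

Section CechStackification.
Variables (C : site) (P : presheaf C) (X : catover C).
Variables (pi : fmor (el P) X) (cX : all_cartesian X).
Let G := cech_groupoid pi cX.
Let J := cech_mor pi cX.

Lemma cech_lift S T (f : chom S T) (v : gpd_catover G T) :
  exists (u : gpd_catover G S) (n : fhom (gpd_catover G) u v), fbase n = f.
Proof.
exists (res P f v).
by exists (@GpdHom _ G S T (res P f v) v f (gunit G S (res P f v)) erefl erefl).
Qed.

(** [psi] factors through the cartesian arrow from the restriction of [v] along [fbase psi]; the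
    vertical factor is exactly an arrow of the groupoid. *)
Lemma cech_full S T (u : gpd_catover G S) (v : gpd_catover G T)
    (psi : fhom X (J S u) (J T v)) :
  exists n : fhom (gpd_catover G) u v, mhom J n = psi.
Proof.
pose b : fhom (el P) (res P (fbase psi) v) v := el_hom erefl.
have [chi chi1 chiE] : exists2 chi : fhom X (pi S u) (pi S (res P (fbase psi) v)),
    fbase chi = idc S & mhom pi b ⊚ chi = psi.
  by apply: cart_lift; rewrite // mhom_base ccompm1.
pose r : garr G S := @FprodOb _ _ _ _ pi pi S u (res P (fbase psi) v) chi chi1.
exists (@GpdHom _ G S T u v (fbase psi) r erefl erefl).
rewrite -[RHS]chiE /= /cech_mor_hom /=.
by rewrite (@pi_vert _ _ _ pi _ _ (el_cast _) erefl) fcompm1.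
Qed.

(** The ends of the groupoid arrow are fixed by source and target, and its isomorphism is recovered
    by cancelling a cartesian arrow. *)
Lemma cech_faithful S T (u : gpd_catover G S) (v : gpd_catover G T)
  (m n : fhom (gpd_catover G) u v) : mhom J m = mhom J n -> m = n.
Proof.
move=> e; have E : ghom_base m = ghom_base n.
  exact: etrans (esym (mhom_base J m)) (etrans (congr1 fbase e) (mhom_base J n)).
case: m n e E => [f [x y a a1] s t] [g [x' y' a' a'1] s' t'] /=.
rewrite /cech_mor_hom /= => e fg; apply: gpd_hom_eq => //=.
move: s t s' t' e; rewrite /= => s t s' t' e.
subst g x x' y y'.
apply: (@fprod_ob_eq _ _ _ pi S (FprodOb a1) (FprodOb a'1) erefl erefl) => /=.
rewrite !el_castid !mhom1 fcompm1 fcomp1m.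
move: e; rewrite !(@pi_vert _ _ _ pi _ _ (el_cast _) erefl) !fcompm1.
by move=> e; apply: esym; apply: cart_inj e => //; rewrite a1 a'1.
Qed.

Hypothesis stC : stable C.
Hypothesis sX : is_stack (C := C) X.
Hypothesis surj_pi : forall (T : C) (x : X T),
  exists (I : Type) (U : I -> C) (f : forall i, chom (U i) T),
    covering f /\
    forall i, exists (u : P (U i)) (psi : fhom X (pi _ u) x), fbase psi = f i.

Lemma cech_stackification : is_stackification (C := C) J.
Proof.
split=> // Z sZ; apply: comparison => //.
- exact: cech_lift.
- exact: cech_full.
- exact: cech_faithful.
Qed.

End CechStackification.

Lemma precomp_equivalence_iso2 (C : category) (A B Z : catover C)
    (J : fmor A B) (G H : fmor B Z) : precomp_equivalence J Z ->
  iso2 (G ⊙ J) (H ⊙ J) -> iso2 G H.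
Proof. by move=> [_ h] [a]; have [b _] := h _ _ a; constructor. Qed.

(** A quasi-inverse comes from the universal property of [eta']; each composite is compared with the
    identity after restriction along [eta] or [eta']. *)
Lemma stackification_equivalence (C : site) (A Q Q' : catover C)
    (eta : fmor A Q) (eta' : fmor A Q') (Phi : fmor Q Q') :
  is_stackification (C := C) eta -> is_stackification (C := C) eta' ->
  iso2 (Phi ⊙ eta) eta' -> is_equivalence Phi.
Proof.
move=> [sQ uQ] [sQ' uQ'] [a].
have [Psi [b]] := (uQ' _ sQ).1 eta; exists Psi; split.
  apply: (precomp_equivalence_iso2 (uQ _ sQ)); constructor.
  have c := fmor2_comp b (whiskerl Psi a).
  (* The two bracketings of a triple composite are different records with convertible components, so
     the 2-morphism is repackaged. *)
  exact: (@Fmor2 _ _ _ (Psi ⊙ Phi ⊙ eta) (fmor_id Q ⊙ eta) c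
    (comp2_base c) (@comp2_nat _ _ _ _ _ c)).
apply: (precomp_equivalence_iso2 (uQ' _ sQ')); constructor.
have c := fmor2_comp a (whiskerl Phi b).
exact: (@Fmor2 _ _ _ (Phi ⊙ Psi ⊙ eta') (fmor_id Q' ⊙ eta') c
  (comp2_base c) (@comp2_nat _ _ _ _ _ c)).
Qed.

(** * The arrows of the groupoid form a sheaf *)

Section CechSheaf.
Variables (C : site) (P : presheaf C) (X : catover C).
Variables (pi : fmor (el P) X) (cX : all_cartesian X).
Hypothesis stC : stable C.
Hypothesis sX : is_stack (C := C) X.
Hypothesis sP : is_sheaf (C := C) P.

(** Sources and targets glue because [P] is a sheaf; the isomorphisms between them glue by descent
    of morphisms in the stack [X]. *)
Lemma cech_arr_sheaf : is_sheaf (C := C) (cech_arr pi cX).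
Proof.
move=> T I U f cf s sc.
have c1 i j V (a : chom V (U i)) (b : chom V (U j)) (e : f i ∘ a = f j ∘ b) :
    res P a (fp1 (s i)) = res P b (fp1 (s j)).
  have := congr1 (cech_src pi cX V) (sc i j V a b e).
  by rewrite !pmap_res.
have c2 i j V (a : chom V (U i)) (b : chom V (U j)) (e : f i ∘ a = f j ∘ b) :
    res P a (fp2 (s i)) = res P b (fp2 (s j)).
  have := congr1 (cech_tgt pi cX V) (sc i j V a b e).
  by rewrite !pmap_res.
have [u [uE uu]] := sP cf c1; have [v [vE vu]] := sP cf c2.
pose li i : fhom (el P) (fp1 (s i)) u := el_hom (esym (uE i)).
pose mi i : fhom (el P) (fp2 (s i)) v := el_hom (esym (vE i)).
pose Rel V (z : X V) (lam : fhom X z (pi T u)) (mu : fhom X z (pi T v)) :=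
  exists i (k : fhom X z (pi _ (fp1 (s i)))),
    lam = mhom pi (li i) ⊚ k /\ mu = mhom pi (mi i) ⊚ (fpiso (s i) ⊚ k).
have [||||M [[M1 ME] Mu]] := descent_hom sX (k := idc T) (Rel := Rel) _ _ _ stC cf.
- move=> V z _ _ [i [k [-> ->]]].
  by rewrite !fbaseM fpiso_base !mhom_base /= !ccomp1m.
- move=> V z _ _ mu [i [k [-> ->]]] [j [k' [e ->]]].
  have e' : f i ∘ fbase k = f j ∘ fbase k'.
    by have := congr1 fbase e; rewrite !fbaseM !mhom_base.
  have := @cech_res_lift _ _ _ pi cX _ _ (fbase k') (s j).
  rewrite -(sc _ _ _ _ _ e') => -[a' [b' [a'1 b'1 c']]].
  have [a [b [a1 b1 c]]] := @cech_res_lift _ _ _ pi cX _ _ (fbase k) (s i).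
  move: a a' b b' a1 a'1 b1 b'1 c c'.
  (* By [sc] the two restrictions coincide; naming them [q] lets [k] and [k'] be compared over one
     object. *)
  move: (res _ _ _) => q a a' b b' a1 a'1 b1 b'1 c c'.
  have [h h1 hE] : exists2 h : fhom X z (pi V (fp1 q)), fbase h = idc V &
    mhom pi a ⊚ h = k by apply: cart_lift; rewrite // mhom_base a1 ccompm1.
  have [h' h'1 h'E] : exists2 h : fhom X z (pi V (fp1 q)), fbase h = idc V &
    mhom pi a' ⊚ h = k' by apply: cart_lift; rewrite // mhom_base a'1 ccompm1.
  have la : li i ⊚ a = li j ⊚ a'.
    by apply: el_hom_eq; rewrite !fbaseM a1 a'1.
  have mb : mi i ⊚ b = mi j ⊚ b'.
    by apply: el_hom_eq; rewrite !fbaseM b1 b'1.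
  have hh' : h = h'.
    apply: (cart_inj cX (phi := mhom pi (li i ⊚ a))); first by rewrite h1.
    by rewrite {2}la !mhomM -!fcompA hE h'E.
  rewrite -hE -h'E hh' !fcompA -!(fcompA _ (fpiso _)) c c' !fcompA -!mhomM.
  by rewrite mb.
- move=> V V' z z' _ _ g [i [k [-> ->]]].
  by exists i, (k ⊚ g); rewrite !fcompA.
- move=> i; exists (pi _ (fp1 (s i))), (mhom pi (li i)).
  exists (mhom pi (mi i) ⊚ fpiso (s i)); rewrite mhom_base; split=> //.
  by exists i, (fid X _); rewrite !fcompm1.
have MP i : M ⊚ mhom pi (li i) = mhom pi (mi i) ⊚ fpiso (s i).
  by apply: ME; exists i, (fid X _); rewrite !fcompm1.
pose t : cech_arr pi cX T := @FprodOb _ _ _ _ pi pi T u v M M1.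
exists t; split=> [i|].
  exact: (@cech_res_unique _ _ _ _ cX _ _ _ _ t (li i) (mi i)).
move=> t' t'E.
have u' : u = fp1 t' by apply: uu => i; rewrite -(t'E i) cech_src_res.
have v' : v = fp2 t' by apply: vu => i; rewrite -(t'E i) cech_tgt_res.
apply: (@fprod_ob_eq _ _ _ pi T t t' u' v').
rewrite {}/t; case: t' t'E u' v' => [x y N N1] t'E /= u' v'; subst x y.
rewrite !el_castid !mhom1 fcompm1 fcomp1m; apply/esym/Mu; split=> //.
move=> V z _ _ [i [k [-> ->]]]; rewrite !fcompA; congr (_ ⊚ _).
have := @cech_res_lift _ _ _ pi cX _ _ (f i) (FprodOb N1).
rewrite t'E => -[a [b [a1 b1 c]]].
have la : a = li i by apply: el_hom_eq; rewrite a1.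
have mb : b = mi i by apply: el_hom_eq; rewrite b1.
by rewrite la mb in c.
Qed.
End CechSheaf.

Local Open Scope ring_scope.

(** * The lsm site *)

Section TotallyBounded.
Variable R : realType.
Implicit Types X Y : metricType R.

(** Finite colourings with small classes combine well in products and subspaces, where the centres
    of a given net may fall outside. A net is obtained by picking one point of each colour. *)
Lemma totally_bounded_colouring X :
  (forall e : R, 0 < e -> exists (K : Type) (F : set K) (c : X -> K),
    [/\ finite_set F, forall x, F (c x) &
        forall x y, c x = c y -> mdist x y < e]) -> totally_bounded X.
Proof.
move=> h e e0; have [K [F [c [finF cF ce]]]] := h e e0.
have [[x0]|X0] := pselect (inhabited X); last first.
  by exists set0 => // x; case: X0.
(* Colours that are not attained are sent to [x0]. *)
exists ((fun k => xget x0 [set y | c y = k]) @` F).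
  exact: finite_image.
move=> x _; exists (xget x0 [set y | c y = c x]); first by exists (c x).
rewrite ballEmdist /=; apply: ce.
by have := @xgetPex _ x0 [set y | c y = c x] (ex_intro _ x erefl).
Qed.

Lemma totally_bounded_finite X : finite_set [set: X] -> totally_bounded X.
Proof.
move=> fX e e0; exists [set: X] => // x _.
by exists x => //; exact: ballxx.
Qed.

Lemma totally_bounded_map X (e : R) : totally_bounded X -> 0 < e ->
  exists (F : set X) (c : X -> X),
    [/\ finite_set F, forall x, F (c x) & forall x, mdist (c x) x < e].
Proof.
move=> tX e0; have [F finF FX] := tX e e0.
have k x : exists y, F y /\ mdist y x < e.
  by have [y Fy] := FX x I; rewrite ballEmdist; exists y.
exists F, (fun x => sval (cid (k x))); split=> // x; by case: cid => ? [].
Qed.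

Lemma totally_bounded_fiber_product X Y (Z : metricType R)
  (f : lip1 X Z) (g : lip1 Y Z) : totally_bounded X -> totally_bounded Y ->
  totally_bounded (fiber_product f g).
Proof.
move=> tX tY; apply: totally_bounded_colouring => e e0.
have e2 : 0 < e / 2 by rewrite divr_gt0.
have [F [c [finF cF ce]]] := totally_bounded_map tX e2.
have [G [d [finG dG de]]] := totally_bounded_map tY e2.
exists (X * Y)%type, (F `*` G), (fun p => (c (sval p).1, d (sval p).2)); split.
- exact: finite_setX.
- by move=> x; split=> /=.
- move=> x y [cxy dxy]; rewrite /mdist /= /mdist /= gt_max [e]splitr.
  apply/andP; split.
    rewrite (le_lt_trans (metric_triangle _ (c (sval y).1) _))// -{1}cxy.
    by rewrite ltrD// metric_sym.
  rewrite (le_lt_trans (metric_triangle _ (d (sval y).2) _))// -{1}dxy.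
  by rewrite ltrD// metric_sym.
Qed.

End TotallyBounded.

(** * Base change of lsm coverings, test spaces and representable sheaves *)

Section LsmSite.
Variable R : realType.

Lemma fiber_product_fst_le (X Y Z : metricType R) (f : lip1 X Z)
  (g : lip1 Y Z) (p q : fiber_product f g) :
  mdist (sval p).1 (sval q).1 <= mdist p q.
Proof. by rewrite {2}/mdist /= {2}/mdist /= le_max lexx. Qed.

Lemma fiber_product_snd_le (X Y Z : metricType R) (f : lip1 X Z)
  (g : lip1 Y Z) (p q : fiber_product f g) :
  mdist (sval p).2 (sval q).2 <= mdist p q.
Proof. by rewrite {2}/mdist /= {2}/mdist /= le_max lexx orbT. Qed.

Definition fiber_product_fst (X Y Z : metricType R) (f : lip1 X Z)
  (g : lip1 Y Z) : lip1 (fiber_product f g) X :=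
  Lip1 (@fiber_product_fst_le X Y Z f g).

Definition fiber_product_snd (X Y Z : metricType R) (f : lip1 X Z)
  (g : lip1 Y Z) : lip1 (fiber_product f g) Y :=
  Lip1 (@fiber_product_snd_le X Y Z f g).

(** The radius at the first component works. In the maximum distance, a lift of [g y] inside the
    ball of radius [s] gives a point over [y] inside the ball of the same radius. *)
Lemma local_submetry_pullback (X Y Z : metricType R) (f : lip1 X Z)
  (g : lip1 Y Z) : local_submetry f -> local_submetry (fiber_product_snd f g).
Proof.
move=> sf x; have [r r0 fr] := sf (sval x).1; exists r => // x' s.
rewrite ballEmdist /= => xx' /andP[s0 sr].
have e : f @` ball (sval x').1 s = ball (f (sval x').1) s.
  apply: fr; first by rewrite ballEmdist /= (le_lt_trans _ xx')// fiber_product_fst_le.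
  by rewrite s0 (lt_le_trans sr)// lerB// fiber_product_fst_le.
apply/seteqP; split=> [_ [p + <-]|y]; rewrite !ballEmdist /=.
  by apply: le_lt_trans; exact: fiber_product_snd_le.
move=> x'y; have : ball (f (sval x').1) s (g y).
  rewrite ballEmdist /= (svalP x').
  by rewrite (le_lt_trans (lip_le g _ _)).
rewrite -e => -[u]; rewrite ballEmdist /= => x'u fu.
exists (exist _ (u, y) fu) => //.
by rewrite /mdist /= /mdist /= gt_max x'u.
Qed.

(** The fiber products with [h] cover [W]: near-isometric lifts of the points [h x1], [h x2], [h x3]
    are paired with the [xk], and the second coordinates add nothing beyond the distances in [W]. *)
Lemma lsm_stable : stable (tbMet_lsm R).
Proof.
move=> T I U f [lf cf] W h.
pose V i : tbMet R := TbMet (totally_bounded_fiber_product (f i) h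
  (@tb_bounded _ (U i)) (@tb_bounded _ W)).
exists I, V, (fun i => fiber_product_snd (f i) h); split; last first.
  move=> i; exists i, (fiber_product_fst (f i) h).
  by apply: lip1_eq => x; rewrite /= (svalP x).
split=> [i|x1 x2 x3 e e0]; first exact: local_submetry_pullback.
have [i [u1 [u2 [u3 [e1 e2 e3 l12 l23]]]]] := cf (h x1) (h x2) (h x3) e e0.
exists i, (exist _ (u1, x1) e1), (exist _ (u2, x2) e2), (exist _ (u3, x3) e3).
split=> //.
  rewrite /mdist /= /mdist /= gt_max (lt_le_trans l12) ?lerD2r ?lip_le //.
  by rewrite ltrDl.
rewrite /mdist /= /mdist /= gt_max (lt_le_trans l23) ?lerD2r ?lip_le //.
by rewrite ltrDl.
Qed.

Lemma lsm_covering_id (T : tbMet R) :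
  lsm_covering (U := fun _ : unit => T) (fun=> idc T).
Proof.
split=> [_ x|x1 x2 x3 e e0].
  exists 1 => // x' s _ _; rewrite /=.
  by apply/seteqP; split=> [_ [y ? <-]|y ?] //; exists y.
by exists tt, x1, x2, x3; split=> //; rewrite ltrDl.
Qed.

Lemma totally_bounded_pt : totally_bounded (pt R).
Proof.
apply: totally_bounded_finite; apply: (@sub_finite_set _ _ [set exist _ 0 erefl]).
  by move=> -[x xE] _; apply: sig_eq.
exact: finite_set1.
Qed.

Lemma totally_bounded_two (r : R) : totally_bounded (two r).
Proof.
apply: totally_bounded_finite.
apply: (@sub_finite_set _ _ ([set two0 r] `|` [set two1 r])).
  by move=> -[x xE] _; case: (xE) => e; [left|right]; apply: sig_eq.
by rewrite finite_setU; split; exact: finite_set1.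
Qed.

Definition tb_pt : tbMet R := TbMet totally_bounded_pt.
Definition tb_two (r : R) : tbMet R := TbMet (totally_bounded_two r).

Definition pt0 : pt R := exist _ 0 erefl.

Lemma pt_eq (x : pt R) : x = pt0. Proof. by case: x => x xE; apply: sig_eq. Qed.

Lemma pt_map_le (X : metricType R) (x : X) (p q : pt R) : mdist x x <= mdist p q.
Proof. by rewrite mdistxx mdist_ge0. Qed.

Definition pt_map (X : metricType R) (x : X) : lip1 (pt R) X := Lip1 (pt_map_le x).

Lemma two_pair_le (X : metricType R) (x y : X) (r : R) : mdist x y <= r ->
  forall p q : two r, mdist (if sval p == 0 then x else y)
    (if sval q == 0 then x else y) <= mdist p q.
Proof.
move=> xy [p hp] [q hq]; rewrite /= {2}/mdist /= {2}/mdist /=.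
have r0 : 0 <= r := le_trans (mdist_ge0 _ _) xy.
case: eqP hp => [-> _|p0 [//|->]]; case: eqP hq => [-> _|q0 [//|->]].
- by rewrite mdistxx subrr normr0.
- by rewrite subr0 ger0_norm.
- by rewrite sub0r normrN ger0_norm// metric_sym.
- by rewrite mdistxx normr_ge0.
Qed.

(** Pairs of points at distance at most [r], seen as maps from [two r]; these are the test maps that
    detect distances. *)
Definition pair2 (X : metricType R) (x y : X) (r : R) (h : mdist x y <= r) :
  lip1 (two r) X := Lip1 (two_pair_le h).

Lemma pair2_0 (X : metricType R) (x y : X) (r : R) (h : mdist x y <= r) :
  pair2 h (two0 r) = x.
Proof. by rewrite /= eqxx. Qed.

Lemma pair2_1 (X : metricType R) (x y : X) (r : R) (h : mdist x y <= r) :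
  0 < r -> pair2 h (two1 r) = y.
Proof. by move=> r0; rewrite /= gt_eqF. Qed.

Lemma mdist_two (r : R) : 0 <= r -> mdist (two0 r) (two1 r) = r.
Proof. by move=> r0; rewrite /mdist /= /mdist /= subr0 ger0_norm. Qed.

(** Values are glued by testing on [pt]. The Lipschitz bound holds up to every [e], by lifting a
    pair of points to one member of the covering. *)
Lemma met_presheaf_sheaf (X : metricType R) :
  is_sheaf (C := tbMet_lsm R) (met_presheaf X).
Proof.
move=> T I U f [_ cf] s sc.
have sE i j (u : U i) (v : U j) : f i u = f j v -> s i u = s j v.
  move=> e; have E : lip_comp (f i) (pt_map u) = lip_comp (f j) (pt_map v).
    exact: lip1_eq.
  have := sc i j tb_pt (pt_map u) (pt_map v) E.
  exact: (congr1 (fun h : lip1 (pt R) X => h pt0)).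
have cf2 (t t' : T) (e : R) : 0 < e -> exists (i : I) (u u' : U i),
    [/\ f i u = t, f i u' = t' & mdist u u' < mdist t t' + e].
  move=> e0; have [i [u1 [u2 [u3 [? ? _ ? _]]]]] := cf t t' t' e e0.
  by exists i, u1, u2.
have gP t : exists x, forall i (u : U i), f i u = t -> s i u = x.
  have [i [u [_ [ut _ _]]]] := cf2 t t 1 ltr01.
  by exists (s i u) => j v vt; apply: sE; rewrite ut.
pose g t := sval (cid (gP t)).
have gE i (u : U i) : s i u = g (f i u) by rewrite /g; case: cid => x /= ->.
have gl t t' : mdist (g t) (g t') <= mdist t t'.
  apply/ler_addgt0Pr => e e0; have [i [u [u' [<- <- l]]]] := cf2 t t' e e0.
  by rewrite -!gE (le_trans (lip_le (s i) _ _))// ltW.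
exists (Lip1 gl); split=> [i|h hE]; first by apply: lip1_eq => u /=; rewrite gE.
apply: lip1_eq => t /=; have [i [u [_ [<- _ _]]]] := cf2 t t 1 ltr01.
by rewrite -gE -hE.
Qed.

End LsmSite.

(** * Descent for proper submetries *)

Section ProperSubmetry.
Variable R : realType.
Implicit Types X Y S T : metricType R.

Lemma submetryP X T (f : lip1 X T) : submetry f <->
  (forall b, exists x, f x = b) /\
  forall x b (e : R), 0 < e -> exists2 y, f y = b & mdist x y < mdist (f x) b + e.
Proof.
split=> -[fs fd]; split=> //.
  move=> x b e e0; have /hausdorff_dist_le[h _] := fd (f x) b.
  exact: h.
move=> b0 b1; apply/hausdorff_dist_le; split=> x /= <- e e0; first exact: fd.
by rewrite metric_sym; exact: fd.
Qed.

Lemma lip_continuous X Y (f : lip1 X Y) : continuous f.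
Proof.
move=> x A /nbhs_ballP[e /= e0 eA].
suff : nbhs x (f @^-1` A) by [].
apply/nbhs_ballP; exists e => //= y; rewrite ballEmdist /= => xy.
by apply: eA; rewrite ballEmdist /= (le_lt_trans (lip_le f _ _)).
Qed.

Section Pullback.
Variables (S T : metricType R) (h : lip1 S T) (Q : proper_submetry T).

Lemma pullback_submetry : submetry (fiber_product_snd Q h).
Proof.
have /submetryP[Qs Qd] := ps_submetry Q.
apply/submetryP; split=> [s|[[q s] /= e] s' eps eps0].
  by have [q qs] := Qs (h s); exists (exist _ (q, s) qs).
have [q' q's' qq'] := Qd q (h s') eps eps0.
exists (exist _ (q', s') q's') => //.
rewrite /mdist /= /mdist /= gt_max ltrDl eps0 andbT (lt_le_trans qq')//.
by rewrite lerD2r e lip_le.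
Qed.

Lemma pullback_proper : Defs.proper (fiber_product_snd Q h).
Proof.
apply: submetry_proper; first exact: pullback_submetry.
move=> s; apply: (@compact_isometry _ _ _ (fun p : fiber_product Q h => (sval p).1)).
  move=> p q /= ps qs; rewrite {2}/mdist /= {2}/mdist /= ps qs mdistxx.
  by rewrite max_l// mdist_ge0.
rewrite (_ : _ @` _ = Q @^-1` [set h s]); first exact: (proj2 (ps_proper Q)).
apply/seteqP; split=> [_ [[[q u] /= e] <- <-]//|q /= qs].
by exists (exist _ (q, s) qs).
Qed.

Definition pullback : proper_submetry S :=
  ProperSubmetry pullback_submetry pullback_proper.

Lemma pullback_cart : lip_iso
  (@fiber_pair _ _ _ _ _ Q h (fiber_product_fst Q h)
     (fiber_product_snd Q h) (fun p => svalP p)).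
Proof.
by apply/fiber_pair_iso; split=> // q s e; exists (exist _ (q, s) e).
Qed.

Definition pullback_square : cart_square pullback Q :=
  @CartSquare _ _ _ pullback Q (fiber_product_fst Q h) h
    (fun p => svalP p) pullback_cart.

End Pullback.

Lemma GH_fibered : fibered_in_groupoids (GH R).
Proof.
split; last exact: GH_cartesian.
move=> S T f Q; exists (pullback f Q : GH R S), (pullback_square f Q).
exact: erefl.
Qed.

Section CartSquare.
Variables (S T : metricType R) (P : proper_submetry S) (Q : proper_submetry T).
Variable c : cart_square P Q.

Lemma square_dist v w :
  mdist v w = Num.max (mdist (sq_top c v) (sq_top c w)) (mdist (P v) (P w)).
Proof. by have /fiber_pair_iso[-> _] := sq_cart c. Qed.

Lemma square_lift q s : Q q = sq_base c s ->
  exists2 p, sq_top c p = q & P p = s.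
Proof.
have /fiber_pair_iso[_ h] := sq_cart c.
by move=> /h[p []]; exists p.
Qed.

Lemma square_inj v w : sq_top c v = sq_top c w -> P v = P w -> v = w.
Proof.
move=> e e'; apply: mdist_positivity; rewrite square_dist e e' !mdistxx.
by rewrite maxxx.
Qed.

End CartSquare.

Lemma vertical_square (T : metricType R) (P Q : proper_submetry T)
    (t : ps_total P -> ps_total Q) : is_isometry t ->
  (forall q, exists p, t p = q) -> (forall p, Q (t p) = P p) ->
  exists c : cart_square P Q, sq_base c = lip_id T /\ forall p, sq_top c p = t p.
Proof.
move=> it ts tb; have tl p q : mdist (t p) (t q) <= mdist p q by rewrite it.
have cc : lip_iso (@fiber_pair _ _ _ _ _ Q (lip_id T) (Lip1 tl) P tb).
  apply/fiber_pair_iso; split=> [v w|q b /= qb].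
    by rewrite /= it max_l// lip_le.
  by have [p pq] := ts q; exists p; rewrite -qb -pq tb.
by exists (CartSquare cc).
Qed.

End ProperSubmetry.

(** A restriction to [two s] shows a distance only through its maximum with [s]; letting [s]
    decrease to [c] recovers the maximum with [c]. *)
Lemma max_right_limit (R : realType) (m d c : R) :
  (forall s, c < s -> Num.max m s = Num.max d s) -> Num.max m c = Num.max d c.
Proof.
suff H (a b : R) : (forall s, c < s -> Num.max a s = Num.max b s) ->
    Num.max a c <= Num.max b c.
  by move=> h; apply/le_anti/andP; split; apply: H => // s /h.
move=> h; rewrite ge_max andbC le_max lexx orbT /=; apply/ler_addgt0Pr => e e0.
have : a <= Num.max a (c + e) by rewrite le_max lexx.
rewrite h ?ltrDl// => /le_trans; apply; rewrite ge_max lerD2r.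
rewrite [c <= _]le_max lexx orbT andbT; apply: ler_wpDr; first exact: ltW.
by rewrite le_max lexx.
Qed.

(** * Points and pairs in the sieve of a covering *)

Section Sieves.
Variables (R : realType) (T : tbMet R) (I : Type) (U : I -> tbMet R).
Variables (f : forall i, chom (U i) T) (cf : lsm_covering f).

Lemma point_in_sieve (t : T) : @in_sieve (tbMet R) T I U f (tb_pt R) (pt_map t).
Proof.
have [i [u [_ [_ [e _ _ _ _]]]]] := proj2 cf t t t 1 ltr01.
by exists i, (pt_map u : chom (tb_pt R) (U i)); apply: lip1_eq => x /=.
Qed.

(** Coverings lift distances only up to a positive excess; the slack in the strict inequality is
    taken as that excess. *)
Lemma pair2_in_sieve (t t' : T) (r : R) (h : mdist t t' <= r) :
  mdist t t' < r -> @in_sieve (tbMet R) T I U f (tb_two r) (pair2 h).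
Proof.
move=> tr; have e0 : 0 < r - mdist t t' by rewrite subr_gt0.
have [i [u [u' [_ [e e' _ + _]]]]] := proj2 cf t t' t' _ e0.
rewrite addrC subrK => ur.
exists i, (pair2 (ltW ur) : chom (tb_two r) (U i)); apply: lip1_eq => x /=.
by case: ifP.
Qed.

End Sieves.

Section GHFunctor.
Variables (R : realType) (Y : catover (tbMet R)) (K : fmor Y (GH R)).
Variables (V W : tbMet R) (g : Y V) (h : Y W) (k : fhom Y g h).

(** Here and in the next lemmas the base of [mhom K k] is written [fbase k], which spares later
    proofs the transport along [mhom_base]. *)
Lemma top_base p : K W h (sq_top (mhom K k) p) = fbase k (K V g p).
Proof. by rewrite sq_comm; move: (mhom_base K k) => /= ->. Qed.

Lemma top_dist v w : mdist v w = Num.max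
  (mdist (sq_top (mhom K k) v) (sq_top (mhom K k) w))
  (mdist (K V g v) (K V g w)).
Proof. exact: square_dist. Qed.

Lemma top_lift q s : K W h q = fbase k s ->
  exists2 p, sq_top (mhom K k) p = q & K V g p = s.
Proof. by move=> e; apply: square_lift; rewrite e -(mhom_base K k). Qed.

Lemma top_inj v w : sq_top (mhom K k) v = sq_top (mhom K k) w ->
  K V g v = K V g w -> v = w.
Proof. exact: square_inj. Qed.

Lemma topM X (l : Y X) (j : fhom Y l g) p :
  sq_top (mhom K (k ⊚ j)) p = sq_top (mhom K k) (sq_top (mhom K j) p).
Proof. by rewrite mhomM. Qed.

Lemma ps_lip p q : mdist (K V g p) (K V g q) <= mdist p q.
Proof. exact: lip_le. Qed.

End GHFunctor.

Section GHFmor2.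
Variables (R : realType) (Y : catover (tbMet R)) (G H : fmor Y (GH R)).
Variable a : fmor2 G H.

Lemma top2_base V (g : Y V) p : H V g (sq_top (a V g) p) = G V g p.
Proof. by rewrite sq_comm; move: (comp2_base a g) => /= ->. Qed.

Lemma top2_dist V (g : Y V) p q :
  mdist (sq_top (a V g) p) (sq_top (a V g) q) = mdist p q.
Proof.
rewrite [RHS](square_dist (a V g)) max_l//.
by rewrite -!top2_base; exact: ps_lip.
Qed.

Lemma top2_surj V (g : Y V) q : exists p, sq_top (a V g) p = q.
Proof.
have [|p pq _] := @square_lift _ _ _ _ _ (a V g) q (H V g q); last by exists p.
by move: (comp2_base a g) => /= ->.
Qed.

Lemma top2_nat V W (g : Y V) (h : Y W) (k : fhom Y g h) p :
  sq_top (a W h) (sq_top (mhom G k) p) = sq_top (mhom H k) (sq_top (a V g) p).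
Proof.
exact: (congr1 (fun c : cart_square (G V g) (H W h) => sq_top c p)
  (comp2_nat a k)).
Qed.

End GHFmor2.

(** * Gluing isomorphisms of families *)

Section GHHom.
Variables (R : realType) (T : tbMet R) (I : Type) (U : I -> tbMet R).
Variables (f : forall i, chom (U i) T) (cf : lsm_covering f).
Let A := el_mor (sieve_incl f).
Let B : catover (tbMet R) := el (hom_presheaf T).

Section Glue.
Variables (G H : fmor B (GH R)) (alpha : fmor2 (G ⊙ A) (H ⊙ A)).

(** The graph of the glued isomorphism over [g]: all images of pairs matched by [alpha] along arrows
    from the sieve. *)
Definition glue_rel V (g : B V) (p : ps_total (G V g)) (q : ps_total (H V g)) :=
  exists W (x : sieve_presheaf f W) (k : fhom B (A W x) g) p',
    p = sq_top (mhom G k) p' /\ q = sq_top (mhom H k) (sq_top (alpha W x) p').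

Lemma glue_rel_base V (g : B V) p q : @glue_rel V g p q -> H V g q = G V g p.
Proof.
move=> [W [x [k [p' [-> ->]]]]]; rewrite !top_base; congr (fbase k _).
exact: (top2_base alpha).
Qed.

(** Two presentations of [p] restrict to the same section [s] over [pt], where the points above them
    coincide by cartesianness; naturality of [alpha] then identifies their images. *)
Lemma glue_rel_fun V (g : B V) p W (x : sieve_presheaf f W)
    (k : fhom B (A W x) g) p' q : sq_top (mhom G k) p' = p ->
  @glue_rel V g p q -> q = sq_top (mhom H k) (sq_top (alpha W x) p').
Proof.
move=> kp [W2 [x2 [k2 [p2 [pp2 ->]]]]]; rewrite {}pp2 in kp.
pose w1 := G _ _ p'; pose w2 := G _ _ p2.
have w12 : fbase k w1 = fbase k2 w2 by rewrite -!top_base kp.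
pose s := res (sieve_presheaf f) (pt_map w1 : chom (tb_pt R) W) x.
pose l1 : fhom (el (sieve_presheaf f)) s x := el_hom erefl.
have s2 : s = res (sieve_presheaf f) (pt_map w2 : chom (tb_pt R) W2) x2.
  have e1 : sval x = lip_comp g (sval k) := svalP k.
  have e2 : sval x2 = lip_comp g (sval k2) := svalP k2.
  apply: sig_eq; rewrite /= e1 e2.
  by apply: lip1_eq => z /=; congr (lip_fun g _).
pose l2 : fhom (el (sieve_presheaf f)) s x2 := el_hom s2.
have [p1' p1E _] := @top_lift _ _ (G ⊙ A) _ _ s x l1 p' (pt0 R) erefl.
have [p2' p2E _] := @top_lift _ _ (G ⊙ A) _ _ s x2 l2 p2 (pt0 R) erefl.
have kl : k ⊚ mhom A l1 = k2 ⊚ mhom A l2.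
  by apply: el_hom_eq; apply: lip1_eq => z; exact: w12.
have e12 : p1' = p2'.
  apply: (@top_inj _ _ G _ _ _ _ (k ⊚ mhom A l1)); last first.
    by rewrite [LHS]pt_eq [RHS]pt_eq.
  by rewrite {2}kl !topM p1E p2E.
rewrite -p1E -p2E !(top2_nat alpha).
rewrite -(@topM _ _ H _ _ _ _ k _ _ (mhom A l1)).
rewrite -(@topM _ _ H _ _ _ _ k2 _ _ (mhom A l2)).
by rewrite kl e12.
Qed.

(** For [r] above the distance of the base points, these points form a map from [two r] in the
    sieve. There [alpha] is an isometry, so the two distances have the same maximum with [r]; then
    [r] decreases to the base distance. *)
Lemma glue_rel_dist V (g : B V) p q p' q' : @glue_rel V g p q ->
  @glue_rel V g p' q' -> mdist q q' = mdist p p'.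
Proof.
move=> pq pq'; pose v := G V g p; pose v' := G V g p'.
rewrite -[LHS](@max_l _ _ _ (mdist v v')); last first.
  by rewrite /v /v' -(glue_rel_base pq) -(glue_rel_base pq') ps_lip.
rewrite -[RHS](@max_l _ _ _ (mdist v v')) ?ps_lip //.
apply: max_right_limit => r vr; have r0 := le_lt_trans (mdist_ge0 _ _) vr.
have gr : mdist ((g : lip1 V T) v) ((g : lip1 V T) v') < r.
  exact: le_lt_trans (lip_le (g : lip1 V T) v v') vr.
have s : @in_sieve (tbMet R) T I U f (tb_two r) (lip_comp g (pair2 (ltW vr))).
  rewrite (_ : lip_comp _ _ = pair2 (ltW gr)); first exact: pair2_in_sieve.
  by apply: lip1_eq => z /=; case: ifP.
pose x : sieve_presheaf f (tb_two r) := exist _ _ s.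
pose k : fhom B (A _ x) g := @el_hom _ (hom_presheaf T) (tb_two r) V
  (pair2 (ltW vr)) _ _ erefl.
have [a ap a0] : exists2 a, sq_top (mhom G k) a = p & G _ _ a = two0 r.
  by apply: top_lift; exact: esym (pair2_0 _).
have [a' ap' a1] : exists2 a, sq_top (mhom G k) a = p' & G _ _ a = two1 r.
  by apply: top_lift; exact: esym (pair2_1 _ _).
have d := top_dist k a a'; rewrite ap ap' a0 a1 mdist_two ?ltW // in d.
rewrite -d (glue_rel_fun ap pq) (glue_rel_fun ap' pq').
have := top_dist k (sq_top (alpha _ x) a) (sq_top (alpha _ x) a').
rewrite !(top2_base alpha) /= a0 a1 mdist_two ?ltW // => <-.
exact: (top2_dist alpha).
Qed.

Lemma glue_rel_left V (g : B V) p : exists q, @glue_rel V g p q.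
Proof.
pose v := G V g p.
have s : @in_sieve (tbMet R) T I U f (tb_pt R) (lip_comp g (pt_map v)).
  rewrite (_ : lip_comp _ _ = pt_map ((g : lip1 V T) v)); first exact: point_in_sieve.
  exact: lip1_eq.
pose x : sieve_presheaf f (tb_pt R) := exist _ _ s.
pose k : fhom B (A _ x) g := @el_hom _ (hom_presheaf T) (tb_pt R) V
  (pt_map v) _ _ erefl.
have [a ap _] := @top_lift _ _ G _ _ _ _ k p (pt0 R) erefl.
by exists (sq_top (mhom H k) (sq_top (alpha _ x) a)), _, x, k, a.
Qed.

Lemma glue_rel_right V (g : B V) q : exists p, @glue_rel V g p q.
Proof.
pose v := H V g q.
have s : @in_sieve (tbMet R) T I U f (tb_pt R) (lip_comp g (pt_map v)).
  rewrite (_ : lip_comp _ _ = pt_map ((g : lip1 V T) v)); first exact: point_in_sieve.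
  exact: lip1_eq.
pose x : sieve_presheaf f (tb_pt R) := exist _ _ s.
pose k : fhom B (A _ x) g := @el_hom _ (hom_presheaf T) (tb_pt R) V
  (pt_map v) _ _ erefl.
have [b bq _] := @top_lift _ _ H _ _ _ _ k q (pt0 R) erefl.
have [a ab] := @top2_surj _ _ _ _ alpha _ x b.
by exists (sq_top (mhom G k) a), _, x, k, a; rewrite ab.
Qed.

(** [glue_rel] is total on both sides, isometric and compatible with the base, hence the graph of an
    isomorphism. An isometric relation is single-valued, which also yields naturality and
    uniqueness. *)
Lemma glue_hom : exists! beta : fmor2 G H,
  forall V (x : sieve_presheaf f V), beta V (A V x) = alpha V x.
Proof.
have bP V (g : B V) : exists c : cart_square (G V g) (H V g),
    sq_base c = lip_id V /\ forall p, glue_rel p (sq_top c p).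
  pose t (p : ps_total (G V g)) := sval (cid (glue_rel_left p)).
  have tE p : glue_rel p (t p) by rewrite /t; case: cid.
  have [||p|c [c1 cE]] := @vertical_square _ _ (G V g) (H V g) t.
  - by move=> p q; exact: glue_rel_dist.
  - move=> q; have [p pq] := glue_rel_right q; exists p.
    apply: mdist_positivity; rewrite (glue_rel_dist (tE p) pq).
    exact: mdistxx.
  - exact: glue_rel_base.
  by exists c; split=> // p; rewrite cE.
pose b V (g : B V) : fhom (GH R) (G V g) (H V g) := sval (cid (bP V g)).
have b1 V g : fbase (b V g) = idc V by rewrite /b; case: cid => c [].
have bE V g p : glue_rel p (sq_top (b V g) p) by rewrite /b; case: cid => c [].
clearbody b.
have rel_eq V (g : B V) p q q' : @glue_rel V g p q -> glue_rel p q' -> q = q'.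
  move=> pq pq'; apply: mdist_positivity; rewrite (glue_rel_dist pq pq').
  exact: mdistxx.
have bN V W (g : B V) (h : B W) (k : fhom B g h) :
    b W h ⊚ mhom G k = mhom H k ⊚ b V g.
  apply: cart_square_eq => p; last first.
    have E : fbase (b W h ⊚ mhom G k) = fbase (mhom H k ⊚ b V g).
      by rewrite !fbaseM !mhom_base !b1 ccompm1 ccomp1m.
    exact: (congr1 (fun c : lip1 V W => c p) E).
  apply: (rel_eq _ _ (sq_top (mhom G k) p)); first exact: bE.
  have [X [x [j [p' [pE qE]]]]] := bE _ _ p.
  by exists X, x, (k ⊚ j), p'; rewrite !topM -pE -qE.
exists (@Fmor2 _ _ _ G H b b1 bN); split=> [V x|[b' b'1 b'N] /= b'E].
  apply: cart_square_eq => p; last first.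
    have E : fbase (b V (A V x)) = fbase (alpha V x).
      by rewrite b1 (comp2_base alpha).
    exact: (congr1 (fun c : lip1 V V => c p) E).
  apply: (rel_eq _ _ p); first exact: bE.
  by exists V, x, (fid B _), p; rewrite !mhom1.
suff e : b = b' by subst b'; congr Fmor2; exact: Prop_irrelevance.
apply: functional_extensionality_dep => V.
apply: functional_extensionality_dep => g; apply: cart_square_eq => p; last first.
  exact: (congr1 (fun c : lip1 V V => c p) (etrans (b1 V g) (esym (b'1 V g)))).
apply: (rel_eq _ _ p) => //.
have [W [x [k [p' [pE _]]]]] := bE V g p.
exists W, x, k, p'; split=> //; rewrite pE -b'E.
exact: (congr1 (fun c : cart_square _ _ => sq_top c p') (b'N _ _ _ _ k)).
Qed.

End Glue.
End GHHom.

(** * Gluing families along a covering *)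

Section GHObject.
Variables (R : realType) (T : tbMet R) (I : Type) (U : I -> tbMet R).
Variables (f : forall i, chom (U i) T) (cf : lsm_covering f).
Variable F : fmor (el (sieve_presheaf f)) (GH R).
Let S : catover (tbMet R) := el (sieve_presheaf f).

Definition sieve_point (t : T) : sieve_presheaf f (tb_pt R) :=
  exist _ (pt_map t : chom (tb_pt R) T) (point_in_sieve cf t).

Definition glue_space : Type := {t : T & ps_total (F _ (sieve_point t))}.

Definition point_hom V (x : S V) (v : V) (t : T)
    (e : (sval x : lip1 V T) v = t) : fhom S (sieve_point t) x.
Proof.
apply: (@el_hom _ (sieve_presheaf f) (tb_pt R) V (pt_map v)).
by apply: sig_eq; apply: lip1_eq => z /=; rewrite -e.
Defined.

Lemma point_hom_base V (x : S V) (t : T) (k : fhom S (sieve_point t) x) :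
  (sval x : lip1 V T) (fbase k (pt0 R)) = t.
Proof.
have e : pt_map t = lip_comp (sval x : lip1 V T) (sval k).
  exact: (congr1 (fun y : sieve_presheaf f (tb_pt R) => sval y) (svalP k)).
exact: esym (congr1 (fun h : lip1 (pt R) T => h (pt0 R)) e).
Qed.

(** The first clause makes the projection to [T] 1-Lipschitz; the second says that over [V] one sees
    the fiber product metric of the glued space with [V]. *)
Definition glue_dist_spec (p q : glue_space) (d : R) : Prop :=
  mdist (tag p) (tag q) <= d /\
  forall V (x : S V) (k : fhom S (sieve_point (tag p)) x)
    (k' : fhom S (sieve_point (tag q)) x),
  mdist (sq_top (mhom F k) (tagged p)) (sq_top (mhom F k') (tagged q)) =
  Num.max d (mdist (fbase k (pt0 R)) (fbase k' (pt0 R))).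

Lemma sieve_pair_in (t t' : T) (r : R) (h : mdist t t' < r) :
  @in_sieve (tbMet R) T I U f (tb_two r) (pair2 (ltW h)).
Proof. exact: pair2_in_sieve. Qed.

(** The candidate is read off from the restrictions to [two r] with [r > delta]: there the two
    points are at distance [D r], which should be the maximum of the wanted distance and [r]. *)
Lemma glue_dist_ex (p q : glue_space) : exists d, glue_dist_spec p q d.
Proof.
case: p q => [t a] [t' b]; rewrite /glue_dist_spec /=.
set delta := mdist t t'.
have pos r : delta < r -> 0 < r by apply: le_lt_trans; exact: mdist_ge0.
pose E r (h : delta < r) : S (tb_two r) := exist _ _ (sieve_pair_in h).
have l0P r (h : delta < r) : (sval (E r h) : lip1 _ T) (two0 r) = t.
  exact: pair2_0.
have l1P r (h : delta < r) : (sval (E r h) : lip1 _ T) (two1 r) = t'.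
  by apply: pair2_1; exact: pos.
pose l0 r h := point_hom (l0P r h); pose l1 r h := point_hom (l1P r h).
pose D r h := mdist (sq_top (mhom F (l0 r h)) a) (sq_top (mhom F (l1 r h)) b).
(* Any other comparison of [a] and [b] agrees with [D] up to the distance. *)
have DE V (x : S V) (k : fhom S (sieve_point t) x) (k' : fhom S (sieve_point t') x)
    r (h : delta < r) : mdist (fbase k (pt0 R)) (fbase k' (pt0 R)) < r ->
    D r h = Num.max (mdist (sq_top (mhom F k) a) (sq_top (mhom F k') b)) r.
  move=> kr; set v := fbase k _ in kr; set v' := fbase k' _ in kr.
  have e : E r h = res (sieve_presheaf f) (pair2 (ltW kr) : chom (tb_two r) V) x.
    apply: sig_eq; apply: lip1_eq => z /=.
    by case: ifP => _; rewrite point_hom_base.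
  pose m : fhom S (E r h) x := el_hom e.
  have mk : m ⊚ l0 r h = k.
    apply: el_hom_eq; apply: lip1_eq => z /=.
    by rewrite eqxx [z]pt_eq.
  have mk' : m ⊚ l1 r h = k'.
    apply: el_hom_eq; apply: lip1_eq => z /=.
    by rewrite gt_eqF ?(pos r) // [z]pt_eq.
  rewrite /D (top_dist m) -!topM mk mk' !top_base; congr Num.max.
  by apply: mdist_two; rewrite ltW ?(pos r).
have ge V (x : S V) (k : fhom S (sieve_point t) x) (k' : fhom S (sieve_point t') x) :
    mdist (fbase k (pt0 R)) (fbase k' (pt0 R)) <=
    mdist (sq_top (mhom F k) a) (sq_top (mhom F k') b).
  rewrite (le_trans _ (ps_lip _ _)) // !top_base.
  by rewrite [F _ _ a]pt_eq [F _ _ b]pt_eq.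
have gd V (x : S V) (k : fhom S (sieve_point t) x) (k' : fhom S (sieve_point t') x) :
    delta <= mdist (fbase k (pt0 R)) (fbase k' (pt0 R)).
  have := lip_le (sval x : lip1 V T) (fbase k (pt0 R)) (fbase k' (pt0 R)).
  by rewrite !point_hom_base.
(* If [D r > r] for some [r], this value is the distance. Otherwise [D r = r] for every [r > delta],
   and the distance is [delta]. *)
have [[r [h rD]]|H] := pselect (exists r h, r < D r h).
  exists (D r h); split; first by rewrite (le_trans (ltW h)) ?ltW.
  move=> V x k k'; rewrite -[LHS](max_l (ge _ _ k k')).
  apply: max_right_limit => s ks.
  have hs : delta < s := le_lt_trans (gd _ _ k k') ks.
  rewrite -(DE _ _ k k' s hs ks).
  have E' s1 s2 (h1 : delta < s1) (h2 : delta < s2) : s1 < s2 ->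
      D s2 h2 = Num.max (D s1 h1) s2.
    move=> s12; apply: DE; rewrite /= mdist_two //.
    by rewrite ltW ?(pos s1).
  case: (ltgtP r s) => [rs|sr|rs]; first exact: E'.
    have := E' _ _ hs h sr; case: leP => [_ Dr|rs <-].
      by rewrite Dr ltxx in rD.
    by rewrite max_l // ltW // (lt_trans sr).
  subst s; rewrite (_ : hs = h) ?max_l ?ltW //; exact: Prop_irrelevance.
exists delta; split=> // V x k k'; rewrite -[LHS](max_l (ge _ _ k k')).
apply: max_right_limit => s ks.
have hs : delta < s := le_lt_trans (gd _ _ k k') ks.
rewrite -(DE _ _ k k' s hs ks) max_r ?ltW //.
apply/le_anti; rewrite (DE _ _ k k' s hs ks) le_max lexx orbT andbT.
rewrite -(DE _ _ k k' s hs ks) leNgt; apply/negP => sD.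
by apply: H; exists s, hs.
Qed.

Definition glue_dist (p q : glue_space) : R := sval (cid (glue_dist_ex p q)).

Lemma glue_dist_ge p q : mdist (tag p) (tag q) <= glue_dist p q.
Proof. by rewrite /glue_dist; case: cid => d []. Qed.

Lemma glue_distE p q V (x : S V) (k : fhom S (sieve_point (tag p)) x)
    (k' : fhom S (sieve_point (tag q)) x) :
  mdist (sq_top (mhom F k) (tagged p)) (sq_top (mhom F k') (tagged q)) =
  Num.max (glue_dist p q) (mdist (fbase k (pt0 R)) (fbase k' (pt0 R))).
Proof. by rewrite /glue_dist; case: cid => d /= [_]; exact. Qed.

Definition cover_sieve i : S (U i) :=
  exist _ (f i) (ex_intro _ i (ex_intro _ (idc (U i)) (esym (ccompm1 (f i))))).

Let dge0 p q : 0 <= glue_dist p q.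
Proof. exact: le_trans (mdist_ge0 _ _) (glue_dist_ge p q). Qed.

Let dxx p : glue_dist p p = 0.
Proof.
have := glue_distE (fid S (sieve_point (tag p))) (fid S (sieve_point (tag p))).
by rewrite !mdistxx max_l.
Qed.

(** The three-point condition puts lifts of all three base points in one [U i] with excess below
    [e / 2]; the triangle inequality of the total space over that [U i] is then used. *)
Let dtri q p r : glue_dist p r <= glue_dist p q + glue_dist q r.
Proof.
apply/ler_addgt0Pr => e e0; have e2 : 0 < e / 2 by rewrite divr_gt0.
have [i [u1 [u2 [u3 [e1 e2' e3 l12 l23]]]]] :=
  proj2 cf (tag p) (tag q) (tag r) _ e2.
pose k1 := @point_hom _ (cover_sieve i) u1 _ e1.
pose k2 := @point_hom _ (cover_sieve i) u2 _ e2'.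
pose k3 := @point_hom _ (cover_sieve i) u3 _ e3.
have : glue_dist p r <=
    mdist (sq_top (mhom F k1) (tagged p)) (sq_top (mhom F k3) (tagged r)).
  by rewrite glue_distE le_max lexx.
move=> /le_trans; apply.
apply: (le_trans (metric_triangle _ (sq_top (mhom F k2) (tagged q)) _)).
rewrite !glue_distE [e]splitr addrACA; apply: lerD; rewrite ge_max lerDl ltW //=.
  by rewrite (le_trans (ltW l12))// lerD2r glue_dist_ge.
by rewrite (le_trans (ltW l23))// lerD2r glue_dist_ge.
Qed.

(** [glue_dist] is chosen separately for each ordered pair, so symmetry is read off over a member of
    the covering. *)
Let dsym p q : glue_dist p q = glue_dist q p.
Proof.
wlog suff h : p q / glue_dist p q <= glue_dist q p.
  by apply/le_anti; rewrite !h.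
apply/ler_addgt0Pr => e e0.
have [i [u1 [u2 [_ [e1 e2 _ l12 _]]]]] := proj2 cf (tag p) (tag q) (tag q) _ e0.
pose k1 := @point_hom _ (cover_sieve i) u1 _ e1.
pose k2 := @point_hom _ (cover_sieve i) u2 _ e2.
have : glue_dist p q <=
    mdist (sq_top (mhom F k1) (tagged p)) (sq_top (mhom F k2) (tagged q)).
  by rewrite glue_distE le_max lexx.
move=> /le_trans; apply.
rewrite metric_sym glue_distE ge_max lerDl ltW //= metric_sym.
rewrite (le_trans (ltW l12))// lerD2r metric_sym; exact: glue_dist_ge.
Qed.

Let dpos p q : glue_dist p q = 0 -> p = q.
Proof.
move=> d0; have := glue_dist_ge p q; rewrite d0.
case: p q d0 => [t a] [t' b] /= d0 tt'.
have {}tt' : t = t' by apply: mdist_positivity; apply/le_anti; rewrite tt' mdist_ge0.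
subst t'; congr existT; apply: mdist_positivity.
have := glue_distE (p := existT _ t a) (q := existT _ t b)
  (fid S (sieve_point t)) (fid S (sieve_point t)).
by rewrite d0 !mdistxx maxxx !mhom1.
Qed.

HB.instance Definition _ := gen_eqMixin glue_space.
HB.instance Definition _ := gen_choiceMixin glue_space.
HB.instance Definition _ := isMetric.Build R glue_space dxx dpos dsym dtri.

Definition glue_proj : lip1 glue_space T :=
  @Lip1 R glue_space T (fun p : glue_space => tag p) glue_dist_ge.

Definition glue_pt t (a : ps_total (F _ (sieve_point t))) : glue_space :=
  existT (fun t => ps_total (F _ (sieve_point t))) t a.

(** Half of [e] pays for lifting the two base points to one [U i], the other half for moving to the
    second fiber in the submetry over it. *)
Lemma glue_submetry : submetry glue_proj.
Proof.
apply/submetryP; split=> [t|p t' e e0].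
  have [/(_ (pt0 R))[x _] _] := ps_submetry (F _ (sieve_point t)).
  by exists (glue_pt x).
have e2 : 0 < e / 2 by rewrite divr_gt0.
have [i [u1 [u2 [_ [e1 e2' _ l12 _]]]]] := proj2 cf (tag p) t' t' _ e2.
pose k1 := @point_hom _ (cover_sieve i) u1 _ e1.
pose k2 := @point_hom _ (cover_sieve i) u2 _ e2'.
have /submetryP[_ h] := ps_submetry (F _ (cover_sieve i)).
have [y yu yl] := h (sq_top (mhom F k1) (tagged p)) u2 _ e2.
have [b bE _] := @top_lift _ _ F _ _ _ _ k2 y (pt0 R) yu.
exists (glue_pt b) => //.
rewrite (le_lt_trans (y := mdist (sq_top (mhom F k1) (tagged p)) y)) //.
  rewrite -bE.
  have := @glue_distE p (glue_pt b) _ (cover_sieve i) k1 k2.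
  by move=> /= ->; rewrite le_max lexx.
rewrite (lt_le_trans yl) // top_base /= [X in _ <= _ + X]splitr addrA lerD2r.
exact: ltW.
Qed.

(** Any two presentations of [y] by points of fibers are at glued distance 0, because they have the
    same image over [V]. *)
Lemma glue_chart_ex V (x : S V) (y : ps_total (F V x)) : exists p : glue_space,
  tag p = (sval x : lip1 V T) (F V x y) /\
  forall t (a : ps_total (F _ (sieve_point t))) (k : fhom S (sieve_point t) x),
    sq_top (mhom F k) a = y -> glue_pt a = p.
Proof.
pose k := @point_hom _ x (F V x y) _ erefl.
have [a ay _] := @top_lift _ _ F _ _ _ _ k y (pt0 R) erefl.
exists (glue_pt a); split=> // t b l ly; apply: dpos.
have := @glue_distE (glue_pt b) (glue_pt a) _ x l k; rewrite /= ly ay mdistxx.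
move=> e; apply/le_anti; rewrite dge0 andbT [leRHS]e.
by rewrite le_max lexx.
Qed.

Definition glue_chart V (x : S V) (y : ps_total (F V x)) : glue_space :=
  sval (cid (glue_chart_ex y)).

Lemma glue_chart_tag V (x : S V) (y : ps_total (F V x)) :
  glue_proj (glue_chart y) = (sval x : lip1 V T) (F V x y).
Proof. by rewrite /glue_chart; case: cid => p []. Qed.

Lemma glue_chartE V (x : S V) t (a : ps_total (F _ (sieve_point t)))
  (k : fhom S (sieve_point t) x) :
  glue_chart (sq_top (mhom F k) a) = glue_pt a.
Proof. by rewrite /glue_chart; case: cid => p /= [_ h]; apply/esym/h. Qed.

Lemma glue_chart_dist V (x : S V) (y y' : ps_total (F V x)) : mdist y y' =
  Num.max (mdist (glue_chart y) (glue_chart y')) (mdist (F V x y) (F V x y')).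
Proof.
pose k := @point_hom _ x (F V x y) _ erefl.
have [a ay _] := @top_lift _ _ F _ _ _ _ k y (pt0 R) erefl.
pose k' := @point_hom _ x (F V x y') _ erefl.
have [a' ay' _] := @top_lift _ _ F _ _ _ _ k' y' (pt0 R) erefl.
have := glue_chartE a k; rewrite ay => ->; have := glue_chartE a' k'.
rewrite ay' => ->; have := @glue_distE (glue_pt a) (glue_pt a') _ x k k'.
by rewrite /= ay ay'.
Qed.

Lemma glue_chart_lift V (x : S V) (p : glue_space) (v : V) :
  glue_proj p = (sval x : lip1 V T) v ->
  exists2 y : ps_total (F V x), glue_chart y = p & F V x y = v.
Proof.
case: p => t a /= e; pose k := @point_hom _ x v t (esym e).
by exists (sq_top (mhom F k) a); [rewrite glue_chartE|rewrite top_base].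
Qed.

Lemma glue_chart_lip V (x : S V) (y y' : ps_total (F V x)) :
  mdist (glue_chart y) (glue_chart y') <= mdist y y'.
Proof. by rewrite [leRHS]glue_chart_dist le_max lexx. Qed.

(** Each fiber is a 1-Lipschitz image of a compact fiber of [F] at a point. *)
Lemma glue_proper : Defs.proper glue_proj.
Proof.
apply: submetry_proper; first exact: glue_submetry.
move=> t; pose c := Lip1 (@glue_chart_lip _ (sieve_point t)).
rewrite (_ : _ @^-1` _ = c @` (F _ (sieve_point t) @^-1` [set pt0 R])).
  apply: continuous_compact; last exact: (proj2 (ps_proper (F _ (sieve_point t)))).
  by apply: continuous_subspaceT; exact: lip_continuous.
apply/seteqP; split=> [p /= pt|_ [y /= yE <-]].
  have [|y yp yE] := @glue_chart_lift _ (sieve_point t) p (pt0 R); first exact: pt.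
  by exists y.
exact: glue_chart_tag.
Qed.

Definition glue_family : proper_submetry T :=
  ProperSubmetry glue_submetry glue_proper.

Lemma glue_square_ex V (x : S V) : exists c : cart_square (F V x) glue_family,
  sq_base c = sval x /\ forall y, sq_top c y = glue_chart y.
Proof.
have comm (y : ps_total (F V x)) :
    glue_proj (Lip1 (@glue_chart_lip _ x) y) = (sval x : lip1 V T) (F V x y).
  exact: glue_chart_tag.
have cc : lip_iso (fiber_pair comm).
  apply/fiber_pair_iso; split=> [v w|p v e] /=.
    by rewrite -glue_chart_dist.
  by have [y] := glue_chart_lift e; exists y.
by exists (@CartSquare _ _ _ (F V x) glue_family _ _ comm cc).
Qed.

(** The extension is the Yoneda functor of the glued family. On the sieve it is compared with [F]
    through the cartesian squares [m] given by [glue_chart]. *)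
Lemma glue_object : exists G : fmor (el (hom_presheaf T)) (GH R),
  iso2 (G ⊙ el_mor (sieve_incl f)) F.
Proof.
have [G [phi phi1]] := yoneda_ob (@hom_presheaf_universal _ T)
  (glue_family : GH R T) (GH_fibered R).
exists G; set A := el_mor (sieve_incl f).
pose m V (x : S V) : fhom (GH R) (F V x) (glue_family : GH R T) :=
  sval (cid (glue_square_ex x)).
have m1 V x : fbase (m V x) = sval x by rewrite /m; case: cid => c [].
have mE V x y : sq_top (m V x) y = glue_chart y by rewrite /m; case: cid => c [].
clearbody m.
pose toid V (g : hom_presheaf T V) : fhom (el (hom_presheaf T)) g (idc T) :=
  @el_hom (tbMet R) (hom_presheaf T) V T g g (idc T) (esym (ccomp1m g)).
have cGH := GH_cartesian R.
have iP V (x : S V) : exists2 c : fhom (GH R) (G V (A V x)) (F V x),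
    fbase c = idc V & m V x ⊚ c = phi ⊚ mhom G (toid V (sval x)).
  apply: cart_lift => //.
  by rewrite fbaseM mhom_base m1 phi1 ccompm1 ccomp1m.
pose i V x := s2val (cid2 (iP V x)).
have i1 V x : fbase (i V x) = idc V by rewrite /i; case: cid2.
have iE V x : m V x ⊚ i V x = phi ⊚ mhom G (toid V (sval x)).
  by rewrite /i; case: cid2.
clearbody i; constructor.
apply: (@Fmor2 _ _ _ (G ⊙ A) F i) => // V W x y k.
have mN : m W y ⊚ mhom F k = m V x.
  apply: cart_square_eq => z; last first.
    have E : fbase (m W y ⊚ mhom F k) = fbase (m V x).
      rewrite fbaseM mhom_base !m1.
      exact: esym (congr1 (fun y : S V => sval y) (svalP k)).
    exact: (congr1 (fun c : lip1 V T => c z) E).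
  rewrite /= !mE; pose l := @point_hom _ x (F V x z) _ erefl.
  have [a az _] := @top_lift _ _ F _ _ _ _ l z (pt0 R) erefl.
  have := glue_chartE a l; have := glue_chartE a (k ⊚ l).
  by rewrite topM az => -> ->.
apply: (cart_inj cGH (phi := m W y)).
  by rewrite !fbaseM !mhom_base !i1 ccomp1m ccompm1.
rewrite !fcompA iE mN iE -fcompA.
congr (phi ⊚ _).
apply: (etrans (esym (mhomM G (toid W (sval y)) (mhom A k)))).
congr (mhom G _).
apply: el_hom_eq.
rewrite fbaseM /=; exact: esym (congr1 (fun y : S V => sval y) (svalP k)).
Qed.

End GHObject.

Lemma GH_stack (R : realType) : is_stack (C := tbMet_lsm R) (GH R).
Proof.
split=> [|T I U f cf]; first exact: GH_fibered.
split; first exact: glue_object.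
by move=> G H alpha; exact: glue_hom.
Qed.

(** * The Urysohn space *)

Section Katetov.
Variables (R : realType) (U : metricType R).

(** Prescribed distances from one new point to a subset of [U]; positivity keeps the new point,
    [None] in [katetov_space], apart from the old ones. *)
Record katetov := Katetov {
  kat_set : set U;
  kat_fun : U -> R;
  kat_gt0 : forall x, kat_set x -> 0 < kat_fun x;
  kat_lip : forall x y, kat_set x -> kat_set y ->
    kat_fun x <= mdist x y + kat_fun y;
  kat_tri : forall x y, kat_set x -> kat_set y ->
    mdist x y <= kat_fun x + kat_fun y }.

Variable k : katetov.

Definition katetov_space : Type := option (subsp (kat_set k)).

Let d (p q : katetov_space) : R := match p, q with
  | None, None => 0
  | Some x, None => kat_fun k (sval x)
  | None, Some y => kat_fun k (sval y)
  | Some x, Some y => mdist x y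
  end.

Let dxx p : d p p = 0. Proof. by case: p => [x|] //=; exact: mdistxx. Qed.

Let dpos p q : d p q = 0 -> p = q.
Proof.
case: p q => [x|] [y|] //= e.
- by congr Some; exact: mdist_positivity.
- by have := kat_gt0 (svalP x); rewrite e ltxx.
- by have := kat_gt0 (svalP y); rewrite e ltxx.
Qed.

Let dsym p q : d p q = d q p.
Proof. by case: p q => [x|] [y|] //=; exact: metric_sym. Qed.

Let dtri q p r : d p r <= d p q + d q r.
Proof.
case: p q r => [x|] [y|] [z|] /=; rewrite ?addr0 ?add0r //.
- exact: metric_triangle.
- exact: kat_lip (svalP x) (svalP y).
- exact: kat_tri (svalP x) (svalP z).
- by rewrite addrC metric_sym; exact: kat_lip (svalP z) (svalP y).
- by rewrite addr_ge0 // ltW // kat_gt0 //; exact: svalP y.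
Qed.

HB.instance Definition _ := gen_eqMixin katetov_space.
HB.instance Definition _ := gen_choiceMixin katetov_space.
HB.instance Definition _ := isMetric.Build R katetov_space dxx dpos dsym dtri.

End Katetov.

(** * Extension of isometries into the Urysohn space *)

Section UrysohnExtension.
Variables (R : realType) (U : metricType R) (hU : urysohn_universal U).

Lemma urysohn_point_pos (k : katetov U) : finite_set (kat_set k) ->
  exists u, forall x, kat_set k x -> mdist u x = kat_fun k x.
Proof.
move=> fk; have [_ _ ext] := hU.
have fS : finite_set [set: subsp (kat_set k)].
  rewrite (_ : setT = sval @^-1` kat_set k); last first.
    by apply/seteqP; split=> // x _; exact: svalP x.
  by apply: finite_preimage => // x y _ _; exact: sig_eq.
have fK : finite_set [set: katetov_space k].
  rewrite (_ : setT = [set None] `|` Some @` [set: subsp (kat_set k)]); last first.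
    by apply/seteqP; split=> // -[x|] _; [right; exists x|left].
  by rewrite finite_setU; split; [exact: finite_set1|exact: finite_image].
have [//|//|g gi gE] := ext (subsp (kat_set k)) (katetov_space k) Some sval fS fK.
exists (g None) => x kx.
have e := gE (exist _ x kx); rewrite -{1}[x]e; exact: gi.
Qed.

(** The extension property is applied to the empty space inside a one-point space. *)
Lemma urysohn_nonempty : inhabited U.
Proof.
have [_ _ ext] := hU.
have f0 : finite_set [set: subsp (set0 : set U)].
  by rewrite (_ : setT = set0) //; apply/seteqP; split=> // -[].
have f1 : finite_set [set: pt R].
  rewrite (_ : setT = [set pt0 R]) //; apply/seteqP; split=> // x _.
  exact: pt_eq.
have [||g _ _] := ext (subsp (set0 : set U)) (pt R) (fun=> pt0 R) sval f0 f1.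
- by move=> -[].
- by move=> -[].
by constructor; exact: g (pt0 R).
Qed.

(* The function realized by a point may be given on an indexed finite family,
   with repetitions and zeros. *)
Lemma urysohn_point (I : Type) (D : set I) (v : I -> U) (k : I -> R) :
  finite_set D ->
  (forall i j, D i -> D j -> k i <= mdist (v i) (v j) + k j) ->
  (forall i j, D i -> D j -> mdist (v i) (v j) <= k i + k j) ->
  exists u, forall i, D i -> mdist u (v i) = k i.
Proof.
move=> fD kl kt; have k0 i : D i -> 0 <= k i.
  move=> Di; have := kt i i Di Di; rewrite mdistxx -mulr2n.
  by rewrite pmulrn_lge0.
(* A zero of [k] is realized by the member of the family at which it occurs. *)
have [[i0 [Di0 ki0]]|kpos] := pselect (exists i, D i /\ k i = 0).
  exists (v i0) => i Di; apply/le_anti.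
  have := kt i0 i Di0 Di; rewrite ki0 add0r => -> /=.
  by have := kl i i0 Di Di0; rewrite ki0 addr0 metric_sym.
(* The inequalities force equal values of [k] at indices with equal image, so [K] is well defined on
   the image of [D]; it is 0 elsewhere. *)
pose K (u : U) := xget 0 [set y | exists i, [/\ D i, v i = u & k i = y]].
have KE i : D i -> K (v i) = k i.
  move=> Di; rewrite /K; case: xgetP => [y _ [j [Dj vj <-]]|/(_ (k i))[]].
    apply/le_anti; have := kl i j Di Dj; have := kl j i Dj Di.
    by rewrite vj mdistxx !add0r => -> ->.
  by exists i.
have Kp x : (v @` D) x -> 0 < K x.
  move=> [i Di <-]; rewrite KE // lt_neqAle k0 // andbT eq_sym.
  by apply/eqP => ki; apply: kpos; exists i.
have Kl x y : (v @` D) x -> (v @` D) y -> K x <= mdist x y + K y.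
  by move=> [i Di <-] [j Dj <-]; rewrite !KE //; exact: kl.
have Kt x y : (v @` D) x -> (v @` D) y -> mdist x y <= K x + K y.
  by move=> [i Di <-] [j Dj <-]; rewrite !KE //; exact: kt.
have [|u uE] := urysohn_point_pos (k := Katetov Kp Kl Kt) _.
  exact: finite_image.
by exists u => i Di; rewrite uE /= ?KE //; exists i.
Qed.

(** One form of completeness for two uses: [A r] collects the late indices of a sequence, or the
    indices of a dense sequence close to a given point. *)
Lemma complete_limit (I : Type) (g : I -> U) (A : R -> set I) :
  (forall e, 0 < e -> A e !=set0) ->
  (forall e e', e <= e' -> A e `<=` A e') ->
  (forall e, 0 < e -> exists2 r, 0 < r &
     forall i j, A r i -> A r j -> mdist (g i) (g j) < e) ->
  exists x, forall e, 0 < e -> exists2 r, 0 < r &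
     forall i, A r i -> mdist x (g i) < e.
Proof.
move=> A0 Al Ac; have [cU _ _] := hU.
pose Fl := filter_from [set r : R | 0 < r] (fun r => g @` A r).
have FF : Filter Fl.
  apply: filter_from_filter; first by exists 1 => /=.
  move=> r s /= r0 s0; exists (Num.min r s) => /=; first by rewrite lt_min r0.
  by move=> _ [i Ai <-]; split; exists i => //; apply: Al Ai; rewrite ge_min lexx ?orbT.
have PF : ProperFilter Fl.
  apply: filter_from_proper => r r0; have [i Ai] := A0 r r0.
  by exists (g i), i.
have [|x xF] := cU Fl PF.
  apply: cauchy_exP => e e0; have [r r0 rA] := Ac e e0.
  have [i Ai] := A0 r r0; exists (g i), r => // _ [j Aj <-].
  by rewrite ballEmdist /=; exact: rA.
exists x => e e0; have [r r0 rB] := xF _ (nbhsx_ballx x e e0).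
by exists r => // i Ai; have := rB (g i); rewrite ballEmdist /=; apply; exists i.
Qed.

(** The net lies inside [A], where the maps to [U] are known to be isometric. *)
Definition totally_bounded_set (X : metricType R) (A : set X) : Prop :=
  forall e : R, 0 < e -> exists F : set X, [/\ finite_set F, F `<=` A &
    forall x, A x -> exists2 y, F y & mdist x y < e].

Lemma le_chain3 (a b c d x y e : R) : b < e / 3 -> c < e / 3 ->
  a <= b + d -> d <= x + c -> x <= y + c -> a <= y + e.
Proof. lra. Qed.

Lemma le_chain3_sub (a b c d x y e : R) : b < e / 3 -> c < e / 3 ->
  a <= d + c -> d <= b + x -> x <= y + c -> a <= y + e.
Proof. lra. Qed.

Lemma le_chain4 (a b c d x y z w t e : R) : a < e / 4 -> b < e / 4 -> c < e / 4 ->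
  d < e / 4 -> x <= b + y -> y <= z + d -> z <= a + w -> w <= t + c ->
  x <= t + e.
Proof. lra. Qed.

Lemma exp2_small (e : R) : 0 < e -> exists N, forall n, (N <= n)%N -> 2 ^- n < e.
Proof.
move=> /ltr_add_invr[N]; rewrite add0r => Ne; exists N => n Nn.
apply: le_lt_trans Ne; rewrite lef_pV2 ?posrE ?exprn_gt0 //.
rewrite -natrX ler_nat; apply: (leq_ltn_trans Nn); exact: ltn_expl.
Qed.

Lemma exp2_gt0 n : 0 < (2 ^- n : R).
Proof. by rewrite invr_gt0 exprn_gt0. Qed.

(** The distances to [z] are realized exactly on finite nets [F n] of mesh [2 ^- n] by points [u n],
    each chosen within [2 * e n] of the next one; the limit realizes them on all of [A]. *)
Lemma urysohn_tb_point (X : metricType R) (A : set X) (phi : X -> U) (z : X) :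
  totally_bounded_set A ->
  (forall x y, A x -> A y -> mdist (phi x) (phi y) = mdist x y) ->
  exists u, forall a, A a -> mdist u (phi a) = mdist z a.
Proof.
move=> tA phiA.
(* Arithmetic of the telescoping bound [uk] below, with [x] the value [e (n + m).+1]. *)
have dbl (c x : R) : c - 4 * (x + x) + 2 * (x + x) <= c - 4 * x by lra.
pose e n : R := 2 ^- n; have e0 n : 0 < e n by exact: exp2_gt0.
have eS n : e n = e n.+1 + e n.+1.
  by rewrite /e exprS invfM -mulrDl -[X in X + X]mul1r -splitr mul1r.
pose F n := sval (cid (tA (e n) (e0 n))).
have fF n : finite_set (F n) by rewrite /F; case: cid => ? [].
have FA n : F n `<=` A by rewrite /F; case: cid => ? [].
have Fe n x : A x -> exists2 y, F n y & mdist x y < e n.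
  by rewrite /F; case: cid => ? /= [_ _]; exact.
pose P n u := forall x, F n x -> mdist u (phi x) = mdist z x.
have P0 : exists u, P 0%N u.
  apply: urysohn_point => // i j /FA Ai /FA Aj; rewrite phiA //.
    by rewrite addrC [mdist i j]metric_sym metric_triangle.
  by rewrite [mdist z i]metric_sym metric_triangle.
have PS n u : P n u -> exists2 u', P n.+1 u' & mdist u u' <= 2 * e n.
  move=> Pu.
  (* Distance [2 * e n] from [u] can be prescribed for the new point unless some [x] makes the
     displayed sum smaller. In that case any point realizing the distances on [F n.+1] is already
     close enough to [u], through [phi x]. *)
  have [[x0 [Fx0 x0s]]|big] := pselect (exists x, F n.+1 x /\
      mdist u (phi x) + mdist z x < 2 * e n).
    have [u' Pu'] : exists u', P n.+1 u'.
      apply: urysohn_point => // i j /FA Ai /FA Aj; rewrite phiA //.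
        by rewrite addrC [mdist i j]metric_sym metric_triangle.
      by rewrite [mdist z i]metric_sym metric_triangle.
    exists u' => //; rewrite (le_trans (metric_triangle _ (phi x0) _)) //.
    by rewrite [mdist _ u']metric_sym Pu' // ltW.
  (* The index [None] stands for [u] itself. On [F n.+1] its distances differ from those of [z] by
     at most [2 * e n], since they agree on the net [F n]. *)
  pose k (i : option X) := if i is Some x then mdist z x else 2 * e n.
  pose v (i : option X) := if i is Some x then phi x else u.
  have near x : F n.+1 x -> mdist u (phi x) <= mdist z x + 2 * e n /\
      mdist z x <= mdist u (phi x) + 2 * e n.
    move=> /FA Ax; have [y Fy xy] := Fe n x Ax.
    have yx : mdist y x < e n by rewrite metric_sym.
    have Ay := FA _ _ Fy; rewrite mulr_natl mulr2n !addrA.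
    have H1 : mdist u (phi x) <= mdist z y + mdist y x.
      by rewrite -(Pu y Fy) -(phiA _ _ Ay Ax) metric_triangle.
    have H2 : mdist z y <= mdist z x + mdist x y by exact: metric_triangle.
    have H3 : mdist z x <= mdist z y + mdist y x by exact: metric_triangle.
    have H4 : mdist z y <= mdist u (phi x) + mdist x y.
      by rewrite -(Pu y Fy) -(phiA _ _ Ax Ay) metric_triangle.
    split.
      apply: (le_trans H1); apply: lerD; last exact: ltW.
      by apply: (le_trans H2); rewrite lerD2l ltW.
    apply: (le_trans H3); apply: lerD; last exact: ltW.
    by apply: (le_trans H4); rewrite lerD2l ltW.
  have big' x : F n.+1 x -> 2 * e n <= mdist u (phi x) + mdist z x.
    by move=> Fx; rewrite leNgt; apply/negP => s; apply: big; exists x.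
  have e20 : 0 <= 2 * e n by rewrite mulr_ge0 // ltW.
  have [|||u' u'E] := @urysohn_point _ ([set None] `|` Some @` F n.+1) v k.
  - by rewrite finite_setU; split; [exact: finite_set1|exact: finite_image].
  - move=> i j [->|[x Fx <-]] [->|[y Fy <-]] /=.
    + by rewrite mdistxx add0r.
    + exact: big'.
    + by rewrite [mdist _ u]metric_sym; exact: (near x Fx).2.
    + have Ax := FA _ _ Fx; have Ay := FA _ _ Fy; rewrite phiA // addrC.
      by rewrite [mdist x y]metric_sym metric_triangle.
  - move=> i j [->|[x Fx <-]] [->|[y Fy <-]] /=.
    + by rewrite mdistxx addr_ge0.
    + by rewrite addrC; exact: (near y Fy).1.
    + by rewrite metric_sym; exact: (near x Fx).1.
    + have Ax := FA _ _ Fx; have Ay := FA _ _ Fy; rewrite phiA //.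
      by rewrite [mdist z x]metric_sym metric_triangle.
  exists u'; first by move=> x Fx; apply: (u'E (Some x)); right; exists x.
  by rewrite metric_sym (u'E None) //; left.
pose st n (s : {u | P n u}) : {u | P n.+1 u} :=
  exist _ (s2val (cid2 (PS n _ (svalP s)))) (s2valP (cid2 (PS n _ (svalP s)))).
have stE n s : mdist (sval s) (sval (st n s)) <= 2 * e n.
  exact: (s2valP' (cid2 (PS n _ (svalP s)))).
pose w := fix w n : {u | P n u} := if n is m.+1 then st m (w m) else cid P0.
pose u n := sval (w n).
have uk n m : mdist (u n) (u (n + m)%N) <= 4 * e n - 4 * e (n + m)%N.
  elim: m => [|m IH]; first by rewrite addn0 mdistxx subrr.
  rewrite addnS (le_trans (metric_triangle _ (u (n + m)%N) _))//.
  rewrite (le_trans (lerD IH (stE _ (w (n + m)%N))))//.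
  by rewrite [e (n + m)%N]eS; exact: dbl.
have [||r r0|x xP] := @complete_limit nat u (fun r => [set n | 4 * e n < r]).
- move=> r r0; have r4 : 0 < r / 4 by rewrite divr_gt0.
  have [N /(_ N (leqnn N)) Nr] := exp2_small r4; exists N => /=.
  by rewrite mulrC -ltr_pdivlMr.
- by move=> r r' rr' n /= /lt_le_trans; apply.
- exists r => // n m /=; wlog nm : n m / (n <= m)%N.
    move=> h; have [nm|mn] := leqP n m; first exact: h.
    by move=> *; rewrite metric_sym; apply: h => //; exact: ltnW.
  move=> nr _; have := uk n (m - n)%N; rewrite subnKC // => /le_lt_trans; apply.
  by rewrite (le_lt_trans _ nr)// gerBl mulr_ge0 // ltW.
exists x => a Aa.
(* Any [a] is close to a net point [y] at which [u n] has the exact distance. *)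
have est (eps : R) : 0 < eps -> exists n y, [/\ F n y, mdist x (u n) < eps,
    mdist a y < eps & mdist (u n) (phi y) = mdist z y].
  move=> eps0; have [r r0 rP] := xP eps eps0.
  have m0 : 0 < Num.min (r / 4) eps by rewrite lt_min divr_gt0.
  have [n /(_ n (leqnn n))] := exp2_small m0; rewrite lt_min => /andP[nr neps].
  have [y Fy ay] := Fe n a Aa; exists n, y; split=> //.
  - by apply: rP; rewrite /= mulrC -ltr_pdivlMr.
  - exact: lt_trans neps.
  - exact: (svalP (w n)).
apply/le_anti/andP; split; apply/ler_addgt0Pr => eps eps0.
  have eps3 : 0 < eps / 3 by rewrite divr_gt0.
  have [n [y [Fy xn ay uy]]] := est _ eps3; have Ay := FA _ _ Fy.
  have H1 := metric_triangle x (u n) (phi a).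
  have H2 := metric_triangle (u n) (phi y) (phi a).
  have H3 := metric_triangle z a y.
  rewrite uy phiA // [mdist y a]metric_sym in H2.
  exact: le_chain3 xn ay H1 H2 H3.
have eps3 : 0 < eps / 3 by rewrite divr_gt0.
have [n [y [Fy xn ay uy]]] := est _ eps3; have Ay := FA _ _ Fy.
have H1 := metric_triangle z y a.
have H2 := metric_triangle (u n) x (phi y).
have H3 := metric_triangle x (phi a) (phi y).
rewrite uy [mdist (u n) x]metric_sym in H2; rewrite phiA // in H3.
rewrite [mdist y a]metric_sym in H1.
exact: le_chain3_sub xn ay H1 H2 H3.
Qed.

Lemma totally_bounded_setU1 (X : metricType R) (A : set X) (x : X) :
  totally_bounded_set A -> totally_bounded_set (A `|` [set x]).
Proof.
move=> tA e e0; have [F [fF FA FP]] := tA e e0; exists (F `|` [set x]); split.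
- by rewrite finite_setU; split; last exact: finite_set1.
- by move=> y [/FA|]; [left|right].
- move=> y [/FP[z Fz yz]|->]; first by exists z => //; left.
  by exists x; [right|rewrite mdistxx].
Qed.

(** The points of the dense sequence are adjoined to [A] one at a time, each by [urysohn_tb_point];
    completeness of [U] then defines the map on all of [X]. *)
Lemma urysohn_extension (X : metricType R) (A : set X) (phi : X -> U)
    (s : nat -> X) : totally_bounded_set A ->
  (forall x y, A x -> A y -> mdist (phi x) (phi y) = mdist x y) ->
  (forall x (e : R), 0 < e -> exists n, mdist x (s n) < e) ->
  exists2 psi : X -> U, is_isometry psi & forall a, A a -> psi a = phi a.
Proof.
move=> tA phiA sD.
pose B := fix B n : set X := if n is m.+1 then B m `|` [set s m] else A.
have tB n : totally_bounded_set (B n).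
  by elim: n => [//|n IH]; exact: totally_bounded_setU1.
have BS n m x : B n x -> B (n + m)%N x.
  by elim: m => [|m IH]; rewrite ?addn0 // addnS => /IH; left.
have BSle n m x : (n <= m)%N -> B n x -> B m x.
  by move=> nm; rewrite -(subnKC nm); exact: BS.
pose P n (psi : X -> U) :=
  forall x y, B n x -> B n y -> mdist (psi x) (psi y) = mdist x y.
have PS n psi : P n psi ->
    exists2 psi', P n.+1 psi' & forall x, B n x -> psi' x = psi x.
  move=> Ppsi; have [u uE] := urysohn_tb_point (s n) (tB n) Ppsi.
  (* If [s n] was already in [B n], then [u] is at distance 0 from its old image, so the old values
     are kept. *)
  pose psi' x := if x == s n then u else psi x.
  have psi'E x : B n x -> psi' x = psi x.
    rewrite /psi'; case: eqP => // -> Bs; apply: mdist_positivity.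
    by rewrite uE // mdistxx.
  exists psi' => // x y [Bx|->] [By|->].
  - by rewrite !psi'E //; exact: Ppsi.
  - by rewrite psi'E // /psi' eqxx metric_sym uE // metric_sym.
  - by rewrite (psi'E y) // /psi' eqxx uE.
  - by rewrite !mdistxx.
pose st n (q : {psi | P n psi}) : {psi | P n.+1 psi} :=
  exist _ (s2val (cid2 (PS n _ (svalP q)))) (s2valP (cid2 (PS n _ (svalP q)))).
have stE n q x : B n x -> sval (st n q) x = sval q x.
  exact: (s2valP' (cid2 (PS n _ (svalP q)))).
pose w := fix w n : {psi | P n psi} :=
  if n is m.+1 then st m (w m) else exist _ phi phiA.
have wE n m x : B n x -> sval (w (n + m)%N) x = sval (w n) x.
  move=> Bx; elim: m => [|m IH]; first by rewrite addn0.
  by rewrite addnS -IH; apply: stE; exact: BS.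
have wphi n x : A x -> sval (w n) x = phi x by exact: (wE 0%N n).
pose g n := sval (w n.+1) (s n).
have Bs n : B n.+1 (s n) by right.
have gE n m : (n < m)%N -> sval (w m) (s n) = g n.
  by move=> nm; rewrite -(subnKC nm); apply: wE.
have gphi n a : A a -> mdist (g n) (phi a) = mdist (s n) a.
  move=> Aa; rewrite -(wphi n.+1) //; apply: (svalP (w n.+1)); first exact: Bs.
  exact: (BS 0%N).
have gg n m : mdist (g n) (g m) = mdist (s n) (s m).
  rewrite -(@gE n (maxn n m).+1) ?ltnS ?leq_maxl // -(@gE m (maxn n m).+1).
    apply: (svalP (w _)).
      by apply: (BSle n.+1) => //; rewrite ltnS leq_maxl.
    by apply: (BSle m.+1) => //; rewrite ltnS leq_maxr.
  by rewrite ltnS leq_maxr.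
have lim x : exists y, forall e, 0 < e -> exists2 r, 0 < r &
    forall n, mdist x (s n) < r -> mdist y (g n) < e.
  have [||e e0|y yP] := @complete_limit nat g (fun r => [set n | mdist x (s n) < r]).
  - by move=> e e0; have [n] := sD x e e0; exists n.
  - by move=> r r' rr' n /= /lt_le_trans; apply.
  - exists (e / 2) => [|i j /= xi xj]; first by rewrite divr_gt0.
    rewrite gg (le_lt_trans (metric_triangle _ x _))// [e]splitr ltrD//.
    by rewrite metric_sym.
  by exists y.
pose psi x := sval (cid (lim x)).
have psiP x e : 0 < e -> exists n, mdist x (s n) < e /\ mdist (psi x) (g n) < e.
  rewrite /psi; case: cid => y /= yP e0; have [r r0 rP] := yP e e0.
  have m0 : 0 < Num.min r e by rewrite lt_min r0.
  have [n] := sD x _ m0; rewrite lt_min => /andP[xr xe].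
  by exists n; split=> //; exact: rP.
exists psi.
  move=> x y; apply/le_anti/andP; split; apply/ler_addgt0Pr => e e0.
    have e4 : 0 < e / 4 by rewrite divr_gt0.
    have [n [xn pn]] := psiP x _ e4; have [m [ym pm]] := psiP y _ e4.
    have H1 := metric_triangle (psi x) (g n) (psi y).
    have H2 := metric_triangle (g n) (g m) (psi y).
    have H3 := metric_triangle (s n) x (s m).
    have H4 := metric_triangle x y (s m).
    rewrite [mdist (g m) _]metric_sym gg in H2.
    rewrite [mdist (s n) x]metric_sym in H3.
    exact: le_chain4 xn pn ym pm H1 H2 H3 H4.
  have e4 : 0 < e / 4 by rewrite divr_gt0.
  have [n [xn pn]] := psiP x _ e4; have [m [ym pm]] := psiP y _ e4.
  have H1 := metric_triangle x (s n) y.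
  have H2 := metric_triangle (s n) (s m) y.
  have H3 := metric_triangle (g n) (psi x) (g m).
  have H4 := metric_triangle (psi x) (psi y) (g m).
  rewrite [mdist (s m) y]metric_sym -gg in H2.
  rewrite [mdist (g n) (psi x)]metric_sym in H3.
  exact: le_chain4 pn xn pm ym H1 H2 H3 H4.
(* On [A] too [psi] is a limit; agreement with [phi] follows by comparing both with [g n] for [s n]
   near [a]. *)
move=> a Aa; apply: mdist_positivity; apply/le_anti.
rewrite mdist_ge0 andbT; apply/ler_addgt0Pr => e e0; rewrite add0r.
have e2 : 0 < e / 2 by rewrite divr_gt0.
have [n [an pn]] := psiP a _ e2.
rewrite (le_trans (metric_triangle _ (g n) _))// gphi // [e]splitr.
by rewrite lerD // ltW // metric_sym.
Qed.

End UrysohnExtension.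

(** Without a finite net, the sets of points of [K] at distance at least [e] from a finite subset
    generate a proper filter. A cluster point [p] contradicts the member of points far from [p]. *)
Lemma compact_totally_bounded (R : realType) (X : metricType R) (K : set X) :
  compact K -> totally_bounded_set K.
Proof.
move=> cK e e0; apply: contrapT => nF.
pose far (S : set X) := [set x | K x /\ forall s, S s -> e <= mdist s x].
pose Fl := filter_from [set S | finite_set S /\ S `<=` K] far.
have FF : Filter Fl.
  apply: filter_from_filter.
    by exists set0; split; [exact: finite_set0|].
  move=> S S' [fS SK] [fS' SK']; exists (S `|` S'); first split.
  - by rewrite finite_setU.
  - by move=> x [/SK|/SK'].
  - by move=> x [Kx h]; split; split=> // s Ss; apply: h; [left|right].
have PF : ProperFilter Fl.
  apply: filter_from_proper => S [fS SK]; apply: contrapT => S0.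
  apply: nF; exists S; split=> // x Kx; apply: contrapT => nx.
  apply: S0; exists x; split=> // s Ss; rewrite leNgt; apply/negP => sx.
  by apply: nx; exists s => //; rewrite metric_sym.
have FK : Fl K by exists set0 => [|x []//]; split; [exact: finite_set0|].
have [p [Kp cp]] := cK _ PF FK.
have Fp : Fl (far [set p]).
  by exists [set p] => //; split; [exact: finite_set1|move=> _ ->].
have [x [[_ /(_ p erefl)] + ]] := cp _ _ Fp (nbhsx_ballx p e e0).
by rewrite ballEmdist /= leNgt => /negP.
Qed.

Lemma totally_bounded_dense_seq (R : realType) (X : metricType R) (x0 : X) :
  totally_bounded_set [set: X] ->
  exists s : nat -> X, forall x (e : R), 0 < e -> exists n, mdist x (s n) < e.
Proof.
move=> tX; pose e n : R := 2 ^- n.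
have lP n : exists l : seq X, forall x, exists2 y, y \in l & mdist x y < e n.
  have [F [/finite_seqP[l lF] _ FP]] := tX (e n) (exp2_gt0 R n).
  by exists l => x; have [y Fy xy] := FP x I; exists y => //; rewrite lF in Fy.
pose l n := sval (cid (lP n)).
have lE n x : exists2 y, y \in l n & mdist x y < e n by rewrite /l; case: cid.
(* An index codes a scale [n] and a position [i] in its net; other codes and positions past the end
   give [x0]. *)
exists (fun k => if unpickle k is Some (n, i) then nth x0 (l n) i else x0).
move=> x r /exp2_small[n /(_ n (leqnn n)) nr]; have [y yl xy] := lE n x.
exists (pickle (n, index y (l n))); rewrite pickleK nth_index //.
exact: lt_trans nr.
Qed.

(** * Families of compacta and the Urysohn chart *)

Section Families.
Variable R : realType.

(** Nets of the compact fibers over a finite net of [T] suffice: the submetry property moves any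
    point into one of these fibers at cost below [e / 2]. *)
Lemma proper_submetry_totally_bounded (T : tbMet R) (Q : proper_submetry T) :
  totally_bounded_set [set: ps_total Q].
Proof.
move=> e e0; have e2 : 0 < e / 2 by rewrite divr_gt0.
have [F fF FT] := @tb_bounded _ T _ e2.
have /submetryP[_ Qd] := ps_submetry Q.
have nP t : exists S : set (ps_total Q), finite_set S /\
    forall q, Q q = t -> exists2 y, S y & mdist q y < e / 2.
  have [S [fS _ SP]] := compact_totally_bounded (proj2 (ps_proper Q) t) e2.
  by exists S.
pose N t := sval (cid (nP t)).
have fN t : finite_set (N t) by rewrite /N; case: cid => ? [].
have NE t q : Q q = t -> exists2 y, N t y & mdist q y < e / 2.
  by rewrite /N; case: cid => ? /= [_]; exact.
exists (\bigcup_(t in F) N t); split=> //; first exact: bigcup_finite.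
move=> q _; have [t Ft tq] := FT (Q q) I; rewrite ballEmdist /= in tq.
have d0 : 0 < e / 2 - mdist (Q q) t by rewrite subr_gt0 metric_sym.
have [q' q't qq'] := Qd q t _ d0.
have [y Ny q'y] := NE _ _ q't; exists y; first by exists t.
rewrite (le_lt_trans (metric_triangle _ q' _))// [e]splitr ltrD//.
by rewrite addrC subrK in qq'.
Qed.

Variables (U : metricType R) (hU : urysohn_universal U).

Lemma family_embedding (T : tbMet R) (Q : proper_submetry T)
    (A : set (ps_total Q)) (phi : ps_total Q -> U) : compact A ->
  (forall x y, A x -> A y -> mdist (phi x) (phi y) = mdist x y) ->
  exists2 psi : ps_total Q -> U, is_isometry psi & forall a, A a -> psi a = phi a.
Proof.
move=> cA phiA; have [[x0]|X0] := pselect (inhabited (ps_total Q)); last first.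
  by exists phi => // x; case: X0.
have [s sD] := totally_bounded_dense_seq x0 (@proper_submetry_totally_bounded T Q).
by apply: (urysohn_extension hU _ phiA sD); exact: compact_totally_bounded.
Qed.

(** The submetry property is the Hausdorff bound for the images of the fibers. The map back to [Q]
    is isometric because [Q] is 1-Lipschitz, so the coordinate in [T] never exceeds the other one in
    the maximum. *)
Lemma family_chart (T : metricType R) (Q : proper_submetry T)
    (psi : ps_total Q -> U) : is_isometry psi ->
  exists (f : lip1 T (Cpt U)) (c : cart_square (cpt_family f) Q),
  [/\ forall t, sval (f t) = psi @` (Q @^-1` [set t]), sq_base c = lip_id T &
      forall p : cpt_total f, psi (sq_top c p) = (sval p).1].
Proof.
move=> ipsi; have /submetryP[Qs Qd] := ps_submetry Q.
have KP t : compact (psi @` (Q @^-1` [set t])) /\ psi @` (Q @^-1` [set t]) !=set0.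
  split; last by have [q qt] := Qs t; exists (psi q), q.
  have pl x y : mdist (psi x) (psi y) <= mdist x y by rewrite ipsi.
  apply: (@continuous_compact _ _ (Lip1 pl)); last exact: (proj2 (ps_proper Q)).
  by apply: continuous_subspaceT; exact: lip_continuous.
pose f0 t : Cpt U := exist _ _ (KP t).
have fl t t' : mdist (f0 t) (f0 t') <= mdist t t'.
  apply/cpt_dist_le; split=> _ [q /= qt <-] e e0.
    have [q' q't qq'] := Qd q t' e e0.
    by exists (psi q'); [exists q'|rewrite ipsi -qt].
  have [q' q't qq'] := Qd q t e e0.
  by exists (psi q'); [exists q'|rewrite ipsi -qt [mdist t _]metric_sym].
pose f := Lip1 fl; exists f.
have topP (p : cpt_total f) : exists q, Q q = (sval p).2 /\ psi q = (sval p).1.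
  by case: p => -[u t] [q /= qt qu]; exists q.
pose top p := sval (cid (topP p)).
have topQ p : Q (top p) = (sval p).2 by rewrite /top; case: cid => ? [].
have topE p : psi (top p) = (sval p).1 by rewrite /top; case: cid => ? [].
have [||p|c [c1 cE]] := @vertical_square _ _ (cpt_family f) Q top.
- move=> p q; rewrite [RHS]/mdist /= [RHS]/mdist /= -!topE -!topQ ipsi max_l //.
  exact: lip_le.
- move=> q; have h : sval (f (Q q)) (psi q) by exists q.
  exists (exist _ (psi q, Q q) h : cpt_total f).
  by apply: mdist_positivity; rewrite -ipsi topE /= mdistxx.
- exact: topQ.
by exists c; split=> // p; rewrite cE.
Qed.

Let pi := urysohn_chart U.

Lemma urysohn_chart_surj (T : tbMet R) (Q : GH R T) :
  exists (f : met (Cpt U) T) (c : fhom (GH R) (pi T f) Q), fbase c = idc T.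
Proof.
have [u0] := urysohn_nonempty hU.
have [|//|psi ipsi _] := @family_embedding T Q set0 (fun=> u0).
  exact: compact0.
by have [f [c [_ c1 _]]] := family_chart ipsi; exists f, c.
Qed.

Lemma lip_idE (X Y : metricType R) (f : lip1 X Y) : f = lip_comp (lip_id Y) f.
Proof. exact: lip1_eq. Qed.

Lemma met_presheaf_universal (T : tbMet R) (S : tbMet R)
  (x : met_presheaf T S) :
  exists! g : chom S T, x = res (met_presheaf T) g (lip_id T : met_presheaf T T).
Proof.
exists x; split; first exact: lip1_eq.
by move=> g ->; exact: lip1_eq.
Qed.

(** The universal element is sent to [lip_comp f (lip_id T)], which equals [f] only propositionally;
    hence the cast, along any proof [e]. *)
Lemma chart_yoneda (T : tbMet R) (y : fmor (met T) (GH R))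
    (f : lip1 T (Cpt U))
    (c : fhom (GH R) (pi T f) (y T (lip_id T : met_presheaf T T))) :
  fbase c = idc T ->
  exists a : fmor2 (pi ⊙ met_map f) y, forall e,
    a T (lip_id T : met_presheaf T T) =
    c ⊚ mhom pi (@el_cast _ (met_presheaf (Cpt U)) T _ f e).
Proof.
move=> c1; have e0 : lip_comp f (lip_id T) = f by exact: lip1_eq.
have [|a aE] := yoneda_hom (@met_presheaf_universal T)
  (G := pi ⊙ met_map f) (H := y)
  (theta := c ⊚ mhom pi (@el_cast _ (met_presheaf (Cpt U)) T _ f e0))
  (GH_cartesian R).
  by rewrite fbaseM c1; exact: lip1_eq.
by exists a => e; rewrite aE; congr (_ ⊚ mhom pi _); exact: el_hom_eq.
Qed.

Lemma chart_iso2 (T : tbMet R) (y : fmor (met T) (GH R)) :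
  exists f : lip1 T (Cpt U), iso2 (pi ⊙ met_map f) y.
Proof.
have [f [c c1]] := urysohn_chart_surj (y T (lip_id T : met_presheaf T T)).
by exists f; have [a _] := chart_yoneda c1.
Qed.

(** [x] is a compact set [K0], and [alpha] identifies it, through [c], with the fiber over [two0 s]
    of the family [Q] given by [g]. Extending this embedding of the fiber to all of [Q] gives a map
    [f] on [two s] with value [K0] at [two0 s], and [h] is its composite with [iota]. *)
Lemma urysohn_chart_lift (r s : R) (rs : 0 < s < r)
    (x : fmor (met (pt R)) (met (Cpt U))) (g : fmor (met (two s)) (GH R))
    (alpha : fmor2 (pi ⊙ x) (g ⊙ met_map (iota0 s))) :
  exists (h : fmor (met (two r)) (met (Cpt U)))
    (beta : fmor2 (h ⊙ met_map (iota0 r)) x)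
    (gamma : fmor2 (pi ⊙ h) (g ⊙ met_map (Defs.iota rs))),
  forall (T : tbMet R) (t : met (pt R) T),
    alpha T t ⊚ mhom pi (beta T t) =
    mhom g (el_cast (iota_iota0 rs t)) ⊚ gamma T (met_map (iota0 r) T t).
Proof.
pose T2 := tb_two s; pose T1 := tb_pt R.
pose id2 : met (two s) T2 := lip_id (two s).
pose id1 : met (pt R) T1 := lip_id (pt R).
pose Q : GH R T2 := g T2 id2.
pose K0 : lip1 (pt R) (Cpt U) := x T1 id1.
pose cl T (t : met (two s) T) : fhom (met (two s)) t id2 :=
  @el_hom _ (met_presheaf (two s)) T T2 t t id2
    (lip_idE t).
pose cl1 T (t : met (pt R) T) : fhom (met (pt R)) t id1 :=
  @el_hom _ (met_presheaf (pt R)) T T1 t t id1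
    (lip_idE t).
pose c : fhom (GH R) (pi T1 K0) Q :=
  mhom g (cl T1 (met_map (iota0 s) T1 id1)) ⊚ alpha T1 id1.
have cb (z : pt R) : sq_base c z = two0 s.
  have E : fbase c = iota0 s :> lip1 (pt R) (two s).
    by rewrite fbaseM (comp2_base alpha id1) (mhom_base g); exact: lip1_eq.
  exact: (congr1 (fun k : lip1 (pt R) (two s) => k z) E).
pose A := Q @^-1` [set two0 s].
have [phi phiE] : exists phi : ps_total Q -> U,
    forall p : cpt_total K0, phi (sq_top c p) = (sval p).1.
  have [u0] := urysohn_nonempty hU.
  exists (fun q => xget u0 [set u | exists p : cpt_total K0,
    sq_top c p = q /\ (sval p).1 = u]).
  move=> p; case: xgetP => [u _ [p' [pp' <-]]|/(_ (sval p).1) []].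
    congr (fst (sval _)); apply: square_inj pp' _.
    by rewrite [LHS]pt_eq [RHS]pt_eq.
  by exists p.
have cA p : A (sq_top c p) by exact: etrans (sq_comm c p) (cb _).
have Ac q : A q -> exists p, sq_top c p = q.
  move=> Aq; have [|p pq _] := @square_lift _ _ _ _ _ c q (pt0 R); last by exists p.
  by rewrite cb.
have phiA y z : A y -> A z -> mdist (phi y) (phi z) = mdist y z.
  move=> /Ac[p <-] /Ac[p' <-]; rewrite !phiE.
  transitivity (mdist p p').
    rewrite [RHS]/mdist /= [RHS]/mdist /= [(sval p).2]pt_eq [(sval p').2]pt_eq.
    by rewrite mdistxx max_l // mdist_ge0.
  rewrite (square_dist c) [cpt_proj _ p]pt_eq [cpt_proj _ p']pt_eq.
  by rewrite mdistxx max_l // mdist_ge0.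
have [psi ipsi psiA] := @family_embedding T2 Q A phi (proj2 (ps_proper Q) _) phiA.
have [f [theta [fE theta1 thetaE]]] := family_chart ipsi.
pose th : fhom (GH R) (pi T2 (f : met (Cpt U) T2)) Q := theta.
have [a aE] := @chart_yoneda T2 g f th theta1.
have psic p : psi (sq_top c p) = (sval p).1.
  by rewrite psiA ?phiE.
have fK0 (z : pt R) : f (two0 s) = K0 z.
  apply: sig_eq; rewrite fE [z]pt_eq; apply/seteqP; split=> [u [q /= /Ac[p <-]]|u Ku].
    by rewrite psic => <-; move: (svalP p); rewrite /= [(sval p).2]pt_eq.
  exists (sq_top c (exist _ (u, pt0 R) Ku : cpt_total K0)); last exact: psic.
  exact: cA.
have xE T (t : met (pt R) T) : x T t = lip_comp K0 t :> lip1 T (Cpt U).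
  have e := svalP (mhom x (cl1 T t)).
  rewrite (_ : sval _ = t) in e; first exact: e.
  exact: (mhom_base x (cl1 T t)).
pose h := met_map f ⊙ met_map (Defs.iota rs).
have hE T (t : met (pt R) T) :
    (h ⊙ met_map (iota0 r)) T t = x T t :> met_presheaf (Cpt U) T.
  apply: (etrans _ (esym (xE T t))); apply: lip1_eq => z /=.
  by rewrite /iota_fun /= eqxx; exact: fK0.
pose b T (t : met (pt R) T) : fhom (met (Cpt U)) ((h ⊙ met_map (iota0 r)) T t) (x T t) :=
  @el_cast _ (met_presheaf (Cpt U)) T _ _ (hE T t).
have bN T T' (t : met (pt R) T) (t' : met (pt R) T') (k : fhom _ t t') :
    b T' t' ⊚ mhom (h ⊙ met_map (iota0 r)) k = mhom x k ⊚ b T t.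
  by apply: el_hom_eq; rewrite !fbaseM !mhom_base; exact: lip1_eq.
exists h, (@Fmor2 _ _ _ (h ⊙ met_map (iota0 r)) x b (fun _ _ => erefl) bN).
pose gm := whiskerr a (met_map (Defs.iota rs)).
exists (@Fmor2 _ _ _ (pi ⊙ h) (g ⊙ met_map (Defs.iota rs)) gm (comp2_base gm)
  (@comp2_nat _ _ _ _ _ gm)).
move=> T t; pose j := met_map (Defs.iota rs) T (met_map (iota0 r) T t).
suff : alpha T t ⊚ mhom pi (b T t) =
  mhom g (el_cast (iota_iota0 rs t)) ⊚ a T j by [].
(* Both sides are pushed forward to [Q], where the injective map [psi] reduces the equation to first
   coordinates in [U]. *)
apply: (cart_inj (@GH_cartesian R)
  (phi := mhom g (cl T (met_map (iota0 s) T t)))).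
  rewrite !fbaseM (comp2_base alpha t) (comp2_base a j) !mhom_base.
  exact: lip1_eq.
have e1 : cl T (met_map (iota0 s) T t) =
    cl T1 (met_map (iota0 s) T1 id1) ⊚ mhom (met_map (iota0 s)) (cl1 T t).
  by apply: el_hom_eq; exact: lip1_eq.
have e2 : cl T (met_map (iota0 s) T t) ⊚ el_cast (iota_iota0 rs t) = cl T j.
  apply: el_hom_eq; apply: (@lip1_eq _ T (two s)) => z.
  by rewrite /= /iota_fun /= eqxx.
have L : mhom g (cl T (met_map (iota0 s) T t)) ⊚ alpha T t =
    c ⊚ mhom pi (mhom x (cl1 T t)).
  by rewrite e1 mhomM -fcompA -(comp2_nat alpha) fcompA.
have e3 : lip_comp f (lip_id (two s)) = f by exact: lip1_eq.
have Rr : mhom g (cl T j) ⊚ a T j =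
    th ⊚ mhom pi (@el_cast _ (met_presheaf (Cpt U)) T2 _ f e3) ⊚
    mhom (pi ⊙ met_map f) (cl T j).
  by rewrite -(aE e3) -(comp2_nat a).
rewrite fcompA L fcompA -mhomM e2 Rr.
apply: cart_square_eq => [p|z]; last first.
  apply: (etrans (cb _)); apply: esym.
  have E k : sq_base th k = k by move: theta1 => /= ->.
  by apply: (etrans (E _)); rewrite /= /iota_fun /= eqxx.
apply: mdist_positivity; rewrite -ipsi.
set l := sq_top _ _; set l' := sq_top _ _.
suff -> : psi l = psi l' by exact: mdistxx.
apply: (etrans (psic _)); apply: esym; exact: (etrans (thetaE _)).
Qed.

Lemma urysohn_chart_formal_submetry : formal_submetry pi.
Proof.
split=> [y|r s rs x g alpha]; last exact: urysohn_chart_lift.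
have [f [a]] := @chart_iso2 (tb_pt R) y.
by exists (met_map f); constructor; exact: a.
Qed.

Lemma GH_quotient_type : quotient_type (GH R).
Proof.
exists (Cpt U), pi; split; first exact: urysohn_chart_formal_submetry.
move=> T t; exists unit, (fun=> T), (fun=> idc T); split.
  exact: lsm_covering_id.
move=> _; have [f fE] := @chart_iso2 T (t ⊙ met_map (lip_id T)).
by exists (met_map f).
Qed.

End Families.

(** The quotient stack is specified by its universal property, hence the assertion for every [Q] and
    [eta] and the separate existence clause, for which [GH R] with [cech_mor] serves. *)
Theorem corollary5p13 (R : realType) (U : metricType R)
    (hU : urysohn_universal U) :
  let pi := urysohn_chart U in
  let G := cech_groupoid pi (GH_cartesian R) in
  [/\ is_sheaf (C := tbMet_lsm R) (gob G),
      is_sheaf (C := tbMet_lsm R) (garr G),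
      (exists (Q : catover (tbMet R)) (eta : fmor (gpd_catover G) Q),
         is_quotient_stack (C := tbMet_lsm R) eta),
      (forall (Q : catover (tbMet R)) (eta : fmor (gpd_catover G) Q),
         is_quotient_stack (C := tbMet_lsm R) eta ->
         (exists Phi : fmor Q (GH R), is_natural_morphism eta Phi) /\
         (forall Phi : fmor Q (GH R),
            is_natural_morphism eta Phi -> is_equivalence Phi))
    & naive_metric_stack (GH R) /\ quotient_type (GH R)].
Proof.
move=> pi G; have sGH := @GH_stack R; have stC := @lsm_stable R.
have st : is_stackification (C := tbMet_lsm R) (cech_mor pi (GH_cartesian R)).
  apply: cech_stackification => // T Q.
  exists unit, (fun=> T), (fun=> idc T); split; first exact: lsm_covering_id.
  by move=> _; exact: urysohn_chart_surj.
split.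
- exact: met_presheaf_sheaf.
- by apply: cech_arr_sheaf => //; exact: met_presheaf_sheaf.
- by exists (GH R), (cech_mor pi (GH_cartesian R)).
- move=> Q eta sQ; split.
    exact: (proj2 sQ _ sGH).1.
  by move=> Phi nPhi; exact: (stackification_equivalence sQ st nPhi).
- split; last exact: (GH_quotient_type hU).
  split=> //; exists (Cpt U), pi; exact: urysohn_chart_formal_submetry.
Qed.
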